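(* Let $N$ be a positive integer and let $f$ be a bounded measurable function on the unit disk $\mathbb{D}$ whose polar decomposition is truncated above at $N$, i.e. $f(re^{i\theta})=\sum_{k=-\infty}^{N}e^{ik\theta}f_k(r)$, where the $f_k$ are radial functions. If $T_f T_{z^2+\bar z^2}=T_{z^2+\bar z^2}T_f$ on the analytic Bergman space $L^2_a(\mathbb{D})$, then $T_f$ is a polynomial of degree at most one in $T_{z^2+\bar z^2}$. In other words, there exist constants $c_2,c_0\in\mathbb{C}$ such that $f(z)=c_2(z^2+\bar z^2)+c_0$ (for almost every $z\in\mathbb{D}$).
   Context: $\mathbb{D}$ is the open unit disk in $\mathbb{C}$ and $dA=r\,dr\,\frac{d\theta}{\pi}$ is normalized Lebesgue area measure on $\mathbb{D}$. The analytic Bergman space $L^2_a(\mathbb{D})$ is the closed subspace of $L^2(\mathbb{D},dA)$ consisting of analytic functions, and $P:L^2(\mathbb{D},dA)\to L^2_a(\mathbb{D})$ is the orthogonal projection. For a bounded measurable function $f$ on $\mathbb{D}$, the Toeplitz operator with symbol $f$ is $T_f:L^2_a(\mathbb{D})\to L^2_a(\mathbb{D})$, $T_f(u)=P(fu)$. Products of operators are compositions. Every $f\in L^2(\mathbb{D},dA)$ has a unique polar decomposition $f(re^{i\theta})=\sum_{k\in\mathbb{Z}}e^{ik\theta}f_k(r)$ (orthogonal expansion converging in $L^2(\mathbb{D},dA)$) with radial functions $f_k\in L^2([0,1],r\,dr)$. Truncated above at $N$ means $f_k=0$ for all $k>N$. Symbols are identified when equal almost everywhere. *)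

(* Defs.v *)
(* MathComp-Analysis; R[i] is the field of complex numbers over R : realType. *)
From mathcomp Require Export all_boot all_order all_algebra.
From mathcomp Require Export all_classical all_reals all_analysis.
From mathcomp Require Export measurable_realfun.
From mathcomp.real_closed Require Export complex.
Export Order.TTheory GRing.Theory Num.Theory.
Export numFieldNormedType.Exports.

Set Implicit Arguments.
Unset Strict Implicit.
Unset Printing Implicit Defensive.

Local Open Scope classical_set_scope.
Local Open Scope ring_scope.
Local Open Scope complex_scope.

(* Functions on the disk are total functions R[i] -> R[i] of which only the
   values on unit_disk matter. *)
Definition unit_disk (R : realType) : set R[i] := [set z | `|z| < 1].

(* Borel measurability, under the identification of R[i] with R * R. *)
Definition disk_measurable (R : realType) (F : R[i] -> R[i]) : Prop :=
  let D := [set p : measurableTypeR R * measurableTypeR R | unit_disk (p.1 +i* p.2)] in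
  measurable_fun D (fun p => complex.Re (F (p.1 +i* p.2))) /\
  measurable_fun D (fun p => complex.Im (F (p.1 +i* p.2))).

Definition cis (R : realType) (t : R) : R[i] := cos t +i* sin t.

(* p = (r, theta) is sent to r e^{i theta}. *)
Definition polar (R : realType) (p : R * R) : R[i] := p.1%:C * cis p.2.

Definition polar_rect (R : realType) : set (R * R) :=
  `[0, 1[%classic `*` `[0, 2 * pi[%classic.

Definition leb2 (R : realType) :
    {measure set (measurableTypeR R * measurableTypeR R) -> \bar R} :=
  ((@lebesgue_measure R) \x (@lebesgue_measure R))%E.

(* Integration against dA = r dr dtheta / pi is written in polar coordinates;
   G is a function of (r, theta). *)
Definition polar_sqnorm (R : realType) (G : R * R -> R[i]) : \bar R :=
  (\int[@leb2 R]_(p in @polar_rect R)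
     (Normc.normc (G p) ^+ 2 * p.1 / pi)%:E)%E.

Definition area_sqnorm (R : realType) (F : R[i] -> R[i]) : \bar R :=
  polar_sqnorm (F \o @polar R).

Definition area_integral (R : realType) (F : R[i] -> R[i]) : R[i] :=
  (\int[@leb2 R]_(p in @polar_rect R) (complex.Re (F (polar p)) * p.1 / pi)) +i*
  (\int[@leb2 R]_(p in @polar_rect R) (complex.Im (F (polar p)) * p.1 / pi)).

(* The density r / pi vanishes only on a null set, so dA-almost everywhere on
   the disk is almost everywhere in (r, theta). *)
Definition ae_disk (R : realType) (Q : R[i] -> Prop) : Prop :=
  {ae @leb2 R, forall p, polar_rect p -> Q (polar p)}.

Definition L2_disk (R : realType) (F : R[i] -> R[i]) : Prop :=
  disk_measurable F /\ (area_sqnorm F < +oo)%E.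

Definition L2_inner (R : realType) (F G : R[i] -> R[i]) : R[i] :=
  area_integral (fun z => F z * conjc (G z)).

(* Over the field R[i], derivability in the direction 1 is complex
   differentiability. *)
Definition analytic_disk (R : realType) (u : R[i] -> R[i]) : Prop :=
  forall z : R[i], unit_disk z -> derivable (u : R[i]^o -> R[i]^o) z 1.

Definition bergman (R : realType) (u : R[i] -> R[i]) : Prop :=
  L2_disk u /\ analytic_disk u.

Definition is_bergman_proj (R : realType) (F h : R[i] -> R[i]) : Prop :=
  bergman h /\
  forall v, bergman v -> L2_inner (fun z => F z - h z) v = 0.

(* The orthogonal projection of L^2(D, dA) onto the Bergman space.  On the disk
   its value is determined by is_bergman_proj; the default value 0 is only
   reached by functions F having no orthogonal projection, hence by no F in
   L^2(D, dA). *)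
Definition bergman_proj (R : realType) (F : R[i] -> R[i]) : R[i] -> R[i] :=
  xget (fun=> 0) [set h | is_bergman_proj F h].

Definition toeplitz (R : realType) (f u : R[i] -> R[i]) : R[i] -> R[i] :=
  bergman_proj (fun z => f z * u z).

(* z^2 + \bar z^2 *)
Definition quad_symbol (R : realType) (z : R[i]) : R[i] :=
  z ^+ 2 + conjc z ^+ 2.

Definition bounded_disk (R : realType) (f : R[i] -> R[i]) : Prop :=
  exists M : R, forall z, unit_disk z -> Normc.normc (f z) <= M.

Definition L2_radial (R : realType) (g : R -> R[i]) : Prop :=
  [/\ measurable_fun (`[0, 1]%classic : set R) (fun r => complex.Re (g r)),
      measurable_fun (`[0, 1]%classic : set R) (fun r => complex.Im (g r)) &
      (\int[@lebesgue_measure R]_(r in `[0%R, 1%R]%classic)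
         (Normc.normc (g r) ^+ 2 * r)%:E < +oo)%E].

(* \sum_(-n <= k <= n) e^{i k theta} (fk k)(r) *)
Definition polar_partial_sum (R : realType) (fk : int -> R -> R[i]) (n : nat)
    (p : R * R) : R[i] :=
  \sum_(j < n.*2.+1)
     let k := (Posz j - Posz n)%R in cis (k%:~R * p.2) * fk k p.1.

Definition polar_decomposition (R : realType) (f : R[i] -> R[i])
    (fk : int -> R -> R[i]) : Prop :=
  (forall k, L2_radial (fk k)) /\
  (fun n => polar_sqnorm (fun p => f (polar p) - polar_partial_sum fk n p))
    @ \oo --> 0%E.

Definition truncated_above (R : realType) (N : nat) (f : R[i] -> R[i]) : Prop :=
  exists fk : int -> R -> R[i], polar_decomposition f fk /\
    forall k : int, (Posz N < k)%R ->
      {ae @lebesgue_measure R, forall r : R, (0 <= r <= 1)%R -> fk k r = 0}.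

(* Main.v *)
(** The commutation relation is read off the matrix of T_f in the orthogonal basis (z^n) of
    the Bergman space: with A(n, m) = (m + 1) <f z^n, z^m>, it is a recurrence linking each
    diagonal m - n = K to the diagonals K + 4, K - 4 and K. Truncation at N gives A = 0 for
    m - n > N. Two analytic facts about bounded symbols close the recurrence: A(n + 1, m + 1) -
    A(n, m) = O(1 / (n + m + 1)), and along a diagonal the entries of index 2 l are moments
    in r^(4 l), so their alternating binomial sums tend to 0, which prevents a sequence
    derived from them from being supported at l = 0. Descending on K >= 3, the highest
    nonzero diagonal is constant, and substituting it in the diagonal K - 4 produces such a
    sequence, so the constant is 0. The diagonals K = 2 and K = 0 are constant and are those of
    c2 (z^2 + conj z ^2) + c0; for K = 1 the diagonal -3 would not be regular unless it
    vanishes. What remains has no entries with m >= n, and then no entries at all.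

    A bounded symbol all of whose entries vanish has Fourier slices orthogonal to all
    r^(|k| + 2 j); these slices vanish almost everywhere since the indicator of r < x is a
    bounded pointwise limit of polynomials in r^2.

    The projection onto the Bergman space is realised by the power series
    sum (n + 1) <F, z^n> z^n; that every Bergman function is the sum of such a series goes
    through a Goursat argument in the logarithmic coordinate, where r e^(i t) becomes
    (log r, t) and circles become segments. *)
Require Import Defs.
From mathcomp Require Import ring lra zify.

Set Implicit Arguments.
Unset Strict Implicit.
Unset Printing Implicit Defensive.

Local Open Scope classical_set_scope.
Local Open Scope ring_scope.
Local Open Scope complex_scope.

(** * Complex numbers *)

Section ComplexNumbers.
Context {R : realType}.
Implicit Types z w : R[i].

(** The factor m + 1 normalises the recurrence so that a leading diagonal is constant: the
    coefficient of A(n, m - 2) becomes 1, while the bare entries decay like 1 / (n + m). As the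
    symbol moves indices by two, a diagonal splits into its even and odd entries, and the estimate
    on A(n + 1, m + 1) - A(n, m) is what ties the two halves together. The sequence supported at l =
    0 comes from the edge of the matrix: the lowering part of the symbol has weight (n - 1) / (n +
    1), which must be replaced by 0 at n = 0 where the formula gives -1; the defect is minus the
    constant of the diagonal. The moments have to be those of a bounded density, and K = 3 is the
    borderline case, where the density does not vanish at r = 0. Analyticity is given as mere
    differentiability at each point, hence Goursat; the Cauchy quotient is only known to be
    continuous at its centre, hence a version with one exceptional point. That point has to be
    interior to a rectangle in the logarithmic coordinate, so expansions are first obtained off the
    ray theta = 0 and then extended by null sets or by continuity. *)

Lemma ReD z w : complex.Re (z + w) = complex.Re z + complex.Re w.
Proof. by case: z; case: w. Qed.

Lemma ImD z w : complex.Im (z + w) = complex.Im z + complex.Im w.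
Proof. by case: z; case: w. Qed.

Lemma ReN z : complex.Re (- z) = - complex.Re z.
Proof. by case: z. Qed.

Lemma ImN z : complex.Im (- z) = - complex.Im z.
Proof. by case: z. Qed.

Lemma ReM z w :
  complex.Re (z * w) = complex.Re z * complex.Re w - complex.Im z * complex.Im w.
Proof. by case: z; case: w. Qed.

Lemma ImM z w :
  complex.Im (z * w) = complex.Re z * complex.Im w + complex.Im z * complex.Re w.
Proof. by case: z => a b; case: w => c d /=; rewrite [b * c]mulrC. Qed.

Lemma Re_conj z : complex.Re (conjc z) = complex.Re z.
Proof. by case: z. Qed.

Lemma Im_conj z : complex.Im (conjc z) = - complex.Im z.
Proof. by case: z. Qed.

Lemma conjcD z w : conjc (z + w) = conjc z + conjc w.
Proof. exact: rmorphD. Qed.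

Lemma conjcB z w : conjc (z - w) = conjc z - conjc w.
Proof. exact: rmorphB. Qed.

Lemma conjcM z w : conjc (z * w) = conjc z * conjc w.
Proof. exact: rmorphM. Qed.

Lemma conjcX z n : conjc (z ^+ n) = conjc z ^+ n.
Proof. exact: rmorphXn. Qed.

Lemma conjc_sum (I : Type) (s : seq I) (P : pred I) (F : I -> R[i]) :
  conjc (\sum_(i <- s | P i) F i) = \sum_(i <- s | P i) conjc (F i).
Proof. exact: rmorph_sum. Qed.

Lemma eq_ReIm z w :
  complex.Re z = complex.Re w -> complex.Im z = complex.Im w -> z = w.
Proof. by case: z => a b; case: w => c d /= -> ->. Qed.

Lemma normc_ge0 z : 0 <= Normc.normc z.
Proof. by case: z => a b; rewrite sqrtr_ge0. Qed.

Lemma normc_sqr z : Normc.normc z ^+ 2 = complex.Re z ^+ 2 + complex.Im z ^+ 2.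
Proof. by case: z => a b /=; rewrite sqr_sqrtr // addr_ge0 ?sqr_ge0. Qed.

Lemma Re_le_normc z : `|complex.Re z| <= Normc.normc z.
Proof.
by rewrite -ler_sqr ?nnegrE ?normc_ge0// normc_sqr real_normK ?num_real// lerDl
  sqr_ge0.
Qed.

Lemma Im_le_normc z : `|complex.Im z| <= Normc.normc z.
Proof.
by rewrite -ler_sqr ?nnegrE ?normc_ge0// normc_sqr real_normK ?num_real// lerDr
  sqr_ge0.
Qed.

Lemma normcE_abs z : `|z| = (Normc.normc z)%:C.
Proof. by []. Qed.

Lemma normcR (x : R) : Normc.normc x%:C = `|x|.
Proof. by rewrite /= expr0n addr0 sqrtr_sqr. Qed.

Lemma normc_conj z : Normc.normc (conjc z) = Normc.normc z.
Proof. by case: z => a b /=; rewrite sqrrN. Qed.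

Lemma normc_opp z : Normc.normc (- z) = Normc.normc z.
Proof. by case: z => a b /=; rewrite !sqrrN. Qed.

Lemma normc_dist z w : Normc.normc (z - w) = Normc.normc (w - z).
Proof. by rewrite -normc_opp opprB. Qed.

Lemma normc_triangle z w : Normc.normc (z + w) <= Normc.normc z + Normc.normc w.
Proof. exact: le_normcD. Qed.

Lemma normc_triangleB z w : Normc.normc (z - w) <= Normc.normc z + Normc.normc w.
Proof. by rewrite -(normc_opp w) normc_triangle. Qed.

Lemma normc_le_ReIm z : Normc.normc z <= `|complex.Re z| + `|complex.Im z|.
Proof.
rewrite -ler_sqr ?nnegrE ?normc_ge0 ?addr_ge0// normc_sqr sqrrD !real_normK ?num_real//.
by rewrite -addrA [_ *+ 2 + _]addrC addrA lerDl mulrn_wge0// mulr_ge0.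
Qed.

Lemma normcX z n : Normc.normc (z ^+ n) = Normc.normc z ^+ n.
Proof.
elim: n => [|n IH]; first by rewrite !expr0 Normc.normc1.
by rewrite !exprS Normc.normcM IH.
Qed.

Lemma normc0E : Normc.normc (0 : R[i]) = 0.
Proof. exact: Normc.normc0. Qed.

Lemma normc_sum (I : Type) (s : seq I) (P : pred I) (F : I -> R[i]) :
  Normc.normc (\sum_(i <- s | P i) F i) <= \sum_(i <- s | P i) Normc.normc (F i).
Proof.
elim/big_rec2: _ => [|i x y _ h]; first by rewrite normc0E.
by rewrite (le_trans (normc_triangle _ _))// lerD2l.
Qed.

Lemma mul_conj_normc z : z * conjc z = (Normc.normc z ^+ 2)%:C.
Proof. by apply: eq_ReIm; rewrite ?ReM ?ImM ?Re_conj ?Im_conj ?normc_sqr/=; ring. Qed.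

Lemma normc_gt0 z : z != 0 -> 0 < Normc.normc z.
Proof.
move=> z0; rewrite lt_neqAle normc_ge0 andbT; apply: contra_neq z0 => /esym.
exact: Normc.eq0_normc.
Qed.

Lemma normc_cis (t : R) : Normc.normc (cis t) = 1.
Proof. by rewrite /= cos2Dsin2 sqrtr1. Qed.

Lemma cisD (s t : R) : cis (s + t) = cis s * cis t.
Proof. by apply: eq_ReIm; rewrite ?ReM ?ImM /= ?cosD ?sinD; ring. Qed.

Lemma cisN (t : R) : cis (- t) = conjc (cis t).
Proof. by rewrite /cis cosN sinN. Qed.

Lemma cis0 : cis (0 : R) = 1.
Proof. by rewrite /cis cos0 sin0. Qed.

Lemma cisX (t : R) n : cis t ^+ n = cis (n%:R * t).
Proof.
elim: n => [|n IH]; first by rewrite expr0 mul0r cis0.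
by rewrite exprS IH -cisD -[n.+1]addn1 natrD mulrDl mul1r addrC.
Qed.

Lemma complexRM (x y : R) : (x * y)%:C = x%:C * y%:C :> R[i].
Proof. exact: rmorphM. Qed.

Definition ccvg (u : nat -> R[i]) (l : R[i]) :=
  (fun n => Normc.normc (u n - l)) @ \oo --> (0 : R).

Lemma squeeze0 (u v : nat -> R) : (forall n, 0 <= u n <= v n) ->
  v @ \oo --> (0 : R) -> u @ \oo --> (0 : R).
Proof.
move=> uv v0; apply: (squeeze_cvgr (f := cst 0) (h := v)) => //; last exact: cvg_cst.
by near=> n; rewrite /=; exact: uv.
Unshelve. all: by end_near. Qed.

Lemma ccvg_le (u : nat -> R[i]) l (v : nat -> R) :
  (forall n, Normc.normc (u n - l) <= v n) -> v @ \oo --> (0 : R) -> ccvg u l.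
Proof. by move=> h v0; apply: squeeze0 v0 => n; rewrite normc_ge0 h. Qed.

Lemma ccvgD u v l k : ccvg u l -> ccvg v k -> ccvg (fun n => u n + v n) (l + k).
Proof.
move=> ul vk; apply: (ccvg_le (v := fun n => Normc.normc (u n - l) + Normc.normc (v n - k))).
  by move=> n; rewrite opprD addrACA normc_triangle.
by rewrite -[X in _ --> X]addr0; exact: cvgD.
Qed.

Lemma ccvgZ c u l : ccvg u l -> ccvg (fun n => c * u n) (c * l).
Proof.
move=> ul; apply: (ccvg_le (v := fun n => Normc.normc c * Normc.normc (u n - l))).
  by move=> n; rewrite -mulrBr Normc.normcM.
by rewrite -[X in _ --> X](mulr0 (Normc.normc c)); apply: cvgM => //; exact: cvg_cst.
Qed.

Lemma ccvgN u l : ccvg u l -> ccvg (fun n => - u n) (- l).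
Proof.
move=> ul; apply: (ccvg_le (v := fun n => Normc.normc (u n - l))) => // n.
by rewrite -opprD normc_opp.
Qed.

Lemma ccvgB u v l k : ccvg u l -> ccvg v k -> ccvg (fun n => u n - v n) (l - k).
Proof. by move=> ul vk; apply: ccvgD => //; exact: ccvgN. Qed.

Lemma ccvg_cst c : ccvg (fun=> c) c.
Proof. by rewrite /ccvg subrr normc0E; exact: cvg_cst. Qed.

Lemma ccvg_normc u l : ccvg u l -> (fun n => Normc.normc (u n)) @ \oo --> Normc.normc l.
Proof.
move=> ul; apply/cvgrPdistC_lt => e e0.
have [N _ h] := (cvgr0Pnorm_lt (fun n => Normc.normc (u n - l))).1 ul _ e0.
exists N => // n Nn; have := h n Nn; rewrite ger0_norm ?normc_ge0// => /=.
apply: le_lt_trans; rewrite ler_norml; apply/andP; split.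
  rewrite lerBrDr addrC lerBlDr normc_dist addrC.
  by rewrite (le_trans _ (normc_triangle _ _))// subrK.
by rewrite lerBlDr (le_trans _ (normc_triangle _ _))// subrK.
Qed.

Lemma ccvg_unique u l k : ccvg u l -> ccvg u k -> l = k.
Proof.
move=> ul uk; have := ccvgB ul uk.
under eq_fun do rewrite subrr.
move=> h; have h2 := ccvg_normc h; have e : Normc.normc (l - k) = 0.
  by rewrite -(cvg_lim _ h2)// normc0E lim_cst.
by apply/eqP; rewrite -subr_eq0; apply/eqP; exact: Normc.eq0_normc.
Qed.

Lemma ccvg_shift u l k : ccvg u l -> ccvg (fun n => u (n + k)%N) l.
Proof. by move=> ul; rewrite /ccvg; apply: (cvg_comp (fun n => (n + k)%N)) ul; exact: cvg_addnr. Qed.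

End ComplexNumbers.

Arguments Normc.normc : simpl never.

(** * Complex-valued integrals *)

Section ComplexIntegral.
Context d (T : measurableType d) (R : realType).
Variables (mu : {measure set T -> \bar R}) (D : set T).
Hypothesis mD : measurable D.
Implicit Types F G : T -> R[i].

Definition cmeas F :=
  measurable_fun D (fun x => complex.Re (F x)) /\
  measurable_fun D (fun x => complex.Im (F x)).

Definition cintegrable F :=
  mu.-integrable D (EFin \o (fun x => complex.Re (F x))) /\
  mu.-integrable D (EFin \o (fun x => complex.Im (F x))).

Definition cint F : R[i] :=
  (\int[mu]_(x in D) complex.Re (F x)) +i* (\int[mu]_(x in D) complex.Im (F x)).

Lemma eq_cint F G : (forall x, D x -> F x = G x) -> cint F = cint G.
Proof.
by move=> FG; congr (_ +i* _); apply: eq_Rintegral => x /set_mem Dx; rewrite FG.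
Qed.

Lemma eq_cmeas F G : (forall x, D x -> F x = G x) -> cmeas F -> cmeas G.
Proof.
move=> FG [h1 h2]; split.
  by apply: eq_measurable_fun h1 => x /set_mem Dx; rewrite FG.
by apply: eq_measurable_fun h2 => x /set_mem Dx; rewrite FG.
Qed.

Lemma eq_cintegrable F G : (forall x, D x -> F x = G x) ->
  cintegrable F -> cintegrable G.
Proof.
move=> FG [h1 h2]; split.
  by apply: eq_integrable h1 => // x /set_mem Dx /=; rewrite FG.
by apply: eq_integrable h2 => // x /set_mem Dx /=; rewrite FG.
Qed.

Lemma cmeas_cst c : cmeas (fun=> c).
Proof. by split; exact: measurable_cst. Qed.

Lemma cmeasD F G : cmeas F -> cmeas G -> cmeas (fun x => F x + G x).
Proof.
move=> [F1 F2] [G1 G2]; split.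
  by under eq_fun do rewrite ReD; exact: measurable_funD.
by under eq_fun do rewrite ImD; exact: measurable_funD.
Qed.

Lemma cmeasN F : cmeas F -> cmeas (fun x => - F x).
Proof.
move=> [F1 F2]; split.
  by under eq_fun do rewrite ReN; exact: measurable_funN.
by under eq_fun do rewrite ImN; exact: measurable_funN.
Qed.

Lemma cmeasB F G : cmeas F -> cmeas G -> cmeas (fun x => F x - G x).
Proof. by move=> mF mG; apply: cmeasD => //; exact: cmeasN. Qed.

Lemma cmeasM F G : cmeas F -> cmeas G -> cmeas (fun x => F x * G x).
Proof.
move=> [F1 F2] [G1 G2]; split.
  by under eq_fun do rewrite ReM; apply: measurable_funB; exact: measurable_funM.
by under eq_fun do rewrite ImM; apply: measurable_funD; exact: measurable_funM.
Qed.

Lemma cmeasX F n : cmeas F -> cmeas (fun x => F x ^+ n).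
Proof.
move=> mF; elim: n => [|n IH]; first by under eq_fun do rewrite expr0; exact: cmeas_cst.
by under eq_fun do rewrite exprS; exact: cmeasM.
Qed.

Lemma cmeas_conj F : cmeas F -> cmeas (fun x => conjc (F x)).
Proof.
move=> [F1 F2]; split.
  by under eq_fun do rewrite Re_conj.
by under eq_fun do rewrite Im_conj; exact: measurable_funN.
Qed.

Lemma cmeas_sum (I : Type) (s : seq I) (F : I -> T -> R[i]) :
  (forall i, cmeas (F i)) -> cmeas (fun x => \sum_(i <- s) F i x).
Proof.
move=> mF; elim: s => [|i s IH].
  by under eq_fun do rewrite big_nil; exact: cmeas_cst.
by under eq_fun do rewrite big_cons; exact: cmeasD.
Qed.

Lemma cmeas_real (f : T -> R) : measurable_fun D f -> cmeas (fun x => (f x)%:C).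
Proof. by move=> mf; split => //=; exact: measurable_cst. Qed.

Lemma measurable_normc F : cmeas F -> measurable_fun D (fun x => Normc.normc (F x)).
Proof.
move=> [F1 F2].
rewrite (_ : (fun x => Normc.normc (F x)) =
  (fun x => Num.sqrt (complex.Re (F x) ^+ 2 + complex.Im (F x) ^+ 2))); last first.
  by apply/funext => x; case: (F x).
apply: (measurableT_comp (continuous_measurable_fun (@sqrt_continuous R))).
by apply: measurable_funD; exact: measurable_funX.
Qed.

Lemma cintegrable_meas F : cintegrable F -> cmeas F.
Proof.
by move=> [/measurable_int/measurable_EFinP h1 /measurable_int/measurable_EFinP h2].
Qed.

Lemma cintegrable_le F (g : T -> R) : cmeas F ->
  mu.-integrable D (EFin \o g) -> (forall x, D x -> Normc.normc (F x) <= g x) ->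
  cintegrable F.
Proof.
move=> [F1 F2] ig Fg; split; apply: le_integrable ig => //; try exact/measurable_EFinP.
- move=> x Dx /=; rewrite lee_fin (le_trans (Re_le_normc _))//.
  by rewrite (le_trans (Fg _ Dx))// ler_norm.
- move=> x Dx /=; rewrite lee_fin (le_trans (Im_le_normc _))//.
  by rewrite (le_trans (Fg _ Dx))// ler_norm.
Qed.

Lemma integrable_normc F : cintegrable F ->
  mu.-integrable D (EFin \o (fun x => Normc.normc (F x))).
Proof.
move=> iF; have [i1 i2] := iF.
apply: (@le_integrable _ _ _ mu D mD _
  (EFin \o (fun x => `|complex.Re (F x)| + `|complex.Im (F x)|))).
- exact/measurable_EFinP/measurable_normc/cintegrable_meas.
- move=> x _ /=; rewrite lee_fin ger0_norm ?normc_ge0// ger0_norm ?addr_ge0//.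
  exact: normc_le_ReIm.
- apply: (@integrableD _ _ _ mu D mD (EFin \o (fun x => `|complex.Re (F x)|))
     (EFin \o (fun x => `|complex.Im (F x)|))); exact: integrable_norm.
Qed.

Lemma cintegrableD F G : cintegrable F -> cintegrable G ->
  cintegrable (fun x => F x + G x).
Proof.
move=> iF iG; apply: (@cintegrable_le _ (fun x => Normc.normc (F x) + Normc.normc (G x))).
- by apply: cmeasD; exact: cintegrable_meas.
- by apply: (integrableD mD (integrable_normc iF) (integrable_normc iG)).
- by move=> x _; exact: normc_triangle.
Qed.

Lemma cintegrableZ c F : cintegrable F -> cintegrable (fun x => c * F x).
Proof.
move=> iF; apply: (@cintegrable_le _ (fun x => Normc.normc c * Normc.normc (F x))).
- by apply: cmeasM; [exact: cmeas_cst|exact: cintegrable_meas].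
- have := integrableZl mD (Normc.normc c) (integrable_normc iF).
  by apply: eq_integrable => // x _ /=; rewrite EFinM.
- by move=> x _; rewrite Normc.normcM.
Qed.

Lemma cintegrableN F : cintegrable F -> cintegrable (fun x => - F x).
Proof.
by move=> /(cintegrableZ (-1)); apply: eq_cintegrable => x _; rewrite mulN1r.
Qed.

Lemma cintegrableB F G : cintegrable F -> cintegrable G ->
  cintegrable (fun x => F x - G x).
Proof. by move=> iF iG; apply: cintegrableD => //; exact: cintegrableN. Qed.

Lemma cintegrable0 : cintegrable (fun=> 0).
Proof. by split; exact: integrable0. Qed.

Lemma cintegrable_sum (I : Type) (s : seq I) (F : I -> T -> R[i]) :
  (forall i, cintegrable (F i)) -> cintegrable (fun x => \sum_(i <- s) F i x).
Proof.
move=> mF; elim: s => [|i s IH].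
  by apply: eq_cintegrable cintegrable0 => x _; rewrite big_nil.
by under eq_fun do rewrite big_cons; exact: cintegrableD.
Qed.

Lemma cintD F G : cintegrable F -> cintegrable G ->
  cint (fun x => F x + G x) = cint F + cint G.
Proof.
move=> [F1 F2] [G1 G2]; apply: eq_ReIm; rewrite ?ReD ?ImD /= -RintegralD//.
  by apply: eq_Rintegral => x _; rewrite ReD.
by apply: eq_Rintegral => x _; rewrite ImD.
Qed.

Lemma cintZ c F : cintegrable F -> cint (fun x => c * F x) = c * cint F.
Proof.
move=> [F1 F2]; apply: eq_ReIm; rewrite ?ReM ?ImM /=; rewrite -!RintegralZl//.
  rewrite -RintegralB//; first by apply: eq_Rintegral => x _; rewrite ReM.
  - have := integrableZl mD (complex.Re c) F1.
    by apply: eq_integrable => // x _ /=; rewrite EFinM.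
  - have := integrableZl mD (complex.Im c) F2.
    by apply: eq_integrable => // x _ /=; rewrite EFinM.
rewrite -RintegralD//; first by apply: eq_Rintegral => x _; rewrite ImM.
- have := integrableZl mD (complex.Re c) F2.
  by apply: eq_integrable => // x _ /=; rewrite EFinM.
- have := integrableZl mD (complex.Im c) F1.
  by apply: eq_integrable => // x _ /=; rewrite EFinM.
Qed.

Lemma cintN F : cintegrable F -> cint (fun x => - F x) = - cint F.
Proof.
move=> iF; rewrite -mulN1r -cintZ//; apply: eq_cint => x _; by rewrite mulN1r.
Qed.

Lemma cintB F G : cintegrable F -> cintegrable G ->
  cint (fun x => F x - G x) = cint F - cint G.
Proof. by move=> iF iG; rewrite cintD ?cintN//; exact: cintegrableN. Qed.

Lemma cint0 : cint (fun=> 0) = 0.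
Proof. by apply: eq_ReIm => /=; rewrite /Rintegral integral0. Qed.

Lemma cint_sum (I : Type) (s : seq I) (F : I -> T -> R[i]) :
  (forall i, cintegrable (F i)) ->
  cint (fun x => \sum_(i <- s) F i x) = \sum_(i <- s) cint (F i).
Proof.
move=> mF; elim: s => [|i s IH].
  by rewrite big_nil -[RHS]cint0; apply: eq_cint => x _; rewrite big_nil.
rewrite big_cons -IH -cintD//; last exact: cintegrable_sum.
by apply: eq_cint => x _; rewrite big_cons.
Qed.

Lemma cint_conj F : cintegrable F -> cint (fun x => conjc (F x)) = conjc (cint F).
Proof.
move=> [F1 F2]; apply: eq_ReIm; rewrite ?Re_conj ?Im_conj /=.
  by apply: eq_Rintegral => x _; rewrite Re_conj.
rewrite -mulN1r -RintegralZl//; apply: eq_Rintegral => x _.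
by rewrite Im_conj mulN1r.
Qed.

(* Multiplying by the conjugate of the integral turns the modulus of the
   integral into the integral of a real part. *)
Lemma normc_cint F : cintegrable F ->
  Normc.normc (cint F) <= \int[mu]_(x in D) Normc.normc (F x).
Proof.
move=> iF; set c := cint F; have [->|c0] := eqVneq c 0.
  by rewrite normc0E Rintegral_ge0// => x _; exact: normc_ge0.
have cp := normc_gt0 c0.
have h : (Normc.normc c) ^+ 2 = \int[mu]_(x in D) complex.Re (conjc c * F x).
  rewrite (_ : Rintegral _ _ _ = complex.Re (cint (fun x => conjc c * F x)))//.
  by rewrite cintZ// -/c mulrC mul_conj_normc.
rewrite -(ler_pM2l cp) -expr2 h -RintegralZl ?integrable_normc//.
move: c {c0 cp h} => c; apply: le_Rintegral => //.
- by have [] := cintegrableZ (conjc c) iF.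
- have := integrableZl mD (Normc.normc c) (integrable_normc iF).
  by apply: eq_integrable => // x _ /=; rewrite EFinM.
- move=> x Dx; rewrite (le_trans (ler_norm _))// (le_trans (Re_le_normc _))//.
  by rewrite Normc.normcM normc_conj.
Qed.

Lemma cintegrable_bounded F M : (mu D < +oo)%E -> cmeas F ->
  (forall x, D x -> Normc.normc (F x) <= M) -> cintegrable F.
Proof.
move=> Dfin mF FM; apply: (@cintegrable_le _ (fun=> M)) => //.
apply: measurable_bounded_integrable => //; exists `|M|; split; first exact: num_real.
by move=> y My x _; exact: ltW.
Qed.

Lemma cint_dominated (F_ : nat -> T -> R[i]) F (g : T -> R) :
  (forall n, cmeas (F_ n)) -> cmeas F ->
  mu.-integrable D (EFin \o g) ->
  (forall x, D x -> ccvg (fun n => F_ n x) (F x)) ->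
  (forall n x, D x -> Normc.normc (F_ n x) <= g x) ->
  ccvg (fun n => cint (F_ n)) (cint F).
Proof.
move=> mF_ mF ig cF hg.
have hF x : D x -> Normc.normc (F x) <= g x.
  move=> Dx; have h := ccvg_normc (cF _ Dx).
  rewrite -(cvg_lim _ h)//; apply: limr_le; first by apply/cvg_ex; eexists; exact: h.
  by near=> n; exact: hg.
have iF_ n : cintegrable (F_ n) by apply: (@cintegrable_le _ g) => // x; exact: hg.
have iF : cintegrable F by apply: (@cintegrable_le _ g).
have iFB n : cintegrable (fun x => F_ n x - F x) by exact: cintegrableB.
apply: (@ccvg_le _ _ _ (fun n => \int[mu]_(x in D) Normc.normc (F_ n x - F x))).
  by move=> n; rewrite -cintB//; exact: normc_cint.
have g0 x : D x -> 0 <= g x by move=> Dx; rewrite (le_trans _ (hF _ Dx))// normc_ge0.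
pose f_ n := EFin \o (fun x => Normc.normc (F_ n x - F x)).
have h : (fun n => \int[mu]_(x in D) f_ n x)%E @ \oo --> (\int[mu]_(x in D) cst 0 x)%E.
  apply: (@dominated_cvg _ _ _ mu D mD f_ (cst 0%E) (fun x => 2%:E * (g x)%:E)%E).
  - by move=> n; exact: measurable_int (integrable_normc (iFB n)).
  - move=> x Dx; apply/fine_cvgP; split; first by apply: nearW.
    exact: cF.
  - by [].
  - exact: integrableZl.
  - move=> n x Dx; rewrite /= lee_fin ger0_norm ?normc_ge0//.
    by rewrite (le_trans (normc_triangleB _ _))// mulr_natl mulr2n lerD// ?hg ?hF.
by move: h; rewrite integral0 => /fine_cvgP[_].
Unshelve. all: by end_near. Qed.

End ComplexIntegral.

(** * Complex differentiability *)

Section Derivable.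

(** Clearing the division by the increment makes the estimate hold at h = 0 as well, so that no
    condition on h is carried through the later compositions. *)
Lemma derivable_epsilon (K : numFieldType) (f : K -> K) (x : K) :
  derivable (f : K^o -> K^o) x 1 ->
  exists l : K, forall e, 0 < e -> exists2 d, 0 < d &
    forall h, `|h| < d -> `|f (x + h) - f x - l * h| <= e * `|h|.
Proof.
move=> /cvg_ex[l /= fl]; exists l => e e0.
move/cvgrPdist_le : fl => /(_ e e0) /nbhs_ballP[d /= d0 dh]; exists d => // h hd.
have [->|h0] := eqVneq h 0; first by rewrite addr0 mulr0 subrr subr0 normr0 mulr0.
have := dh h; rewrite -ball_normE /= sub0r normrN => /(_ hd h0).
rewrite distrC => H.
have hp : 0 < `|h| by rewrite normr_gt0.
rewrite -(ler_pM2r hp) in H; apply: le_trans H; rewrite -normrM mulrBl.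
rewrite le_eqVlt; apply/orP; left; apply/eqP; congr (`|_ - _|).
by rewrite /GRing.scale /= mulr1 [h + x]addrC mulrAC mulVf// mul1r.
Qed.

Lemma epsilon_derivable (K : numFieldType) (f : K -> K) (x l : K) :
  (forall e, 0 < e -> exists2 d, 0 < d &
    forall h, `|h| < d -> `|f (x + h) - f x - l * h| <= e * `|h|) ->
  derivable (f : K^o -> K^o) x 1.
Proof.
move=> H; apply/cvg_ex; exists l; apply/cvgrPdist_le => e e0.
have [d d0 dh] := H e e0; apply/nbhs_ballP; exists d => //= h.
rewrite -ball_normE /= sub0r normrN => /dh {}dh h0.
have hp : 0 < `|h| by rewrite normr_gt0.
rewrite -(ler_pM2r hp); apply: le_trans dh; rewrite distrC -normrM mulrBl.
rewrite [X in `|X - _|](_ : _ = f (x + h) - f x)//.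
by rewrite /GRing.scale /= mulr1 [h + x]addrC mulrAC mulVf// mul1r.
Qed.

Context {R : realType}.
Implicit Types (G : R[i] -> R[i]) (z w : R[i]).

Definition cderivable G z := exists c : R[i], forall e : R, 0 < e ->
  exists2 d : R, 0 < d & forall h, Normc.normc h < d ->
    Normc.normc (G (z + h) - G z - c * h) <= e * Normc.normc h.

Lemma derivable_cderivable G z :
  derivable (G : R[i]^o -> R[i]^o) z 1 <-> cderivable G z.
Proof.
split.
  move=> /derivable_epsilon[c H]; exists c => e e0.
  have [|d d0 dh] := H e%:C; first by rewrite ltcR.
  (* A positive element of R[i] is real, hence the embedding of its real part; this is what
     translates between complex and real epsilons. *)
  have dE : d = (complex.Re d)%:C.
    by move: d0; rewrite ltcE /= => /andP[/eqP h _]; apply: eq_ReIm.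
  exists (complex.Re d); first by rewrite -ltcR -dE.
  move=> h hd; have := dh h; rewrite {1}dE !normcE_abs ltcR => /(_ hd).
  by rewrite -complexRM lecR.
move=> [c H]; apply: (@epsilon_derivable _ _ _ c) => e e0.
have eE : e = (complex.Re e)%:C.
  by move: e0; rewrite ltcE /= => /andP[/eqP h _]; apply: eq_ReIm.
have [|d d0 dh] := H (complex.Re e); first by rewrite -ltcR -eE.
exists d%:C; first by rewrite ltcR.
move=> h; rewrite !normcE_abs ltcR => /dh.
by rewrite -lecR complexRM -eE.
Qed.

(* Complex differentiability of a function of s + it, in real coordinates. *)
Definition cdiff (K : R -> R -> R[i]) (s t : R) (c : R[i]) :=
  forall e : R, 0 < e -> exists2 d : R, 0 < d & forall h k, `|h| < d -> `|k| < d ->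
    Normc.normc (K (s + h) (t + k) - K s t - c * (h +i* k)) <= e * (`|h| + `|k|).

Lemma real_deriv_epsilon (f : R -> R) (x l : R) : is_derive x 1 f l ->
  forall e, 0 < e -> exists2 d, 0 < d &
    forall h, `|h| < d -> `|f (x + h) - f x - l * h| <= e * `|h|.
Proof.
move=> [df fl] e e0; move: df; rewrite /derivable => /cvgrPdist_le.
rewrite (_ : lim _ = l) // => /(_ e e0) /nbhs_ballP[d /= d0 dh]; exists d => // h hd.
have [->|h0] := eqVneq h 0; first by rewrite addr0 mulr0 subrr subr0 normr0 mulr0.
have := dh h; rewrite -ball_normE /= sub0r normrN => /(_ hd h0).
rewrite distrC => H.
have hp : 0 < `|h| by rewrite normr_gt0.
rewrite -(ler_pM2r hp) in H; apply: le_trans H; rewrite -normrM mulrBl.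
rewrite le_eqVlt; apply/orP; left; apply/eqP; congr (`|_ - _|).
by rewrite /GRing.scale /= mulr1 [h + x]addrC mulrAC mulVf// mul1r.
Qed.

Lemma normc_pair_le (h k : R) : Normc.normc (h +i* k) <= `|h| + `|k|.
Proof. exact: (normc_le_ReIm (h +i* k)). Qed.

(** The function is the exponential of s + i t; the real derivatives of exp, cos and sin at 0 are
    assembled here, and other points follow by multiplicativity. *)
Lemma cdiff_polar0 : cdiff (fun s t => (expR s)%:C * cis t) 0 0 1.
Proof.
(* The two coordinates contribute at most 3 e1 |h| + 6 e1 |k| in all, which e / 8 covers; e1 <= 1
   keeps |h| <= 1 and exp h <= 3. *)
move=> e e0; have [e1 [e1p e18 e11]] : exists e1 : R, [/\ 0 < e1, e1 <= e / 8 & e1 <= 1].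
  exists (Num.min (e / 8) 1).
  by rewrite lt_min divr_gt0//= ltr01 !ge_min !lexx orbT.
have [d1 d10 H1] := real_deriv_epsilon (is_derive_expR (0 : R)) e1p.
have [d2 d20 H2] := real_deriv_epsilon (is_derive_cos (0 : R)) e1p.
have [d3 d30 H3] := real_deriv_epsilon (is_derive_sin (0 : R)) e1p.
exists (Num.min (Num.min d1 d2) (Num.min d3 e1)); first by rewrite !lt_min d10 d20 d30 e1p.
move=> h k; rewrite !lt_min => /andP[/andP[h1 _] /andP[_ he]] /andP[/andP[_ k2] /andP[k3 ke]].
have {H1} := H1 _ h1; have {H2} := H2 _ k2; have {H3} := H3 _ k3.
rewrite !add0r expR0 cos0 sin0 !mul1r oppr0 mul0r ?subr0 ?addr0 => S C X.
apply: le_trans (normc_le_ReIm _) _.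
rewrite !(ReD, ImD, ReN, ImN, ReM, ImM) /= !(mul0r, mulr0, mul1r, add0r, addr0, subr0, oppr0, sin0, cos0, mulr1).
have k1 : `|k| <= 1 by rewrite ltW// (lt_le_trans ke).
have h1' : `|h| <= 1 by rewrite ltW// (lt_le_trans he).
have he' : `|h| <= e1 by exact: ltW.
have ke' : `|k| <= e1 by exact: ltW.
set E := expR h in X *; set c := cos k in C *; set s := sin k in S *.
have E1 : `|E - 1| <= 2 * `|h|.
  rewrite (_ : E - 1 = (E - 1 - h) + h); last by ring.
  rewrite (le_trans (ler_normD _ _))//.
  have := ler_wpM2r (normr_ge0 h) e11; lra.
have E3 : `|E| <= 3.
  rewrite (_ : E = (E - 1) + 1); last by ring.
  rewrite (le_trans (ler_normD _ _))// normr1; lra.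
have A1 : `|E * c - 1 - h| <= e1 * `|h| + 3 * (e1 * `|k|).
  rewrite (_ : E * c - 1 - h = (E - 1 - h) + E * (c - 1)); last by ring.
  rewrite (le_trans (ler_normD _ _))// lerD// normrM ler_pM//.
have A2 : `|E * s - k| <= 3 * (e1 * `|k|) + 2 * (`|h| * e1).
  rewrite (_ : E * s - k = E * (s - k) + (E - 1) * k); last by ring.
  rewrite (le_trans (ler_normD _ _))// lerD//.
    by rewrite normrM ler_pM.
  by rewrite normrM mulrA ler_pM.
apply: le_trans (lerD A1 A2) _.
have := ler_wpM2r (normr_ge0 h) e18; have := ler_wpM2r (normr_ge0 k) e18.
have := normr_ge0 h; have := normr_ge0 k.
move: (`|h|) (`|k|) => a b; nra.
Qed.

Lemma cdiff_polar s t :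
  cdiff (fun s t => (expR s)%:C * cis t) s t ((expR s)%:C * cis t).
Proof.
move=> e e0; have Ep := expR_gt0 s.
have [|d d0 dh] := cdiff_polar0 (e := e / expR s); first by rewrite divr_gt0.
exists d => // h k hd kd; have := dh h k hd kd.
rewrite !add0r expR0 cis0 mulr1 mul1r (_ : 1%:C = 1)//.
rewrite expRD cisD complexRM.
have aux (x y z w u : R[i]) : x * y * (z * w) - x * z - x * z * u = (x * z) * (y * w - 1 - u).
  by ring.
rewrite aux.
rewrite [in X in _ -> X]Normc.normcM [in X in _ -> X]Normc.normcM normc_cis mulr1 normcR (gtr0_norm Ep).
by rewrite mulrAC ler_pdivlMr// mulrC.
Qed.

(** The chain rule from the disk to the logarithmic coordinate; [M] bounds the increment of K by M
    (|h| + |k|). *)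
Lemma cdiff_comp (K : R -> R -> R[i]) G s t c : cdiff K s t c ->
  cderivable G (K s t) -> exists c', cdiff (fun s t => G (K s t)) s t c'.
Proof.
move=> Kc [g Gg]; exists (g * c) => e e0.
pose M := Normc.normc c + 1.
have M0 : 0 < M by rewrite ltr_pwDr// normc_ge0.
have g0 : 0 < Normc.normc g + 1 by rewrite ltr_pwDr// normc_ge0.
have [|d1 d10 H1] := Gg (e / (2 * M)); first by rewrite divr_gt0// mulr_gt0.
have [|d2 d20 H2] := Kc (Num.min 1 (e / (2 * (Normc.normc g + 1)))).
  by rewrite lt_min ltr01 divr_gt0// mulr_gt0.
exists (Num.min d2 (d1 / (2 * M))); first by rewrite lt_min d20 divr_gt0// mulr_gt0.
move=> h k; rewrite !lt_min => /andP[h2 h1] /andP[k2 k1].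
have {H2} := H2 _ _ h2 k2.
set D := K (s + h) (t + k) - K s t; set u := h +i* k; set m := `|h| + `|k| => H2.
have m0 : 0 <= m by rewrite addr_ge0.
have um : Normc.normc u <= m by exact: normc_pair_le.
have D1 : Normc.normc D <= M * m.
  rewrite (_ : D = (D - c * u) + c * u); last by rewrite subrK.
  rewrite (le_trans (normc_triangle _ _))// mulrDl mul1r addrC lerD//.
    by rewrite Normc.normcM ler_wpM2l// normc_ge0.
  by rewrite (le_trans H2)// -[leRHS]mul1r ler_wpM2r// ge_min lexx.
have DD : Normc.normc D < d1.
  rewrite (le_lt_trans D1)// /m mulrDr (splitr d1) ltrD//.
    by rewrite mulrC -ltr_pdivlMr// -mulrA -invfM.
  by rewrite mulrC -ltr_pdivlMr// -mulrA -invfM.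
have {H1} := H1 _ DD; rewrite (_ : K s t + D = K (s + h) (t + k)); last by rewrite /D addrC subrK.
move=> H1.
rewrite (_ : _ - _ - _ = (G (K (s + h) (t + k)) - G (K s t) - g * D) + g * (D - c * u)); last by ring.
rewrite (le_trans (normc_triangle _ _))// (splitr e) mulrDl lerD//.
  rewrite (le_trans H1)//.
  rewrite (_ : e / 2 * m = e / (2 * M) * (M * m)); last by field; rewrite gt_eqF.
  by rewrite ler_wpM2l// ltW// divr_gt0// mulr_gt0.
rewrite Normc.normcM.
have H3 : Normc.normc (D - c * u) <= e / (2 * (Normc.normc g + 1)) * m.
  by rewrite (le_trans H2)// ler_wpM2r// ge_min lexx orbT.
rewrite (_ : e / 2 * m = (Normc.normc g + 1) * (e / (2 * (Normc.normc g + 1)) * m)); last by field; rewrite gt_eqF.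
by apply: ler_pM => //; rewrite ?normc_ge0// lerDl.
Qed.

End Derivable.

(** * Quartering of rectangles *)

Section Bisection.
Context {R : realType}.

Lemma half_power_small (w d : R) : 0 < d -> exists n, w / 2 ^+ n < d.
Proof.
move=> d0; exists (Num.truncn (w / d)).+1.
have h2 : 0 < 2 ^+ (Num.truncn (w / d)).+1 :> R by rewrite exprn_gt0.
rewrite ltr_pdivrMr// mulrC -ltr_pdivrMr//.
have h := truncnS_gt (w / d).
rewrite (lt_le_trans h)// -natrX ler_nat ltnW// ltn_expl//.
Qed.

(** The first pair holds the ends of the s-interval, the second those of the t-interval. *)
Definition rect : Type := (R * R) * (R * R).

Definition subrect (Q Q' : rect) :=
  [/\ Q.1.1 <= Q'.1.1, Q'.1.2 <= Q.1.2, Q.2.1 <= Q'.2.1 & Q'.2.2 <= Q.2.2].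

Definition valid_rect (Q : rect) := Q.1.1 <= Q.1.2 /\ Q.2.1 <= Q.2.2.

Definition in_rect (Q : rect) (x y : R) := Q.1.1 <= x <= Q.1.2 /\ Q.2.1 <= y <= Q.2.2.

Definition rect_size (Q : rect) := (Q.1.2 - Q.1.1) + (Q.2.2 - Q.2.1).

(** The combinatorial half of Goursat's argument, for any additive function of rectangles: if J Q0
    were nonzero, some quarter at each stage would keep its share, and the nested quarters would
    shrink to a point violating the local estimate. *)
Lemma bisection (J : rect -> R[i]) (Q0 : rect) : valid_rect Q0 ->
  (forall a m b I, a <= m <= b -> subrect Q0 ((a, b), I) -> valid_rect ((a, b), I) ->
     J ((a, b), I) = J ((a, m), I) + J ((m, b), I)) ->
  (forall I c m d, c <= m <= d -> subrect Q0 (I, (c, d)) -> valid_rect (I, (c, d)) ->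
     J (I, (c, d)) = J (I, (c, m)) + J (I, (m, d))) ->
  (forall x y, in_rect Q0 x y -> forall e : R, 0 < e -> exists2 d : R, 0 < d &
     forall Q, subrect Q0 Q -> in_rect Q x y -> Q.1.2 - Q.1.1 < d -> Q.2.2 - Q.2.1 < d ->
       Normc.normc (J Q) <= e * rect_size Q ^+ 2) ->
  J Q0 = 0.
Proof.
move=> vQ0 addS addT loc.
(* A degenerate rectangle splits into two copies of itself, so additivity gives J = J + J. The
   quartering below divides by the size. *)
have [sz|sz] := eqVneq (rect_size Q0) 0.
  move: Q0 vQ0 addS sz {addT loc} => [[a b] [c d]] /= [/= ab cd] addS sz.
  have ? : a = b by move: sz; rewrite /rect_size /=; lra.
  subst b; have := addS a a a (c, d).
  rewrite !lexx => /(_ isT) H; have {}H := H (And4 (lexx _) (lexx _) (lexx _) (lexx _)) (conj (lexx _) cd).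
  by apply: (@addrI _ (J ((a, a), (c, d)))); rewrite addr0 -H.
have sz0 : 0 < rect_size Q0.
  rewrite lt_neqAle eq_sym sz /=; have [? ?] := vQ0.
  by rewrite /rect_size addr_ge0// subr_ge0.
apply: contrapT => J0.
have Jp : 0 < Normc.normc (J Q0) by apply: normc_gt0; apply/eqP.
(* Halving both sides divides the squared size by four, so one of the four quarters keeps the ratio
   K; the local estimate is contradicted with e = K / 2. *)
pose K : R := Normc.normc (J Q0) / rect_size Q0 ^+ 2.
have K0 : 0 < K by rewrite divr_gt0// exprn_gt0.
pose P Q := [/\ subrect Q0 Q, valid_rect Q & K * rect_size Q ^+ 2 <= Normc.normc (J Q)].
(* The premise [P Q] stands under the existential so that [choice] yields a map on all
   rectangles. *)
have step Q : exists Q', P Q -> [/\ P Q', subrect Q Q',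
    Q'.1.2 - Q'.1.1 = (Q.1.2 - Q.1.1) / 2 & Q'.2.2 - Q'.2.1 = (Q.2.2 - Q.2.1) / 2].
  apply: contrapT => /forallNP H.
  have PQ : P Q by apply: contrapT => nP; apply: (H Q) => /nP.
  move: (PQ); move: Q PQ H => [[a b] [c d]] PQ H [[/= s1 s2 s3 s4] [/= ab cd] KJ].
  have [m [am mb m1 m2]] : exists m, [/\ a <= m, m <= b, m - a = (b - a) / 2 & b - m = (b - a) / 2].
    by exists ((a + b) / 2); split; clear - ab; lra.
  have [n [cn nd n1 n2]] : exists n, [/\ c <= n, n <= d, n - c = (d - c) / 2 & d - n = (d - c) / 2].
    by exists ((c + d) / 2); split; clear - cd; lra.
  have J4 : J ((a, b), (c, d)) = J ((a, m), (c, n)) + J ((a, m), (n, d)) +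
      (J ((m, b), (c, n)) + J ((m, b), (n, d))).
    rewrite (addS a m b) ?am ?mb//.
    by congr (_ + _); rewrite -addT ?cn ?nd//; split => //=; rewrite ?(le_trans mb) ?(le_trans s1).
  have small Q' : subrect Q0 Q' -> valid_rect Q' -> subrect ((a, b), (c, d)) Q' ->
      Q'.1.2 - Q'.1.1 = (b - a) / 2 -> Q'.2.2 - Q'.2.1 = (d - c) / 2 ->
      Normc.normc (J Q') < K * rect_size Q' ^+ 2.
    move=> sub0 v sub h1 h2; rewrite ltNge; apply/negP => le.
    by apply: (H Q') => _.
  have q Q' : subrect Q0 Q' -> valid_rect Q' -> subrect ((a, b), (c, d)) Q' ->
      Q'.1.2 - Q'.1.1 = (b - a) / 2 -> Q'.2.2 - Q'.2.1 = (d - c) / 2 ->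
      Normc.normc (J Q') < K * rect_size ((a, b), (c, d)) ^+ 2 / 4.
    move=> *; rewrite (lt_le_trans (small Q' _ _ _ _ _))//.
    rewrite /rect_size /= (_ : _ + _ = ((b - a) + (d - c)) / 2); last by lra.
    by rewrite expr_div_n mulrA -natrX.
  have q1 := q ((a, m), (c, n)); have q2 := q ((a, m), (n, d)).
  have q3 := q ((m, b), (c, n)); have q4 := q ((m, b), (n, d)).
  have {}q1 : Normc.normc (J ((a, m), (c, n))) < K * rect_size ((a, b), (c, d)) ^+ 2 / 4.
    by apply: q1; rewrite /subrect /valid_rect /=; do ?split; rewrite // ?(le_trans s1 am) ?(le_trans mb s2) ?(le_trans s3 cn) ?(le_trans nd s4).
  have {}q2 : Normc.normc (J ((a, m), (n, d))) < K * rect_size ((a, b), (c, d)) ^+ 2 / 4.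
    by apply: q2; rewrite /subrect /valid_rect /=; do ?split; rewrite // ?(le_trans s1 am) ?(le_trans mb s2) ?(le_trans s3 cn) ?(le_trans nd s4).
  have {}q3 : Normc.normc (J ((m, b), (c, n))) < K * rect_size ((a, b), (c, d)) ^+ 2 / 4.
    by apply: q3; rewrite /subrect /valid_rect /=; do ?split; rewrite // ?(le_trans s1 am) ?(le_trans mb s2) ?(le_trans s3 cn) ?(le_trans nd s4).
  have {}q4 : Normc.normc (J ((m, b), (n, d))) < K * rect_size ((a, b), (c, d)) ^+ 2 / 4.
    by apply: q4; rewrite /subrect /valid_rect /=; do ?split; rewrite // ?(le_trans s1 am) ?(le_trans mb s2) ?(le_trans s3 cn) ?(le_trans nd s4).
  have := normc_triangle (J ((a, m), (c, n)) + J ((a, m), (n, d))) (J ((m, b), (c, n)) + J ((m, b), (n, d))).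
  have := normc_triangle (J ((a, m), (c, n))) (J ((a, m), (n, d))).
  have := normc_triangle (J ((m, b), (c, n))) (J ((m, b), (n, d))).
  rewrite -J4; lra.
have [g gP] := choice step.
pose Qn := fix Qn n := if n is k.+1 then g (Qn k) else Q0.
have PQn n : P (Qn n).
  elim: n => [|n IH]; last by have [] := gP _ IH.
  by split; [split|by []|rewrite /K divfK// expf_neq0].
have w1 n : (Qn n).1.2 - (Qn n).1.1 = (Q0.1.2 - Q0.1.1) / 2 ^+ n.
  elim: n => [|n IH]; first by rewrite expr0 divr1.
  by have [_ _ /= -> _] := gP _ (PQn n); rewrite IH exprSr invfM mulrA.
have w2 n : (Qn n).2.2 - (Qn n).2.1 = (Q0.2.2 - Q0.2.1) / 2 ^+ n.
  elim: n => [|n IH]; first by rewrite expr0 divr1.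
  by have [_ _ /= _ ->] := gP _ (PQn n); rewrite IH exprSr invfM mulrA.
have mono k n : subrect (Qn n) (Qn (n + k)%N).
  elim: k => [|k IH]; first by rewrite addn0; split.
  have [_ [s1 s2 s3 s4] _ _] := gP _ (PQn (n + k)%N); have [t1 t2 t3 t4] := IH.
  rewrite addnS /=; split.
  - exact: le_trans s1.
  - exact: le_trans s2 _.
  - exact: le_trans s3.
  - exact: le_trans s4 _.
have cross m n : (Qn m).1.1 <= (Qn n).1.2 /\ (Qn m).2.1 <= (Qn n).2.2.
  have [h1 _ h3 _] := mono n m; have [_ h2 _ h4] := mono m n.
  rewrite addnC in h2 h4; have [_ [v1 v2] _] := PQn (m + n)%N.
  by split; [rewrite (le_trans h1)// (le_trans v1)|rewrite (le_trans h3)// (le_trans v2)].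
(* The common point of the nested rectangles, as the suprema of their lower ends. *)
pose x := sup (range (fun n => (Qn n).1.1)); pose y := sup (range (fun n => (Qn n).2.1)).
have xn n : (Qn n).1.1 <= x <= (Qn n).1.2.
  apply/andP; split.
    apply: ub_le_sup; last by exists n.
    by exists Q0.1.2 => _ [k _ <-]; exact: (cross k 0).1.
  apply: ge_sup; first by exists (Qn 0).1.1; exists 0.
  by move=> _ [k _ <-]; exact: (cross k n).1.
have yn n : (Qn n).2.1 <= y <= (Qn n).2.2.
  apply/andP; split.
    apply: ub_le_sup; last by exists n.
    by exists Q0.2.2 => _ [k _ <-]; exact: (cross k 0).2.
  apply: ge_sup; first by exists (Qn 0).2.1; exists 0.
  by move=> _ [k _ <-]; exact: (cross k n).2.
have K2 : 0 < K / 2 by apply: divr_gt0.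
have [d d0 dQ] := loc x y (conj (xn 0) (yn 0)) _ K2.
have [n nd] := half_power_small (rect_size Q0) d0.
have [v1 v2] := vQ0.
have [sub vn Kn] := PQn n.
have p2 : 0 < (2 ^+ n)^-1 :> R by rewrite invr_gt0 exprn_gt0.
have := dQ (Qn n) sub (conj (xn n) (yn n)).
rewrite w1 w2 => H.
have {}H := H (le_lt_trans _ nd) (le_lt_trans _ nd).
have sn : rect_size (Qn n) = rect_size Q0 / 2 ^+ n.
  by rewrite {1}/rect_size w1 w2 -mulrDl.
have snp : 0 < rect_size (Qn n) ^+ 2 by rewrite exprn_gt0// sn mulr_gt0.
have : Normc.normc (J (Qn n)) <= K / 2 * rect_size (Qn n) ^+ 2.
  apply: H; rewrite ler_wpM2r ?(ltW p2)// /rect_size.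
    by rewrite lerDl subr_ge0.
  by rewrite lerDr subr_ge0.
move=> H2; have := le_trans Kn H2.
rewrite ler_pM2r//; lra.
Qed.

End Bisection.

(** * Integrals of continuous functions over segments *)

Section Segments.
Context {R : realType}.
Notation leb := (@lebesgue_measure R).
Implicit Types F G : R -> R[i].

Definition ccont F (x : R) := forall e : R, 0 < e -> exists2 d : R, 0 < d &
  forall y, `|y - x| < d -> Normc.normc (F y - F x) <= e.

Lemma ccont_segment_integrable F (a b : R) : (forall x, a <= x <= b -> ccont F x) ->
  cintegrable leb `[a, b] F.
Proof.
move=> cF; split; apply: continuous_compact_integrable; try exact: segment_compact.
- apply: continuous_in_subspaceT => x /set_mem; rewrite /= in_itv /= => xab.
  apply/cvgrPdist_le => e e0; have [d d0 H] := cF x xab e e0.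
  exists d => //= y; rewrite /= distrC => /H h.
  by rewrite distrC -ReN -ReD (le_trans (Re_le_normc _)).
- apply: continuous_in_subspaceT => x /set_mem; rewrite /= in_itv /= => xab.
  apply/cvgrPdist_le => e e0; have [d d0 H] := cF x xab e e0.
  exists d => //= y; rewrite /= distrC => /H h.
  by rewrite distrC -ImN -ImD (le_trans (Im_le_normc _)).
Qed.

Lemma Rintegral_segment_split (f : R -> R) (a m b : R) : a <= m <= b ->
  leb.-integrable `[a, b] (EFin \o f) ->
  \int[leb]_(x in `[a, b]) f x = \int[leb]_(x in `[a, m]) f x + \int[leb]_(x in `[m, b]) f x.
Proof.
move=> /andP[am mb] fi.
have := Rintegral_itvB fi (x := m); rewrite !bnd_simp => /(_ am mb).
rewrite (Rintegral_itv_obnd_cbnd (r := m)); first by move=> <-; rewrite addrC subrK.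
apply: integrableS fi => //; apply: subset_itvr; by rewrite bnd_simp.
Qed.

Lemma cint_segment_split F (a m b : R) : a <= m <= b -> cintegrable leb `[a, b] F ->
  cint leb `[a, b] F = cint leb `[a, m] F + cint leb `[m, b] F.
Proof.
move=> amb [F1 F2]; apply: eq_ReIm; rewrite ?ReD ?ImD /=.
  exact: Rintegral_segment_split.
exact: Rintegral_segment_split.
Qed.

Lemma cint_segment_cst (a b : R) (c : R[i]) : a <= b ->
  cint leb `[a, b] (fun=> c) = (b - a)%:C * c.
Proof.
move=> ab; have E r : \int[leb]_(x in `[a, b]) r = r * (b - a).
  rewrite Rintegral_cst//= lebesgue_measure_itv /= lte_fin.
  have [//|ba] := ltP a b; have -> : b = a by apply: le_anti; rewrite ba.
  by rewrite subrr.
by apply: eq_ReIm; rewrite ?ReM ?ImM /= !E; ring.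
Qed.

Lemma cint_segment_bound (a b M : R) F : a <= b -> cintegrable leb `[a, b] F ->
  (forall x, a <= x <= b -> Normc.normc (F x) <= M) ->
  Normc.normc (cint leb `[a, b] F) <= M * (b - a).
Proof.
move=> ab iF FM; rewrite (le_trans (normc_cint _ iF))//.
have -> : M * (b - a) = \int[leb]_(x in `[a, b]) M.
  rewrite Rintegral_cst//= lebesgue_measure_itv /= lte_fin.
  have [//|ba] := ltP a b; have -> : b = a by apply: le_anti; rewrite ba.
  by rewrite subrr.
apply: le_Rintegral => //; first exact: integrable_normc.
  apply: measurable_bounded_integrable => //=.
    by rewrite lebesgue_measure_itv /=; case: ifPn => _; rewrite ltry.
  by exists `|M|; split; [exact: num_real|move=> y My x _; exact: ltW].
Qed.

End Segments.

(** * Goursat's theorem on rectangles *)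

Section Goursat.
Context {R : realType}.
Notation leb := (@lebesgue_measure R).
Variable K : R -> R -> R[i].

(* The integral of K(s + it) d(s + it) along the boundary of a rectangle. *)
Definition rect_int (Q : @rect R) : R[i] :=
  'i%C * cint leb `[Q.2.1, Q.2.2] (fun t => K Q.1.2 t - K Q.1.1 t) -
  cint leb `[Q.1.1, Q.1.2] (fun s => K s Q.2.2 - K s Q.2.1).

Lemma cdiff_ccont s t c : cdiff K s t c -> ccont (K^~ t) s /\ ccont (K s) t.
Proof.
move=> Kc.
have H e : 0 < e -> exists2 d, 0 < d & forall h k, `|h| < d -> `|k| < d ->
    Normc.normc (K (s + h) (t + k) - K s t) <= e.
  move=> e0; have [d d0 Kd] := Kc 1 ltr01.
  pose M := Normc.normc c + 1.
  have M0 : 0 < M by rewrite ltr_pwDr// normc_ge0.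
  exists (Num.min d (e / (2 * M))); first by rewrite lt_min d0 divr_gt0// mulr_gt0.
  move=> h k; rewrite !lt_min => /andP[hd he] /andP[kd ke].
  rewrite -[_ - _](subrK (c * (h +i* k))) (le_trans (normc_triangle _ _))//.
  rewrite (le_trans (lerD (Kd _ _ hd kd) (lexx _)))// Normc.normcM mul1r.
  have := ler_wpM2l (normc_ge0 c) (normc_pair_le h k).
  move: he ke; rewrite !ltr_pdivlMr ?mulr_gt0// /M.
  move: (Normc.normc (h +i* k)) (Normc.normc c) (`|h|) (`|k|) => n C a b; lra.
split=> e e0; have [d d0 Hd] := H e e0; exists d => // y yd.
  have := Hd (y - s) 0 yd; rewrite normr0 => /(_ d0).
  by rewrite addr0 [s + _]addrC subrK.
have := Hd 0 (y - t); rewrite normr0 => /(_ d0 yd).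
by rewrite addr0 [t + _]addrC subrK.
Qed.

Definition rect_cont (Q : @rect R) :=
  forall s t, in_rect Q s t -> ccont (K^~ t) s /\ ccont (K s) t.

Lemma rect_cont_integrable_t Q s c d : rect_cont Q ->
  Q.2.1 <= c -> d <= Q.2.2 -> Q.1.1 <= s <= Q.1.2 -> cintegrable leb `[c, d] (K s).
Proof.
move=> cQ s3 s4 sQ; apply: ccont_segment_integrable => t /andP[t1 t2].
by apply: (cQ s t _).2; split => //; rewrite (le_trans s3)// (le_trans t2).
Qed.

Lemma rect_cont_integrable_s Q t a b : rect_cont Q ->
  Q.1.1 <= a -> b <= Q.1.2 -> Q.2.1 <= t <= Q.2.2 -> cintegrable leb `[a, b] (K^~ t).
Proof.
move=> cQ s1 s2 tQ; apply: ccont_segment_integrable => s /andP[t1 t2].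
by apply: (cQ s t _).1; split => //; rewrite (le_trans s1)// (le_trans t2).
Qed.

Lemma rect_int_split_s Q a m b I : rect_cont Q -> a <= m <= b ->
  subrect Q ((a, b), I) -> valid_rect ((a, b), I) ->
  rect_int ((a, b), I) = rect_int ((a, m), I) + rect_int ((m, b), I).
Proof.
case: I => c d cQ amb [s1 s2 s3 s4] [ab cd]; rewrite /= in s1 s2 s3 s4 ab cd.
rewrite /rect_int /=.
have iT := rect_cont_integrable_t cQ s3 s4; have iS := rect_cont_integrable_s cQ s1 s2.
have ha : Q.1.1 <= a <= Q.1.2 by rewrite s1 (le_trans ab).
have hb : Q.1.1 <= b <= Q.1.2 by rewrite s2 (le_trans s1).
have hm : Q.1.1 <= m <= Q.1.2.
  by move: amb => /andP[am mb]; rewrite (le_trans s1)// (le_trans mb).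
have hc : Q.2.1 <= c <= Q.2.2 by rewrite s3 (le_trans cd).
have hd : Q.2.1 <= d <= Q.2.2 by rewrite s4 (le_trans s3).
rewrite (cint_segment_split amb); last by apply: cintegrableB; [by []|exact: iS..].
rewrite (@cintB _ _ _ leb _ _ (K b) (K a))//; [|exact: iT..].
rewrite (@cintB _ _ _ leb _ _ (K m) (K a))//; [|exact: iT..].
rewrite (@cintB _ _ _ leb _ _ (K b) (K m))//; [|exact: iT..].
by ring.
Qed.

Lemma rect_int_split_t Q I c m d : rect_cont Q -> c <= m <= d ->
  subrect Q (I, (c, d)) -> valid_rect (I, (c, d)) ->
  rect_int (I, (c, d)) = rect_int (I, (c, m)) + rect_int (I, (m, d)).
Proof.
case: I => a b cQ cmd [s1 s2 s3 s4] [ab cd]; rewrite /= in s1 s2 s3 s4 ab cd.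
rewrite /rect_int /=.
have iT := rect_cont_integrable_t cQ s3 s4; have iS := rect_cont_integrable_s cQ s1 s2.
have ha : Q.1.1 <= a <= Q.1.2 by rewrite s1 (le_trans ab).
have hb : Q.1.1 <= b <= Q.1.2 by rewrite s2 (le_trans s1).
have hm : Q.2.1 <= m <= Q.2.2.
  by move: cmd => /andP[cm md]; rewrite (le_trans s3)// (le_trans md).
have hc : Q.2.1 <= c <= Q.2.2 by rewrite s3 (le_trans cd).
have hd : Q.2.1 <= d <= Q.2.2 by rewrite s4 (le_trans s3).
rewrite (cint_segment_split cmd); last by apply: cintegrableB; [by []|exact: iT..].
rewrite (@cintB _ _ _ leb _ _ (K^~ d) (K^~ c))//; [|exact: iS..].
rewrite (@cintB _ _ _ leb _ _ (K^~ d) (K^~ m))//; [|exact: iS..].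
rewrite (@cintB _ _ _ leb _ _ (K^~ m) (K^~ c))//; [|exact: iS..].
by ring.
Qed.

(** Near a point the affine part of K integrates to 0 around a rectangle, and the remainder is small
    compared with the size on a boundary of comparable length, so the integral is small compared
    with the squared size. *)
Theorem Goursat_rectangle (Q : rect) : valid_rect Q ->
  (forall s t, in_rect Q s t -> exists c, cdiff K s t c) -> rect_int Q = 0.
Proof.
move=> vQ dK.
have cQ : rect_cont Q by move=> s t /dK[c /cdiff_ccont].
apply: bisection => //.
- by move=> a m b I; exact: rect_int_split_s.
- by move=> I c m d; exact: rect_int_split_t.
move=> s t st e e0; have [k Kk] := dK _ _ st.
have [dl dl0 Kd] := Kk (e / 2) (divr_gt0 e0 (ltr0n _ 2)).
exists dl => // -[[a b] [c d]] sub [/= /andP[as' sb] /andP[ct td]] bad dcd.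
have [/= s1 s2 s3 s4] := sub.
have ab := le_trans as' sb; have cd := le_trans ct td.
pose E x y := K x y - K s t - k * ((x - s) +i* (y - t)).
have EB x y : a <= x <= b -> c <= y <= d -> Normc.normc (E x y) <= e / 2 * (b - a + (d - c)).
  move=> /andP[ax xb] /andP[cy yd].
  have xs : `|x - s| <= b - a by rewrite ler_norml; apply/andP; split; lra.
  have yt : `|y - t| <= d - c by rewrite ler_norml; apply/andP; split; lra.
  have := Kd (x - s) (y - t) (le_lt_trans xs bad) (le_lt_trans yt dcd).
  rewrite [s + _]addrC subrK [t + _]addrC subrK => /le_trans; apply.
  by rewrite ler_wpM2l ?divr_ge0// ?(ltW e0)// lerD.
have ha : Q.1.1 <= a <= Q.1.2 by rewrite s1 (le_trans ab).
have hb : Q.1.1 <= b <= Q.1.2 by rewrite s2 (le_trans s1).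
have hc : Q.2.1 <= c <= Q.2.2 by rewrite s3 (le_trans cd).
have hd : Q.2.1 <= d <= Q.2.2 by rewrite s4 (le_trans s3).
have jT := rect_cont_integrable_t cQ s3 s4.
have jS := rect_cont_integrable_s cQ s1 s2.
(* The increments of the linear part k (x - s + i (y - t)) across the rectangle in the two
   directions. They may be subtracted since i (d - c) c1 = (b - a) c2. *)
pose c1 : R[i] := k * (b - a)%:C; pose c2 : R[i] := k * 'i%C * (d - c)%:C.
have icst x y (v : R[i]) : cintegrable leb `[x, y] (fun=> v).
  by apply: ccont_segment_integrable => ? _ ? ?; exists 1 => // ? _; rewrite subrr normc0E ltW.
have j1 : cintegrable leb `[c, d] (fun y => K b y - K a y).
  by apply: cintegrableB; [by []|exact: jT..].
have j2 : cintegrable leb `[a, b] (fun x => K x d - K x c).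
  by apply: cintegrableB; [by []|exact: jS..].
have h1 : cint leb `[c, d] (fun y => K b y - K a y - c1) =
    cint leb `[c, d] (fun y => K b y - K a y) - (d - c)%:C * c1.
  by rewrite (@cintB _ _ _ leb _ _ (fun y => K b y - K a y) (fun=> c1))// cint_segment_cst.
have h2 : cint leb `[a, b] (fun x => K x d - K x c - c2) =
    cint leb `[a, b] (fun x => K x d - K x c) - (b - a)%:C * c2.
  by rewrite (@cintB _ _ _ leb _ _ (fun x => K x d - K x c) (fun=> c2))// cint_segment_cst.
have -> : rect_int ((a, b), (c, d)) =
    'i%C * cint leb `[c, d] (fun y => K b y - K a y - c1) -
    cint leb `[a, b] (fun x => K x d - K x c - c2).
  by rewrite h1 h2 /rect_int /= /c1 /c2; ring.
have i1 : cintegrable leb `[c, d] (fun y => K b y - K a y - c1) by exact: cintegrableB.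
have i2 : cintegrable leb `[a, b] (fun x => K x d - K x c - c2) by exact: cintegrableB.
have b1 : Normc.normc (cint leb `[c, d] (fun y => K b y - K a y - c1)) <=
    e * (b - a + (d - c)) * (d - c).
  apply: cint_segment_bound => // y cyd.
  rewrite (_ : _ - _ - _ = E b y - E a y); last first.
    rewrite /E /c1 (_ : (b - a)%:C = ((b - s) +i* (y - t)) - ((a - s) +i* (y - t))); last first.
      by apply: eq_ReIm; rewrite ?ReD ?ImD ?ReN ?ImN /=; ring.
    by ring.
  rewrite (le_trans (normc_triangleB _ _))// (splitr e) mulrDl lerD//; apply: EB => //.
    by rewrite ab lexx.
  by rewrite ab lexx.
have b2 : Normc.normc (cint leb `[a, b] (fun x => K x d - K x c - c2)) <=
    e * (b - a + (d - c)) * (b - a).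
  apply: cint_segment_bound => // x axb.
  rewrite (_ : _ - _ - _ = E x d - E x c); last first.
    rewrite /E /c2 -mulrA (_ : 'i%C * (d - c)%:C = ((x - s) +i* (d - t)) - ((x - s) +i* (c - t))); last first.
      by apply: eq_ReIm; rewrite ?ReM ?ImM ?ReD ?ImD ?ReN ?ImN /=; ring.
    by ring.
  rewrite (le_trans (normc_triangleB _ _))// (splitr e) mulrDl lerD//; apply: EB => //.
    by rewrite cd lexx.
  by rewrite cd lexx.
rewrite (le_trans (normc_triangleB _ _))// Normc.normcM (_ : Normc.normc 'i%C = 1); last first.
  by rewrite /Normc.normc expr0n add0r expr1n sqrtr1.
rewrite mul1r (le_trans (lerD b1 b2))// /rect_size /= -mulrDr expr2 -mulrA.
by rewrite [d - c + (b - a)]addrC.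
Qed.

Lemma rect_int_bound (Q : rect) M : valid_rect Q -> rect_cont Q ->
  (forall s t, in_rect Q s t -> Normc.normc (K s t) <= M) ->
  Normc.normc (rect_int Q) <= 2 * M * rect_size Q.
Proof.
case: Q => [[a b] [c d]] [ab cd] cQ KM; rewrite /= in ab cd.
have iT := rect_cont_integrable_t cQ (lexx _) (lexx _).
have iS := rect_cont_integrable_s cQ (lexx _) (lexx _).
rewrite /= in iT iS.
rewrite (le_trans (normc_triangleB _ _))// Normc.normcM (_ : Normc.normc 'i%C = 1); last first.
  by rewrite /Normc.normc expr0n add0r expr1n sqrtr1.
rewrite mul1r /rect_size /= mulrDr addrC lerD//.
  apply: cint_segment_bound => //.
    by apply: cintegrableB; [by []|apply: iS; rewrite ?lexx ?cd..].
  move=> s sQ; rewrite (le_trans (normc_triangleB _ _))// mulr_natl mulr2n.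
  by rewrite lerD// KM//; split => //=; rewrite ?lexx ?cd.
apply: cint_segment_bound => //.
  by apply: cintegrableB; [by []|apply: iT; rewrite ?lexx ?ab..].
move=> s sQ; rewrite (le_trans (normc_triangleB _ _))// mulr_natl mulr2n.
by rewrite lerD// KM//; split => //=; rewrite ?lexx ?ab.
Qed.

(** Pieces that avoid the exceptional point contribute 0, so the integral equals that over an
    arbitrarily small square around it, which a local bound on K makes negligible. *)
Theorem Goursat_rectangle_except (Q : rect) (s0 t0 M r : R) : valid_rect Q ->
  rect_cont Q -> Q.1.1 < s0 < Q.1.2 -> Q.2.1 < t0 < Q.2.2 -> 0 < r ->
  (forall s t, in_rect Q s t -> s <> s0 \/ t <> t0 -> exists c, cdiff K s t c) ->
  (forall s t, `|s - s0| < r -> `|t - t0| < r -> Normc.normc (K s t) <= M) ->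
  rect_int Q = 0.
Proof.
case: Q => [[a b] [c d]] [ab cd] cQ; rewrite /= in ab cd * => /andP[as0 s0b] /andP[ct0 t0d] r0 dK KM.
have M0 : 0 <= M by rewrite (le_trans (normc_ge0 (K s0 t0)))// KM// subrr normr0.
apply: contrapT => J0.
have Jp : 0 < Normc.normc (rect_int ((a, b), (c, d))) by apply: normc_gt0; apply/eqP.
(* A square of half-side h has size 4 h, whence the bound 8 M h from [rect_int_bound]. Dividing by M
   + 1 covers M = 0, and halving the minimum makes all the inequalities strict. *)
have [h [h0 hr ha hb hc]] : exists h : R, [/\ 0 < h, h < r, h < s0 - a, h < b - s0 &
    [/\ h < t0 - c, h < d - t0 &
    8 * M * h < Normc.normc (rect_int ((a, b), (c, d)))]].
  pose u : R := Num.min (Num.min r (Num.min (s0 - a) (b - s0)))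
           (Num.min (Num.min (t0 - c) (d - t0))
             (Normc.normc (rect_int ((a, b), (c, d))) / (8 * (M + 1)))).
  have M1 : 0 < M + 1 by rewrite ltr_wpDl.
  have u0 : 0 < u.
    by rewrite /u !lt_min r0 !subr_gt0 as0 s0b ct0 t0d divr_gt0// mulr_gt0.
  have : u / 2 < u by rewrite ltr_pdivrMr// ltr_pMr// ltr1n.
  rewrite {2}/u !lt_min => /andP[/andP[h1 /andP[h2 h3]] /andP[/andP[h4 h5] h6]].
  exists (u / 2); split => //; first by rewrite divr_gt0.
  split => //; move: h6; rewrite ltr_pdivlMr ?mulr_gt0//; apply: le_lt_trans.
  have aux (w : R) : 0 < w -> 8 * M * (w / 2) <= w / 2 * (8 * (M + 1)).
    by clear => ?; lra.
  exact: aux.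
case: hc => hc hd hJ.
have sub a' b' c' d' : a <= a' -> b' <= b -> c <= c' -> d' <= d ->
  subrect ((a, b), (c, d)) ((a', b'), (c', d')) by move=> *; split.
have zero a' b' c' d' : a <= a' -> b' <= b -> c <= c' -> d' <= d -> a' <= b' -> c' <= d' ->
    (s0 < a' \/ b' < s0) \/ (t0 < c' \/ d' < t0) -> rect_int ((a', b'), (c', d')) = 0.
  move=> h1 h2 h3 h4 h5 h6 hh; apply: Goursat_rectangle => //.
  move=> s t [/= /andP[s1 s2] /andP[t1 t2]]; apply: dK.
    by split; rewrite /= ?(le_trans h1)// ?(le_trans s2)// ?(le_trans h3)// ?(le_trans t2).
  case: hh => [[hh|hh]|[hh|hh]]; [left|left|right|right] => e; subst.
  - by move: (le_lt_trans s1 hh); rewrite ltxx.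
  - by move: (lt_le_trans hh s2); rewrite ltxx.
  - by move: (le_lt_trans t1 hh); rewrite ltxx.
  - by move: (lt_le_trans hh t2); rewrite ltxx.
have [l1 l2 l3 l4] : [/\ a <= s0 - h, s0 + h <= b, c <= t0 - h & t0 + h <= d].
  by clear - ha hb hc hd; split; lra.
have [l5 l6 l7 l8] : [/\ s0 - h < s0, s0 < s0 + h, t0 - h < t0 & t0 < t0 + h].
  by clear - h0; split; lra.
have l56 := ltW (lt_trans l5 l6); have l78 := ltW (lt_trans l7 l8).
have l25 := le_trans l56 l2; have l48 := le_trans l78 l4.
have l16 := le_trans l1 l56; have l37 := le_trans l3 l78.
(* Four cuts, to the left, to the right, below and above, isolate the central square. *)
have E : rect_int ((a, b), (c, d)) = rect_int ((s0 - h, s0 + h), (t0 - h, t0 + h)).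
  have p1 : a <= s0 - h <= b by rewrite l1.
  have p2 : s0 - h <= s0 + h <= b by rewrite l56.
  have p3 : c <= t0 - h <= d by rewrite l3.
  have p4 : t0 - h <= t0 + h <= d by rewrite l78.
  have L (x : R) := lexx x.
  rewrite (rect_int_split_s cQ p1 (sub _ _ _ _ (L _) (L _) (L _) (L _)) (conj ab cd)).
  rewrite (@zero a) ?add0r//; last by left; right.
  rewrite (rect_int_split_s cQ p2 (sub _ _ _ _ l1 (L _) (L _) (L _)) (conj l25 cd)).
  rewrite (@zero (s0 + h)) ?addr0//; last by left; left.
  rewrite (rect_int_split_t cQ p3 (sub _ _ _ _ l1 l2 (L _) (L _)) (conj l56 cd)).
  rewrite (@zero _ _ c) ?add0r//; last by right; right.
  rewrite (rect_int_split_t cQ p4 (sub _ _ _ _ l1 l2 l3 (L _)) (conj l56 l48)).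
  by rewrite (@zero _ _ (t0 + h)) ?addr0//; right; left.
have : Normc.normc (rect_int ((a, b), (c, d))) <= 8 * M * h.
  rewrite E (_ : 8 * M * h = 2 * M * rect_size ((s0 - h, s0 + h), (t0 - h, t0 + h))); last first.
    by rewrite /rect_size /=; ring.
  apply: rect_int_bound => //.
    move=> s t [/= /andP[s1 s2] /andP[t1 t2]]; apply: cQ; split => /=.
      by rewrite (le_trans l1)// (le_trans s2).
    by rewrite (le_trans l3)// (le_trans t2).
  move=> s t [/= sQ tQ]; apply: KM; apply: le_lt_trans hr.
    by rewrite ler_distl.
  by rewrite ler_distl.
by rewrite leNgt hJ.
Qed.

End Goursat.

(** * Circle integrals as sides of a rectangle *)

Section CircleMean.
Context {R : realType}.
Notation leb := (@lebesgue_measure R).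

Definition circle_int (G : R[i] -> R[i]) (r : R) : R[i] :=
  cint leb `[0, 2 * pi] (fun t => G (r%:C * cis t)).

Lemma pi2_ge0 : 0 <= 2 * pi :> R.
Proof. by rewrite mulr_ge0// pi_ge0. Qed.

Lemma cis_2pi : cis (2 * pi) = 1 :> R[i].
Proof. by rewrite /cis mulr_natl cos2pi sin2pi. Qed.

Lemma normc_polar (r t : R) : 0 <= r -> Normc.normc (r%:C * cis t) = r.
Proof. by move=> r0; rewrite Normc.normcM normc_cis mulr1 normcR ger0_norm. Qed.

(** In the coordinate s = log r an annulus is a rectangle; the sides t = 0 and t = 2 pi carry the
    same values and cancel, which leaves the two circles. *)
Lemma circle_int_constant G (r1 r2 : R) : 0 < r1 -> r1 <= r2 ->
  (forall z, r1 <= Normc.normc z <= r2 -> cderivable G z) ->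
  circle_int G r1 = circle_int G r2.
Proof.
move=> r10 r12 dG; have r20 := lt_le_trans r10 r12.
pose K s t := G ((expR s)%:C * cis t).
pose Q : rect := ((ln r1, ln r2), (0, 2 * pi)).
have vQ : valid_rect Q by split => /=; [rewrite ler_ln|exact: pi2_ge0].
have dK s t : in_rect Q s t -> exists c, cdiff K s t c.
  move=> [/= /andP[s1 s2] _]; apply: (cdiff_comp (cdiff_polar s t)).
  apply: dG; rewrite normc_polar ?expR_ge0//.
  by rewrite -ler_ln ?posrE ?expR_gt0// expRK s1 -ler_ln ?posrE ?expR_gt0// expRK.
have := Goursat_rectangle vQ dK.
have Z : cint leb `[ln r1, ln r2] (fun s => K s (2 * pi) - K s 0) = 0.
  rewrite -[RHS](cint0 leb `[ln r1, ln r2]); apply: eq_cint => s _.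
  by rewrite /K cis_2pi cis0 subrr.
rewrite /rect_int [X in _ - X]Z subr0 => /eqP; rewrite mulf_eq0 => /orP[/eqP[] /eqP|]; first by rewrite oner_eq0.
have iK s : ln r1 <= s <= ln r2 -> cintegrable leb `[0, 2 * pi] (K s).
  move=> sQ; apply: ccont_segment_integrable => t tQ.
  by have [c /cdiff_ccont[]] := dK s t (conj sQ tQ).
have l12 : ln r1 <= ln r2 by rewrite ler_ln.
rewrite cintB//; try by apply: iK; rewrite l12 lexx.
rewrite subr_eq0 => /eqP /esym; rewrite /circle_int /K !lnK//.
Qed.

End CircleMean.

(** * Rules for complex derivatives and continuity *)

Section CDerivable.
Context {R : realType}.
Implicit Types (G : R[i] -> R[i]) (z w : R[i]).

Lemma cderivable_cst c z : cderivable (fun=> c) z.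
Proof.
exists 0 => e e0; exists 1 => // h _.
by rewrite subrr mul0r subrr normc0E mulr_ge0 ?normc_ge0// ltW.
Qed.

Lemma cderivable_id z : cderivable id z.
Proof.
exists 1 => e e0; exists 1 => // h _.
rewrite mul1r [z + h]addrC addrK subrr normc0E mulr_ge0 ?normc_ge0// ltW//.
Qed.

Lemma cderivableM G1 G2 z : cderivable G1 z -> cderivable G2 z ->
  cderivable (fun w => G1 w * G2 w) z.
Proof.
move=> /derivable_cderivable h1 /derivable_cderivable h2.
apply/derivable_cderivable; exact: (derivableM h1 h2).
Qed.

Lemma cderivableB G1 G2 z : cderivable G1 z -> cderivable G2 z ->
  cderivable (fun w => G1 w - G2 w) z.
Proof.
move=> /derivable_cderivable h1 /derivable_cderivable h2.
apply/derivable_cderivable; exact: (derivableB h1 h2).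
Qed.

Lemma cderivableD G1 G2 z : cderivable G1 z -> cderivable G2 z ->
  cderivable (fun w => G1 w + G2 w) z.
Proof.
move=> /derivable_cderivable h1 /derivable_cderivable h2.
apply/derivable_cderivable; exact: (derivableD h1 h2).
Qed.

Lemma cderivableV G z : G z != 0 -> cderivable G z ->
  cderivable (fun w => (G w)^-1) z.
Proof.
move=> h1 /derivable_cderivable h2.
apply/derivable_cderivable; exact: (derivableV h1 h2).
Qed.

Lemma cderivableX G z n : cderivable G z -> cderivable (fun w => G w ^+ n) z.
Proof.
move=> h; elim: n => [|n IH].
  by under eq_fun do rewrite expr0; exact: cderivable_cst.
by under eq_fun do rewrite exprS; exact: cderivableM.
Qed.

Lemma cderivable_near G H z (d : R) : 0 < d ->
  (forall w, Normc.normc (w - z) < d -> G w = H w) ->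
  cderivable G z -> cderivable H z.
Proof.
move=> d0 GH [c Gc]; exists c => e e0; have [d1 d10 H1] := Gc e e0.
exists (Num.min d d1) => [|h]; first by rewrite lt_min d0.
rewrite lt_min => /andP[hd hd1]; rewrite -!GH; first exact: H1.
  by rewrite subrr normc0E.
by rewrite [z + h]addrC addrK.
Qed.

Definition ccontinuous G z := forall e : R, 0 < e -> exists2 d : R, 0 < d &
  forall h, Normc.normc h < d -> Normc.normc (G (z + h) - G z) <= e.

Lemma cderivable_ccontinuous G z : cderivable G z -> ccontinuous G z.
Proof.
move=> [c Gc] e e0; have [d d0 H] := Gc 1 ltr01.
pose M := Normc.normc c + 1.
have M0 : 0 < M by rewrite ltr_pwDr// normc_ge0.
exists (Num.min d (e / M)) => [|h]; first by rewrite lt_min d0 divr_gt0.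
rewrite lt_min => /andP[hd]; rewrite ltr_pdivlMr// => he.
rewrite -[_ - _](subrK (c * h)) (le_trans (normc_triangle _ _))//.
rewrite (le_trans (lerD (H _ hd) (lexx _)))// Normc.normcM -mulrDl addrC mulrC.
exact: ltW.
Qed.

Lemma cdiff_continuous (K : R -> R -> R[i]) s t c : cdiff K s t c ->
  forall e : R, 0 < e -> exists2 d : R, 0 < d & forall h k, `|h| < d -> `|k| < d ->
    Normc.normc (K (s + h) (t + k) - K s t) <= e.
Proof.
move=> Kc e e0; have [d d0 Kd] := Kc 1 ltr01.
pose M := Normc.normc c + 1.
have M0 : 0 < M by rewrite ltr_pwDr// normc_ge0.
exists (Num.min d (e / (2 * M))); first by rewrite lt_min d0 divr_gt0// mulr_gt0.
move=> h k; rewrite !lt_min => /andP[hd he] /andP[kd ke].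
rewrite -[_ - _](subrK (c * (h +i* k))) (le_trans (normc_triangle _ _))//.
rewrite (le_trans (lerD (Kd _ _ hd kd) (lexx _)))// Normc.normcM mul1r.
have := ler_wpM2l (normc_ge0 c) (normc_pair_le h k).
move: he ke; rewrite !ltr_pdivlMr ?mulr_gt0// /M.
move: (Normc.normc (h +i* k)) (Normc.normc c) (`|h|) (`|k|) => n C a b; lra.
Qed.

(** Transports mere continuity to the logarithmic coordinate, which is all that is known at the
    exceptional point. *)
Lemma ccontinuous_polar G s t : ccontinuous G ((expR s)%:C * cis t) ->
  forall e : R, 0 < e -> exists2 d : R, 0 < d & forall h k, `|h| < d -> `|k| < d ->
    Normc.normc (G ((expR (s + h))%:C * cis (t + k)) - G ((expR s)%:C * cis t)) <= e.
Proof.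
move=> Gc e e0; have [d d0 Gd] := Gc e e0.
have d2 : 0 < d / 2 by rewrite divr_gt0.
have [d' d'0 H] := cdiff_continuous (cdiff_polar s t) d2.
exists d' => // h k hd kd; have {}H := H h k hd kd.
have := Gd ((expR (s + h))%:C * cis (t + k) - (expR s)%:C * cis t).
rewrite [X in G X](_ : _ = (expR (s + h))%:C * cis (t + k)); last by rewrite addrC subrK.
by apply; rewrite (le_lt_trans H)// ltr_pdivrMr// ltr_pMr// ltr1n.
Qed.

Lemma ccontinuous_polar_ccont G s t : ccontinuous G ((expR s)%:C * cis t) ->
  ccont (fun s => G ((expR s)%:C * cis t)) s /\
  ccont (fun t => G ((expR s)%:C * cis t)) t.
Proof.
move=> /ccontinuous_polar H; split => e e0; have [d d0 Hd] := H e e0; exists d => // y yd.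
  have := Hd (y - s) 0 yd; rewrite normr0 => /(_ d0).
  by rewrite addr0 [s + _]addrC subrK.
have := Hd 0 (y - t); rewrite normr0 => /(_ d0 yd).
by rewrite addr0 [t + _]addrC subrK.
Qed.

End CDerivable.

(** * Cauchy's theorem on circles and the Taylor expansion *)

Section CircleIntegrals.
Context {R : realType}.
Notation leb := (@lebesgue_measure R).
Implicit Types (G v : R[i] -> R[i]) (z w : R[i]).

Lemma circle_integrable G r : 0 < r ->
  (forall w, Normc.normc w = r -> cderivable G w) ->
  cintegrable leb `[0, 2 * pi] (fun t => G (r%:C * cis t)).
Proof.
move=> r0 dG; apply: ccont_segment_integrable => t _.
rewrite -{1}(lnK r0); apply: (ccontinuous_polar_ccont _).2.
by apply: cderivable_ccontinuous; apply: dG; rewrite normc_polar ?expR_ge0// lnK.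
Qed.

(** By the half-angle formula sin (x / 2) = 0, and the sine has no zero strictly between 0 and
    pi. *)
Lemma cos_eq1_small (x : R) : `|x| < 2 * pi -> cos x = 1 -> x = 0.
Proof.
move=> x2 c1; apply: contrapT => /eqP x0.
have : sin (x / 2) ^+ 2 = 0.
  have := cosD (x / 2) (x / 2); rewrite -splitr c1.
  have := cos2Dsin2 (x / 2); rewrite -!expr2; lra.
move/eqP; rewrite sqrf_eq0 => /eqP s0.
have [xp|xn] := ltP 0 x.
  have : 0 < sin (x / 2).
    apply: sin_gt0_pi; rewrite divr_gt0//= ltr_pdivrMr// mulrC.
    by move: x2; rewrite gtr0_norm.
  by rewrite s0 ltxx.
have {}xn : x < 0 by rewrite lt_neqAle x0.
have : 0 < sin (- x / 2).
  apply: sin_gt0_pi; rewrite divr_gt0//= ?oppr_gt0// ltr_pdivrMr// mulrC.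
  by move: x2; rewrite ltr0_norm.
by rewrite mulNr sinN s0 oppr0 ltxx.
Qed.

Lemma cis_inj (s t : R) : `|s - t| < 2 * pi -> cis s = cis t -> s = t.
Proof.
move=> st e; apply/eqP; rewrite -subr_eq0; apply/eqP; apply: cos_eq1_small => //.
have : cis (s - t) = 1.
  by rewrite cisD e -cisD subrr cis0.
by move=> /(congr1 (@complex.Re R)).
Qed.

(** The angle [t0] is strictly inside ]0, 2 pi[ so that the exceptional point is interior to the
    rectangle; the Taylor expansion inherits this slit along theta = 0. *)
Lemma circle_int_constant_except G (r1 r2 r0 t0 : R) :
  0 < r1 -> r1 < r0 -> r0 < r2 -> 0 < t0 < 2 * pi ->
  (forall w, r1 <= Normc.normc w <= r2 -> w <> r0%:C * cis t0 -> cderivable G w) ->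
  ccontinuous G (r0%:C * cis t0) ->
  circle_int G r1 = circle_int G r2.
Proof.
move=> r10 r1r0 r0r2 /andP[t00 t02] dG cG.
have r00 := lt_trans r10 r1r0; have r20 := lt_trans r00 r0r2.
pose K s t := G ((expR s)%:C * cis t).
pose Q : rect := ((ln r1, ln r2), (0, 2 * pi)).
have vQ : valid_rect Q.
  by split => /=; [rewrite ler_ln// ltW// (lt_trans r1r0)|exact: pi2_ge0].
have dG' s t : in_rect Q s t -> s <> ln r0 \/ t <> t0 -> cderivable G ((expR s)%:C * cis t).
  move=> [/= /andP[s1 s2] /andP[t1 t2]] st; apply: dG.
    rewrite normc_polar ?expR_ge0//.
    by rewrite -ler_ln ?posrE ?expR_gt0// expRK s1 -ler_ln ?posrE ?expR_gt0// expRK.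
  move=> e; have := congr1 (@Normc.normc R) e.
  rewrite !normc_polar ?expR_ge0 ?(ltW r00)// => es.
  have s0 : s = ln r0 by rewrite -es expRK.
  case: st => // [] []; apply: cis_inj.
    rewrite ltr_norml ltrBrDl ltrBlDl; apply/andP; split.
      by rewrite (lt_le_trans t02)// lerDl.
    by rewrite ltrBlDr (le_lt_trans t2)// ltrDl.
  move: e; rewrite es => /(congr1 (fun w => r0%:C^-1 * w)).
  have r0C : r0%:C != 0 :> R[i] by rewrite eq_complex /= eqxx andbT gt_eqF.
  by rewrite !mulrA mulVf// !mul1r.
have cQ : rect_cont K Q.
  move=> s t st; apply: ccontinuous_polar_ccont.
  have [[-> ->]|h] := pselect (s = ln r0 /\ t = t0); first by rewrite lnK.
  apply/cderivable_ccontinuous/dG' => //.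
  by apply/not_andP.
have [r [M [r' KM]]] : exists r M, 0 < r /\
    forall s t, `|s - ln r0| < r -> `|t - t0| < r -> Normc.normc (K s t) <= M.
  rewrite -(lnK r00) in cG; have [d d0 Hd] := ccontinuous_polar cG ltr01.
  exists d, (1 + Normc.normc (K (ln r0) t0)); split => // s t sd td.
  have := Hd _ _ sd td; rewrite [ln r0 + _]addrC subrK [t0 + _]addrC subrK => h.
  by rewrite -[K s t](subrK (K (ln r0) t0)) (le_trans (normc_triangle _ _))// lerD2r.
have H : rect_int K Q = 0.
  apply: (Goursat_rectangle_except vQ cQ _ _ r' _ KM).
  - by rewrite /= !ltr_ln// r1r0.
  - by rewrite /= t00.
  - by move=> s t sQ st; apply: (cdiff_comp (cdiff_polar s t)); exact: dG'.
move: H.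
have Z : cint leb `[ln r1, ln r2] (fun s => K s (2 * pi) - K s 0) = 0.
  rewrite -[RHS](cint0 leb `[ln r1, ln r2]); apply: eq_cint => s _.
  by rewrite /K cis_2pi cis0 subrr.
rewrite /rect_int [X in _ - X]Z subr0 => /eqP; rewrite mulf_eq0 => /orP[/eqP[] /eqP|]; first by rewrite oner_eq0.
have iK s : ln r1 <= s <= ln r2 -> cintegrable leb `[0, 2 * pi] (K s).
  by move=> sQ; apply: (rect_cont_integrable_t cQ).
have l12 : ln r1 <= ln r2 by rewrite ler_ln// ltW// (lt_trans r1r0).
rewrite cintB//; try by apply: iK; rewrite l12 lexx.
rewrite subr_eq0 => /eqP /esym; rewrite /circle_int /K !lnK//.
Qed.

Lemma circle_int_bound G r M : 0 < r ->
  (forall w, Normc.normc w = r -> cderivable G w) ->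
  (forall w, Normc.normc w = r -> Normc.normc (G w) <= M) ->
  Normc.normc (circle_int G r) <= M * (2 * pi).
Proof.
move=> r0 dG GM; rewrite -[2 * pi]subr0.
apply: cint_segment_bound; [exact: pi2_ge0|exact: circle_integrable|].
by move=> t _; apply: GM; rewrite normc_polar ?ltW.
Qed.

(** The circle integral of w^m does not depend on the radius and yet scales like r^m; the radii 1
    and 2 are compared. *)
Lemma cint_cisX_eq0 m : (0 < m)%N -> cint leb `[0, 2 * pi] (fun t => cis t ^+ m) = 0.
Proof.
move=> m0; have dX w : cderivable (fun w : R[i] => w ^+ m) w.
  by apply: cderivableX; exact: cderivable_id.
have E r : 0 < r -> circle_int (fun w => w ^+ m) r =
    (r ^+ m)%:C * cint leb `[0, 2 * pi] (fun t => cis t ^+ m).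
  move=> r0; rewrite -cintZ//; last first.
    have := circle_integrable ltr01 (fun w _ => dX w).
    by apply: eq_cintegrable => // t _; rewrite mul1r.
  by apply: eq_cint => t _; rewrite exprMn rmorphXn.
have := circle_int_constant ltr01 (ler1n _ 2) (fun w _ => dX w).
rewrite !E// expr1n mul1r => /eqP; rewrite eq_sym -subr_eq0 -{2}[cint _ _ _]mul1r -mulrBl.
rewrite mulf_eq0 => /orP[|/eqP//].
rewrite subr_eq0 => /eqP[] h; have : 1 < 2 ^+ m :> R by rewrite exprn_egt1 ?ltr1n// -lt0n.
by rewrite h ltxx.
Qed.

Lemma cint_cst_circle (c : R[i]) : cint leb `[0, 2 * pi] (fun=> c) = (2 * pi)%:C * c.
Proof. by rewrite cint_segment_cst ?subr0// pi2_ge0. Qed.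

Lemma cint_cisVX_eq0 m : (0 < m)%N ->
  cint leb `[0, 2 * pi] (fun t => (cis t)^-1 ^+ m) = 0.
Proof.
move=> m0; have e t : (cis t)^-1 ^+ m = conjc (cis t ^+ m) :> R[i].
  rewrite rmorphXn /=; congr (_ ^+ m); apply: (mulfI (x := cis t)).
    by apply/eqP => /(congr1 (@Normc.normc R)); rewrite normc_cis normc0E => /eqP; rewrite oner_eq0.
  rewrite mul_conj_normc normc_cis expr1n divff//.
  by apply/eqP => /(congr1 (@Normc.normc R)); rewrite normc_cis normc0E => /eqP; rewrite oner_eq0.
have -> : cint leb `[0, 2 * pi] (fun t => (cis t)^-1 ^+ m) =
    cint leb `[0, 2 * pi] (fun t => conjc (cis t ^+ m)).
  by apply: eq_cint => t _; exact: e.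
rewrite cint_conj// ?cint_cisX_eq0 ?conjc0//.
have := circle_integrable ltr01 (fun w _ => cderivableX m (cderivable_id w)).
by apply: eq_cintegrable => // t _; rewrite mul1r.
Qed.

Definition cderivable_disk (v : R[i] -> R[i]) :=
  forall w, Normc.normc w < 1 -> cderivable v w.

(** Cauchy's coefficient integral written against dt: one power of w has been absorbed by dw = i w
    dt. The radius 1 / 2 is an arbitrary choice, by [taylor_circle]. *)
Definition taylor_coef (v : R[i] -> R[i]) (m : nat) : R[i] :=
  circle_int (fun w => v w * w^-1 ^+ m) (1 / 2) / (2 * pi)%:C.

Lemma normc_neq0 (w : R[i]) : 0 < Normc.normc w -> w != 0.
Proof. by apply: contraTneq => ->; rewrite normc0E ltxx. Qed.

Lemma pi2C_neq0 : (2 * pi)%:C != 0 :> R[i].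
Proof. by rewrite eq_complex /= eqxx andbT gt_eqF// mulr_gt0// pi_gt0. Qed.

Lemma cderivable_divX v m w : cderivable v w -> w != 0 ->
  cderivable (fun w => v w * w^-1 ^+ m) w.
Proof.
move=> vw w0; apply: cderivableM => //; apply: cderivableX; apply: cderivableV => //.
exact: cderivable_id.
Qed.

Lemma taylor_circle v m r : cderivable_disk v -> 0 < r < 1 ->
  circle_int (fun w => v w * w^-1 ^+ m) r = (2 * pi)%:C * taylor_coef v m.
Proof.
move=> dv /andP[r0 r1].
have e (x : R[i]) : (2 * pi)%:C * (x / (2 * pi)%:C) = x by rewrite mulrC divfK ?pi2C_neq0.
rewrite /taylor_coef e {e}.
have H a b : 0 < a -> a <= b -> b < 1 -> circle_int (fun w => v w * w^-1 ^+ m) a =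
    circle_int (fun w => v w * w^-1 ^+ m) b.
  move=> a0 ab b1; apply: circle_int_constant => // w /andP[aw wb].
  by apply: cderivable_divX; [apply: dv; exact: le_lt_trans b1|apply: normc_neq0; exact: lt_le_trans aw].
have h2 : 0 < 1 / 2 :> R by rewrite divr_gt0.
have h21 : 1 / 2 < 1 :> R by rewrite ltr_pdivrMr// mul1r ltr1n.
have [h|/ltW h] := leP r (1 / 2); first exact: H.
by apply/esym; exact: H.
Qed.

(** The factor w accounts for dw = i w dt, so a circle integral of this function is a Cauchy
    integral of the difference quotient. With c the derivative of v at z, the value chosen at z
    makes it continuous there. *)
Definition cauchy_quot v z (c : R[i]) w :=
  if w == z then c * w else (v w - v z) / (w - z) * w.

Lemma cauchy_quot_cderivable v z c w : cderivable v w -> w <> z ->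
  cderivable (cauchy_quot v z c) w.
Proof.
move=> dv wz; have wz0 : 0 < Normc.normc (w - z).
  by apply: normc_gt0; rewrite subr_eq0; apply/eqP.
apply: (@cderivable_near _ (fun w => (v w - v z) / (w - z) * w) _ w _ wz0).
  move=> x xw; rewrite /cauchy_quot; case: eqP => // xz.
  by move: xw; rewrite xz normc_dist ltxx.
apply: cderivableM; last exact: cderivable_id.
apply: cderivableM.
  by apply: cderivableB => //; exact: cderivable_cst.
apply: (@cderivableV _ (fun w => w - z)); first by rewrite subr_eq0; apply/eqP.
by apply: cderivableB; [exact: cderivable_id|exact: cderivable_cst].
Qed.

Lemma cauchy_quot_continuous v z : cderivable v z ->
  exists c, ccontinuous (cauchy_quot v z c) z.
Proof.
move=> [c vc]; exists c.
have : ccontinuous (fun w => if w == z then c else (v w - v z) / (w - z)) z.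
  move=> e e0; have [d d0 H] := vc e e0; exists d => // h hd; rewrite eqxx.
  case: eqP => [_|/eqP hz]; first by rewrite subrr normc0E ltW.
  have h0 : h != 0 by apply: contraNneq hz => ->; rewrite addr0.
  have hp := normc_gt0 h0.
  rewrite [X in _ / X](_ : _ = h); last by rewrite addrC addKr.
  rewrite -(ler_pM2r hp) -Normc.normcM mulrBl divfK//.
  exact: H.
move=> H e e0.
have [d1 d10 H1] := H 1 ltr01.
pose M := 1 + Normc.normc c.
have M0 : 0 < M by rewrite ltr_wpDr// normc_ge0.
have e1 : 0 < e / 2 / (1 + Normc.normc z).
  by rewrite !divr_gt0// ltr_wpDr// normc_ge0.
have [d2 d20 H2] := H _ e1.
exists (Num.min d1 (Num.min d2 (e / 2 / M))) => [|h].
  by rewrite !lt_min d10 d20 !divr_gt0.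
rewrite !lt_min => /andP[/H1 h1 /andP[/H2 h2 h3]].
pose q w := if w == z then c else (v w - v z) / (w - z).
have qE w : cauchy_quot v z c w = q w * w by rewrite /cauchy_quot /q; case: ifP.
rewrite -!/(q _) in h1 h2; rewrite !qE.
have qz : q z = c by rewrite /q eqxx.
rewrite (_ : _ - _ = (q (z + h) - q z) * z + q (z + h) * h); last by ring.
rewrite (le_trans (normc_triangle _ _))// (splitr e) lerD// Normc.normcM.
  move: h2; rewrite ler_pdivlMr ?ltr_wpDr ?normc_ge0//; apply: le_trans.
  by rewrite ler_wpM2l ?normc_ge0// lerDr.
apply: (@le_trans _ _ (M * Normc.normc h)).
  rewrite ler_wpM2r ?normc_ge0// -[q (z + h)](subrK (q z)).
  by rewrite (le_trans (normc_triangle _ _))// qz lerD2r -qz.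
by move: h3; rewrite ltr_pdivlMr// mulrC => /ltW.
Qed.

(** The integral is the same for all radii, even across |z|, and on small circles the factor w makes
    it tend to 0. *)
Lemma circle_cauchy_quot v r0 t0 r c : cderivable_disk v ->
  0 < r0 -> r0 < r -> r < 1 -> 0 < t0 < 2 * pi ->
  ccontinuous (cauchy_quot v (r0%:C * cis t0) c) (r0%:C * cis t0) ->
  circle_int (cauchy_quot v (r0%:C * cis t0) c) r = 0.
Proof.
move=> dv r00 r0r r1 t0Q; set z := r0%:C * cis t0 => cG.
have nz : Normc.normc z = r0 by rewrite normc_polar// ltW.
set G := cauchy_quot v z c in cG *.
have dG w : Normc.normc w < 1 -> w <> z -> cderivable G w.
  by move=> w1 wz; apply: cauchy_quot_cderivable => //; exact: dv.
have [d d0 Hd] := cderivable_ccontinuous (dv 0 ltac:(by rewrite normc0E)) ltr01.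
(* Near 0 the numerator of the quotient is at most 1 + |v 0 - v z| and its denominator at least r0 /
   2. *)
pose M := (1 + Normc.normc (v 0 - v z)) * (2 / r0).
have pi0 : 0 < 2 * pi :> R by rewrite mulr_gt0// pi_gt0.
have M0 : 0 < M by rewrite mulr_gt0 ?divr_gt0// ltr_wpDr// normc_ge0.
apply: contrapT => /eqP/normc_gt0 C0.
pose q1 := Num.min (Num.min (d / 2) (r0 / 2)) (Normc.normc (circle_int G r) / (M * (2 * pi)) / 2).
have q10 : 0 < q1 by rewrite !lt_min !divr_gt0// mulr_gt0.
have half (x : R) : 0 < x -> x / 2 < x by move=> x0; rewrite ltr_pdivrMr// ltr_pMr// ltr1n.
have q1d : q1 < d by rewrite !gt_min half.
have q1r0 : q1 <= r0 / 2 by rewrite !ge_min lexx orbT.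
have q1r0' : q1 < r0 by rewrite (le_lt_trans q1r0)// half.
have q1C : q1 * (M * (2 * pi)) < Normc.normc (circle_int G r).
  have M2 : 0 < M * (2 * pi) by exact: mulr_gt0.
  rewrite -ltr_pdivlMr//.
  have : q1 <= Normc.normc (circle_int G r) / (M * (2 * pi)) / 2 by rewrite ge_min lexx orbT.
  by move/le_lt_trans; apply; apply: half; exact: divr_gt0.
have E : circle_int G q1 = circle_int G r.
  apply: (circle_int_constant_except q10 q1r0' r0r t0Q _ cG) => w /andP[_ wr].
  by apply: dG; exact: le_lt_trans r1.
move: q1C; rewrite -E ltNge => /negP; apply.
rewrite mulrA; apply: circle_int_bound => // w wq1.
  apply: dG; first by rewrite wq1 (lt_trans q1r0')// (lt_trans r0r).
  by move=> wz; move: q1r0'; rewrite -wq1 wz nz ltxx.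
rewrite /G /cauchy_quot; case: eqP => [wz|/eqP wz].
  by move: q1r0'; rewrite -wq1 wz nz ltxx.
rewrite Normc.normcM wq1 mulrC ler_pM2l// Normc.normcM ler_pM ?normc_ge0//.
  rewrite (_ : v w - v z = (v (0 + w) - v 0) + (v 0 - v z)); last by rewrite add0r; ring.
  by rewrite (le_trans (normc_triangle _ _))// lerD2r Hd// wq1.
rewrite Normc.normcV -[X in _ <= X]invrK lef_pV2 ?posrE ?invr_gt0 ?divr_gt0//; last first.
  by apply: normc_gt0; rewrite subr_eq0.
rewrite invf_div; have := normc_triangle (z - w) w; rewrite subrK nz wq1 normc_dist; lra.
Qed.

(** On a circle of radius p between |z| and 1, summing (v w - v z) (z / w)^m gives the Cauchy
    quotient up to a term of order (|z| / p)^M, and the quotient itself integrates to 0. *)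
Theorem taylor_expansion v r t : cderivable_disk v -> 0 < r < 1 -> 0 < t < 2 * pi ->
  ccvg (fun M => \sum_(m < M) taylor_coef v m * (r%:C * cis t) ^+ m) (v (r%:C * cis t)).
Proof.
move=> dv /andP[r0 r1] tQ; set z := r%:C * cis t.
have nz : Normc.normc z = r by rewrite normc_polar// ltW.
have z1 : Normc.normc z < 1 by rewrite nz.
have [c cG] := cauchy_quot_continuous (dv z z1).
pose p : R := (r + 1) / 2.
have rp : r < p by rewrite /p; lra.
have p1 : p < 1 by rewrite /p; lra.
have p0 := lt_trans r0 rp.
have G0 := circle_cauchy_quot dv r0 rp p1 tQ cG.
set G := cauchy_quot v z c in G0 cG.
have pn s : Normc.normc (p%:C * cis s) = p by rewrite normc_polar// ltW.
have pn0 s : p%:C * cis s != 0 :> R[i] by apply: normc_neq0; rewrite pn.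
have pz s : p%:C * cis s != z.
  by apply/eqP => e; move: (pn s); rewrite e nz => e'; move: rp; rewrite e' ltxx.
have dG w : Normc.normc w = p -> cderivable G w.
  move=> wp; apply: cauchy_quot_cderivable; first by apply: dv; rewrite wp.
  by move=> wz; move: rp; rewrite -nz -wz wp ltxx.
have iG : cintegrable leb `[0, 2 * pi] (fun s => G (p%:C * cis s)).
  exact: circle_integrable.
(* This is (v w - v z) (z / w)^m, split into two integrable pieces. It integrates to 2 pi times the
   m-th Taylor term, from which v z is removed for m = 0 only. *)
pose H m w := z ^+ m * (v w * w^-1 ^+ m) - z ^+ m * v z * w^-1 ^+ m.
have dX m w : Normc.normc w = p -> cderivable (fun w => w^-1 ^+ m) w.
  move=> wp; apply: cderivableX; apply: cderivableV; last exact: cderivable_id.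
  by apply: normc_neq0; rewrite wp.
have dvX m w : Normc.normc w = p -> cderivable (fun w => v w * w^-1 ^+ m) w.
  by move=> wp; apply: cderivableM; [apply: dv; rewrite wp|exact: dX].
have i1 m := circle_integrable p0 (dvX m).
have i2 m := circle_integrable p0 (dX m).
have iH m : cintegrable leb `[0, 2 * pi] (fun s => H m (p%:C * cis s)).
  by apply: cintegrableB; [by []|exact: cintegrableZ..].
have IH m : cint leb `[0, 2 * pi] (fun s => H m (p%:C * cis s)) =
    (2 * pi)%:C * (z ^+ m * taylor_coef v m - v z * (m == 0)%:R).
  rewrite (@cintB _ _ _ leb _ _ (fun s => z ^+ m * (v (p%:C * cis s) * (p%:C * cis s)^-1 ^+ m))
    (fun s => z ^+ m * v z * (p%:C * cis s)^-1 ^+ m))//; [|exact: cintegrableZ..].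
  rewrite (cintZ _ _ (i1 m))// (cintZ _ _ (i2 m))//.
  have := taylor_circle m dv (r := p); rewrite p0 p1 => /(_ isT); rewrite /circle_int => ->.
  rewrite mulrBr; congr (_ - _); first by rewrite mulrCA.
  case: m => [|m].
    have -> : cint leb `[0, 2 * pi] (fun s => (p%:C * cis s)^-1 ^+ 0) = (2 * pi)%:C * 1.
      by rewrite -cint_cst_circle; apply: eq_cint => s _; rewrite expr0.
    by rewrite expr0 mul1r !mulr1 mulrC.
  have pC0 : p%:C != 0 :> R[i] by rewrite eq_complex /= eqxx andbT gt_eqF.
  have -> : cint leb `[0, 2 * pi] (fun s => (p%:C * cis s)^-1 ^+ m.+1) =
      cint leb `[0, 2 * pi] (fun s => p%:C^-1 ^+ m.+1 * (cis s)^-1 ^+ m.+1).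
    by apply: eq_cint => s _; rewrite invfM exprMn.
  rewrite cintZ ?cint_cisVX_eq0 ?mulr0//.
  have : cintegrable leb `[0, 2 * pi] (fun s => p%:C ^+ m.+1 * (p%:C * cis s)^-1 ^+ m.+1).
    exact: cintegrableZ.
  by apply: eq_cintegrable => // s _; rewrite invfM exprMn mulrA -exprMn divff ?expr1n ?mul1r.
pose q s := z / (p%:C * cis s).
have nq s : Normc.normc (q s) = r / p by rewrite /q Normc.normcM Normc.normcV nz pn.
have aux (a b x y : R[i]) n :
    y ^+ n * (a * x^-1 ^+ n) - y ^+ n * b * x^-1 ^+ n = (a - b) * (y / x) ^+ n.
  by rewrite exprMn; ring.
have geo (a x y : R[i]) n : x != 0 -> x - y != 0 ->
    a * \sum_(m < n) (y / x) ^+ m = a / (x - y) * x - a / (x - y) * x * (y / x) ^+ n.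
  move=> x0 xy.
  have h : 1 - (y / x) ^+ n = (1 - y / x) * \sum_(m < n) (y / x) ^+ m.
    by rewrite -[LHS]opprB subrX1 -mulNr opprB.
  have -> : a / (x - y) * x - a / (x - y) * x * (y / x) ^+ n =
    a / (x - y) * x * (1 - (y / x) ^+ n) by ring.
  by rewrite h; field; rewrite x0 xy.
have GH M s : \sum_(m < M) H m (p%:C * cis s) =
    G (p%:C * cis s) - G (p%:C * cis s) * q s ^+ M.
  set w := p%:C * cis s.
  have -> : \sum_(m < M) H m w = (v w - v z) * \sum_(m < M) q s ^+ m.
    rewrite mulr_sumr; apply: eq_bigr => m _; exact: aux.
  have w0 : w != 0 := pn0 s; have wz : w - z != 0 by rewrite subr_eq0 pz.
  rewrite /G /cauchy_quot (negbTE (pz s)) -/w.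
  exact: geo.
have iGq M : cintegrable leb `[0, 2 * pi] (fun s => G (p%:C * cis s) * q s ^+ M).
  have : cintegrable leb `[0, 2 * pi] (fun s => G (p%:C * cis s) - \sum_(m < M) H m (p%:C * cis s)).
    by apply: cintegrableB => //; exact: cintegrable_sum.
  by apply: eq_cintegrable => // s _; rewrite GH opprB addrC subrK.
have main M : (2 * pi)%:C * (\sum_(m < M.+1) taylor_coef v m * z ^+ m - v z) =
    - cint leb `[0, 2 * pi] (fun s => G (p%:C * cis s) * q s ^+ M.+1).
  have := eq_cint leb (fun s (_ : `[0, 2 * pi]%classic s) => GH M.+1 s).
  rewrite cint_sum// cintB// [X in X - _]G0 sub0r => <-.
  rewrite [RHS](eq_bigr (fun m : 'I_M.+1 =>
      (2 * pi)%:C * (z ^+ m * taylor_coef v m - v z * (m == 0 :> nat)%:R))); last first.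
    by move=> m _; exact: IH.
  rewrite -[RHS]mulr_sumr; congr (_ * _); rewrite [RHS]big_split /= sumrN; congr (_ - _).
    by apply: eq_bigr => m _; rewrite mulrC.
  by rewrite big_ord_recl /= mulr1 big1 ?addr0// => m _; rewrite mulr0.
(* The remainder integral is at most (r / p)^(M + 1) times this constant, which does not depend on
   M. *)
pose A := \int[leb]_(s in `[0, 2 * pi]) Normc.normc (G (p%:C * cis s)).
have bnd M : Normc.normc (\sum_(m < M.+1) taylor_coef v m * z ^+ m - v z) <= (r / p) ^+ M.+1 * A / (2 * pi).
  rewrite ler_pdivlMr ?mulr_gt0 ?pi_gt0//.
  have -> : 2 * pi = Normc.normc (2 * pi)%:C :> R by rewrite normcR ger0_norm// pi2_ge0.
  rewrite mulrC -Normc.normcM main normc_opp (le_trans (normc_cint _ (iGq _)))//.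
  rewrite -RintegralZl//; last exact: integrable_normc.
  apply: le_Rintegral => //; first exact: integrable_normc.
    have : leb.-integrable `[0, 2 * pi]
        (fun s => ((r / p) ^+ M.+1)%:E * (Normc.normc (G (p%:C * cis s)))%:E)%E.
      by apply: integrableZl => //; exact: integrable_normc.
    by apply: eq_integrable => // x _ /=; rewrite EFinM.
  by move=> s _; rewrite Normc.normcM normcX nq mulrC.
have rp0 : 0 <= r / p by apply: divr_ge0; exact: ltW.
have rp1 : `|r / p| < 1 by rewrite (ger0_norm rp0) ltr_pdivrMr// mul1r.
rewrite /ccvg -(cvg_shiftn 1).
apply: (squeeze0 (v := fun M => (r / p) ^+ (M + 1) * (A / (2 * pi)))).
  by move=> M /=; rewrite normc_ge0 /= addn1 mulrA; exact: bnd.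
rewrite -[X in _ --> X](mul0r (A / (2 * pi))); apply: cvgM; last exact: cvg_cst.
by move: (cvg_expr rp1); rewrite -(cvg_shiftn 1).
Qed.

End CircleIntegrals.

(** * Power series *)

Section PowerSeries.
Context {R : realType}.
Implicit Types (a u : nat -> R[i]) (z w : R[i]).

Definition cpsum a z (M : nat) : R[i] := \sum_(m < M) a m * z ^+ m.

(** A total function: it has a value for every sequence, and this value is the limit whenever there
    is one, by [climP]. *)
Definition clim (u : nat -> R[i]) : R[i] :=
  lim ((fun n => complex.Re (u n)) @ \oo) +i* lim ((fun n => complex.Im (u n)) @ \oo).

Lemma ccvg_ReIm u l : ccvg u l ->
  ((fun n => complex.Re (u n)) @ \oo --> complex.Re l) /\
  ((fun n => complex.Im (u n)) @ \oo --> complex.Im l).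
Proof.
move=> ul; split; apply/cvgrPdistC_lt => e e0.
  have [N _ h] := (cvgr0Pnorm_lt (fun n => Normc.normc (u n - l))).1 ul _ e0.
  exists N => // n Nn; have := h n Nn; rewrite ger0_norm ?normc_ge0// => /=.
  by apply: le_lt_trans; rewrite -ReN -ReD Re_le_normc.
have [N _ h] := (cvgr0Pnorm_lt (fun n => Normc.normc (u n - l))).1 ul _ e0.
exists N => // n Nn; have := h n Nn; rewrite ger0_norm ?normc_ge0// => /=.
by apply: le_lt_trans; rewrite -ImN -ImD Im_le_normc.
Qed.

Lemma ReIm_ccvg u l : ((fun n => complex.Re (u n)) @ \oo --> complex.Re l) ->
  ((fun n => complex.Im (u n)) @ \oo --> complex.Im l) -> ccvg u l.
Proof.
move=> h1 h2; apply: (@ccvg_le _ _ _ (fun n =>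
  `|complex.Re (u n) - complex.Re l| + `|complex.Im (u n) - complex.Im l|)).
  by move=> n; rewrite -ReN -ReD -ImN -ImD normc_le_ReIm.
rewrite -[X in _ --> X]addr0; apply: cvgD; apply/cvgr0Pnorm_lt => e e0.
  by move/cvgrPdistC_lt : h1 => /(_ e e0); apply: filterS => n; rewrite normr_id.
by move/cvgrPdistC_lt : h2 => /(_ e e0); apply: filterS => n; rewrite normr_id.
Qed.

Lemma climP u l : ccvg u l -> clim u = l.
Proof.
move=> /ccvg_ReIm[h1 h2]; apply: eq_ReIm => /=; exact: cvg_lim.
Qed.

Lemma real_series_cvg (x b : nat -> R) : (forall n, `|x n| <= b n) ->
  cvgn (series b) -> cvgn (fun M => \sum_(m < M) x m).
Proof.
move=> xb cb; have : cvgn (series x).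
  apply: normed_cvg; apply: (series_le_cvg (v_ := b)) => [n|n|n|//].
  - exact: normr_ge0.
  - exact: le_trans (normr_ge0 _) (xb n).
  - exact: xb.
rewrite (_ : (fun M => _) = series x)//.
by apply/funext => M; rewrite /series /= big_mkord.
Qed.

Lemma Re_sum (I : Type) (s : seq I) (F : I -> R[i]) :
  complex.Re (\sum_(i <- s) F i) = \sum_(i <- s) complex.Re (F i).
Proof. by elim/big_rec2: _ => // i x y _ <-; rewrite ReD. Qed.

Lemma Im_sum (I : Type) (s : seq I) (F : I -> R[i]) :
  complex.Im (\sum_(i <- s) F i) = \sum_(i <- s) complex.Im (F i).
Proof. by elim/big_rec2: _ => // i x y _ <-; rewrite ImD. Qed.

Lemma complex_series_cvg u (b : nat -> R) : (forall n, Normc.normc (u n) <= b n) ->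
  cvgn (series b) -> ccvg (fun M => \sum_(m < M) u m) (clim (fun M => \sum_(m < M) u m)).
Proof.
move=> ub cb; apply: ReIm_ccvg => /=.
  have c : cvgn (fun M => \sum_(m < M) complex.Re (u m)).
    exact: (real_series_cvg (x := fun m => complex.Re (u m)) (fun n => le_trans (Re_le_normc _) (ub n)) cb).
  by under [fun n => _]eq_fun do rewrite Re_sum; exact: c.
have c : cvgn (fun M => \sum_(m < M) complex.Im (u m)).
  exact: (real_series_cvg (x := fun m => complex.Im (u m)) (fun n => le_trans (Im_le_normc _) (ub n)) cb).
by under [fun n => _]eq_fun do rewrite Im_sum; exact: c.
Qed.

(** The differentiated geometric series is the majorant for coefficients of size C (n + 1), the
    growth of the coefficients of a Bergman projection. *)
Lemma sum_arith_geom (q : R) M :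
  (1 - q) ^+ 2 * \sum_(n < M) n.+1%:R * q ^+ n = 1 - M.+1%:R * q ^+ M + M%:R * q ^+ M.+1.
Proof.
elim: M => [|M IH]; first by rewrite big_ord0; ring.
by rewrite big_ord_recr /= mulrDr IH !exprS -!natr1; ring.
Qed.

Lemma sum_arith_geom_le (q : R) M : 0 <= q < 1 ->
  \sum_(n < M) n.+1%:R * q ^+ n <= (1 - q) ^- 2.
Proof.
move=> /andP[q0 q1]; have p : 0 < (1 - q) ^+ 2 by rewrite exprn_gt0// subr_gt0.
rewrite -(ler_pM2l p) sum_arith_geom mulfV ?gt_eqF//.
have h : 0 <= q ^+ M by rewrite exprn_ge0.
have hM : 0 <= M%:R :> R by [].
have : M%:R * q ^+ M.+1 <= M%:R * q ^+ M.
  by rewrite ler_wpM2l// exprS ler_piMl// ltW.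
rewrite -natr1 mulrDl mul1r; lra.
Qed.

Lemma cvg_arith_geom (C q : R) : 0 <= C -> 0 <= q < 1 ->
  cvgn (series (fun n => C * (n.+1%:R * q ^+ n))).
Proof.
move=> C0 /andP[q0 q1]; apply: nondecreasing_is_cvgn.
  apply/nondecreasing_seqP => n; rewrite /series /= big_nat_recr//= lerDl.
  by rewrite !mulr_ge0// exprn_ge0.
exists (C * (1 - q) ^- 2) => _ [M _ <-]; rewrite /series /= big_mkord -mulr_sumr.
by rewrite ler_wpM2l// sum_arith_geom_le// q0.
Qed.

Lemma natmulX_le (x d : R) n : 0 <= x -> 0 <= d ->
  n%:R * x ^+ n.-1 * d <= (x + d) ^+ n.
Proof.
move=> x0 d0.
have H : x ^+ n + n%:R * x ^+ n.-1 * d <= (x + d) ^+ n.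
  elim: n => [|n IH]; first by rewrite !expr0 !mul0r addr0.
  have xd : 0 <= x + d by rewrite addr_ge0.
  rewrite exprS [leRHS]exprS; apply: le_trans (ler_wpM2l xd IH).
  have : 0 <= n%:R * x ^+ n.-1 * d ^+ 2 by rewrite !mulr_ge0// exprn_ge0.
  have e : n%:R * x ^+ n = x * (n%:R * x ^+ n.-1).
    by case: n {IH} => [|n]; [rewrite !mul0r mulr0|rewrite /= exprS; ring].
  rewrite -natr1 /= mulrDl e mul1r.
  move: (n%:R * x ^+ n.-1) (x ^+ n) => y w; rewrite expr2 => h; nra.
by rewrite (le_trans _ H)// lerDr exprn_ge0.
Qed.

(** The terms of degree at least 2 in h have nonnegative coefficients, so replacing z by |z| and h
    by d dominates them with a gain of (|h| / d)^2. The induction is on the exact remainder [e] at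
    |z| and d, which is bounded by (|z| + d)^n only at the end. *)
Lemma expr_remainder z h (d : R) n : 0 < d -> Normc.normc h <= d ->
  Normc.normc ((z + h) ^+ n - z ^+ n - n%:R * z ^+ n.-1 * h) <=
    (Normc.normc h / d) ^+ 2 * (Normc.normc z + d) ^+ n.
Proof.
move=> d0 hd; set x := Normc.normc z; set k := Normc.normc h / d.
have x0 : 0 <= x := normc_ge0 z.
have k0 : 0 <= k by rewrite divr_ge0 ?normc_ge0// ltW.
pose e n := (x + d) ^+ n - x ^+ n - n%:R * x ^+ n.-1 * d.
have eS m : e m.+1 = (x + d) * e m + m%:R * x ^+ m.-1 * d ^+ 2.
  rewrite /e !exprS -natr1 /=; case: m => [|m]; first by rewrite !expr0 /=; ring.
  by rewrite /= !exprS; ring.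
have xd : 0 <= x + d by rewrite addr_ge0// ltW.
have main : Normc.normc ((z + h) ^+ n - z ^+ n - n%:R * z ^+ n.-1 * h) <= k ^+ 2 * e n.
  elim: n => [|n IH].
    rewrite /e !expr0 !mul0r !subr0 !subrr normc0E mulr_ge0// ?exprn_ge0//.
  have -> : (z + h) ^+ n.+1 - z ^+ n.+1 - n.+1%:R * z ^+ n.+1.-1 * h =
     (z + h) * ((z + h) ^+ n - z ^+ n - n%:R * z ^+ n.-1 * h) + n%:R * z ^+ n.-1 * h ^+ 2.
    by rewrite !exprS -natr1 /=; case: n {IH} => [|n]; [rewrite !expr0 /=; ring|rewrite /= !exprS; ring].
  rewrite (le_trans (normc_triangle _ _))// [leRHS](_ : _ = k ^+ 2 * ((x + d) * e n) + k ^+ 2 * (n%:R * x ^+ n.-1 * d ^+ 2)); last by rewrite eS mulrDr.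
  rewrite lerD//.
    rewrite Normc.normcM mulrCA ler_pM ?normc_ge0//.
    by rewrite (le_trans (normc_triangle _ _))// lerD2l.
  rewrite !Normc.normcM !normcX -/x.
  have -> : Normc.normc n%:R = n%:R :> R.
    by rewrite -[n%:R](rmorph_nat (real_complex R)) normcR ger0_norm.
  rewrite (_ : Normc.normc h = k * d); last by rewrite /k divfK// gt_eqF.
  by have -> : n%:R * x ^+ n.-1 * (k * d) ^+ 2 = k ^+ 2 * (n%:R * x ^+ n.-1 * d ^+ 2) by ring.
rewrite (le_trans main)// ler_wpM2l ?exprn_ge0// /e.
have h1 : 0 <= x ^+ n by rewrite exprn_ge0.
have h2 : 0 <= n%:R * x ^+ n.-1 * d by rewrite !mulr_ge0// ?exprn_ge0// ltW.
lra.
Qed.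

Variables (a : nat -> R[i]) (C : R).
Hypothesis aC : forall n, Normc.normc (a n) <= C * n.+1%:R.

Let C0 : 0 <= C.
Proof. by have := aC 0; rewrite mulr1; apply: le_trans; exact: normc_ge0. Qed.

Definition csum z := clim (cpsum a z).

Lemma cpsum_cvg z : Normc.normc z < 1 -> ccvg (cpsum a z) (csum z).
Proof.
move=> z1; apply: (@complex_series_cvg (fun m => a m * z ^+ m) (fun n => C * (n.+1%:R * Normc.normc z ^+ n))).
  by move=> n; rewrite Normc.normcM normcX mulrA ler_wpM2r// exprn_ge0// normc_ge0.
by apply: cvg_arith_geom => //; rewrite normc_ge0.
Qed.

Lemma ccvg_le_normc u l (B : R) : ccvg u l -> (forall n, Normc.normc (u n) <= B) ->
  Normc.normc l <= B.
Proof.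
move=> /ccvg_normc h hB; rewrite -(cvg_lim _ h)//; apply: limr_le.
  by apply/cvg_ex; eexists; exact: h.
by near=> n; exact: hB.
Unshelve. all: by end_near. Qed.

(** Take q = |z| + d halfway between |z| and 1: the remainders of all terms together are at most
    (|h| / d)^2 times the sum of |a n| q^n, a quadratic error for the differentiated series. *)
Lemma csum_cderivable : cderivable_disk csum.
Proof.
move=> z z1; pose d : R := (1 - Normc.normc z) / 2; pose q : R := Normc.normc z + d.
have d0 : 0 < d by rewrite divr_gt0// subr_gt0.
have q1 : q < 1 by rewrite /q /d; lra.
have q0 : 0 <= q by rewrite addr_ge0 ?normc_ge0// ltW.
have q01 : 0 <= q < 1 by rewrite q0.
pose K : R := C * (1 - q) ^- 2.
have K0 : 0 <= K by rewrite mulr_ge0// invr_ge0 exprn_ge0// subr_ge0 ltW.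
have aq M : \sum_(n < M) Normc.normc (a n) * q ^+ n <= K.
  apply: (@le_trans _ _ (\sum_(n < M) C * (n.+1%:R * q ^+ n))).
    by apply: ler_sum => n _; rewrite mulrA ler_wpM2r// exprn_ge0.
  by rewrite -mulr_sumr ler_wpM2l// sum_arith_geom_le.
pose D M := \sum_(n < M) a n * (n%:R * z ^+ n.-1).
have cD : ccvg D (clim D).
  apply: (@complex_series_cvg (fun n => a n * (n%:R * z ^+ n.-1)) (fun n => C / d * (n.+1%:R * q ^+ n))); last first.
    by apply: cvg_arith_geom => //; rewrite divr_ge0// ltW.
  move=> n; rewrite !Normc.normcM normcX.
  have -> : Normc.normc n%:R = n%:R :> R.
    by rewrite -[n%:R](rmorph_nat (real_complex R)) normcR ger0_norm.
  have h := natmulX_le n (normc_ge0 z) (ltW d0).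
  rewrite -(ler_pM2r d0) -(mulrA (Normc.normc (a n))) (le_trans (ler_wpM2l (normc_ge0 _) h))//.
  rewrite (_ : C / d * _ * d = C * n.+1%:R * q ^+ n); last by field; rewrite gt_eqF.
  by rewrite ler_wpM2r// exprn_ge0.
exists (clim D) => e e0.
have K1 : 0 < K + 1 by rewrite ltr_wpDl.
exists (Num.min d (e * d ^+ 2 / (K + 1))).
  by rewrite lt_min d0 divr_gt0// mulr_gt0// exprn_gt0.
move=> h; rewrite lt_min => /andP[hd he].
have zh1 : Normc.normc (z + h) < 1.
  rewrite (le_lt_trans (normc_triangle _ _))//; move: hd; rewrite /d.
  by move: (Normc.normc z) (Normc.normc h) z1 => x y; lra.
apply: (@le_trans _ _ ((Normc.normc h / d) ^+ 2 * K)).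
  apply: (ccvg_le_normc (u := fun M => cpsum a (z + h) M - cpsum a z M - D M * h)).
    apply: ccvgB; first by apply: ccvgB; exact: cpsum_cvg.
    under [fun n => _]eq_fun do rewrite mulrC; rewrite mulrC; exact: ccvgZ.
  move=> M; rewrite /cpsum /D mulr_suml -!sumrB (le_trans (normc_sum _ _ _))//.
  apply: (@le_trans _ _ ((Normc.normc h / d) ^+ 2 * \sum_(n < M) Normc.normc (a n) * q ^+ n)).
    rewrite mulr_sumr; apply: ler_sum => n _.
    rewrite (_ : _ - _ - _ = a n * ((z + h) ^+ n - z ^+ n - n%:R * z ^+ n.-1 * h)); last by ring.
    rewrite Normc.normcM mulrCA ler_wpM2l ?normc_ge0//.
    by apply: expr_remainder => //; exact: ltW.
  by rewrite ler_wpM2l// exprn_ge0// divr_ge0 ?normc_ge0// ltW.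
move: he; rewrite ltr_pdivlMr// => he.
rewrite expr_div_n mulrAC ler_pdivrMr ?exprn_gt0// expr2 -!mulrA.
rewrite [leRHS]mulrCA ler_wpM2l ?normc_ge0//.
rewrite (le_trans _ (ltW he))// ler_wpM2l ?normc_ge0// lerDl//.
Qed.

End PowerSeries.

(** * Polar coordinates *)

Section PolarMeasure.
Context {R : realType}.
Notation leb := (@lebesgue_measure R).
Notation T := (measurableTypeR R * measurableTypeR R)%type.
Notation rct := (@polar_rect R : set T).
Implicit Types (F : R[i] -> R[i]) (G H : T -> R[i]).

Lemma measurable_polar_rect : measurable rct.
Proof. by apply: measurableX; exact: measurable_itv. Qed.

Lemma leb2_polar_rect : @leb2 R rct = (2 * pi)%:E.
Proof.
rewrite (_ : leb2 R rct = (leb \x leb)%E (`[0, 1[%classic `*` `[0, 2 * pi[%classic))//.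
rewrite product_measure1E; [|exact: measurable_itv..].
have lM (b : R) : 0 < b -> leb `[0, b[%classic = b%:E.
  by move=> b0; rewrite lebesgue_measure_itv /= lte_fin b0 sube0.
transitivity (leb `[0%R, 1%R[%classic * leb `[0%R, (2 * pi)%R[%classic)%E => //.
by rewrite !lM ?mul1e// mulr_gt0// pi_gt0.
Qed.

Lemma leb2_polar_rect_lty : (@leb2 R rct < +oo)%E.
Proof. by rewrite leb2_polar_rect ltry. Qed.

Lemma polarE (p : T) : polar p = (p.1 * cos p.2) +i* (p.1 * sin p.2).
Proof. by apply: eq_ReIm; rewrite /polar ?ReM ?ImM /=; ring. Qed.

Lemma normc_polar_pt (p : T) : 0 <= p.1 -> Normc.normc (polar p) = p.1.
Proof. by move=> p0; rewrite /polar Normc.normcM normc_cis mulr1 normcR ger0_norm. Qed.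

Lemma polar_rectP (p : T) : rct p -> 0 <= p.1 < 1 /\ 0 <= p.2 < 2 * pi.
Proof. by move=> [/=]; rewrite !in_itv. Qed.

Lemma unit_diskE (z : R[i]) : unit_disk z <-> Normc.normc z < 1.
Proof. by rewrite /unit_disk /= normcE_abs -[1]/(1%:C) ltcR. Qed.

Lemma unit_disk_polar (p : T) : rct p -> unit_disk (polar p).
Proof.
by move=> /polar_rectP[/andP[p0 p1] _]; apply/unit_diskE; rewrite normc_polar_pt.
Qed.

Lemma measurable_fst_T (D : set T) : measurable_fun D (fun p : T => p.1 : R).
Proof. exact: measurable_funTS measurable_fst. Qed.

Lemma measurable_snd_T (D : set T) : measurable_fun D (fun p : T => p.2 : R).
Proof. exact: measurable_funTS measurable_snd. Qed.

Definition cart_disk : set T := [set p | unit_disk (p.1 +i* p.2)].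

Lemma measurable_cart_disk : measurable cart_disk.
Proof.
rewrite (_ : cart_disk = setT `&` (fun p : T => p.1 ^+ 2 + p.2 ^+ 2) @^-1` `]-oo, 1[%classic).
  have : measurable_fun setT (fun p : T => p.1 ^+ 2 + p.2 ^+ 2 : R).
    by apply: measurable_funD; apply: measurable_funX; [exact: measurable_fst_T|exact: measurable_snd_T].
  by apply => //; exact: measurable_itv.
rewrite setTI; apply/seteqP; split => p /=; rewrite in_itv /=.
  move=> /unit_diskE h; rewrite -[_ + _]/(complex.Re (p.1 +i* p.2) ^+ 2 + complex.Im (p.1 +i* p.2) ^+ 2).
  by rewrite -normc_sqr expr_lt1// normc_ge0.
move=> h; apply/unit_diskE; rewrite -(@expr_lt1 _ 2)// ?normc_ge0// normc_sqr//.
Qed.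

Lemma measurable_polar : measurable_fun setT (fun p : T => (p.1 * cos p.2, p.1 * sin p.2) : T).
Proof.
apply/measurable_fun_pair; apply: measurable_funM; try exact: measurable_fst_T.
  apply: (@measurableT_comp _ _ _ _ _ _ (@cos R)); last exact: measurable_snd_T.
  by apply: continuous_measurable_fun; exact: continuous_cos.
apply: (@measurableT_comp _ _ _ _ _ _ (@sin R)); last exact: measurable_snd_T.
by apply: continuous_measurable_fun; exact: continuous_sin.
Qed.

Lemma cmeas_polar F : disk_measurable F -> cmeas rct (fun p => F (polar p)).
Proof.
move=> [h1 h2].
have sub : [set (p.1 * cos p.2, p.1 * sin p.2) | p in rct] `<=` cart_disk.
  by move=> _ [p /unit_disk_polar + <-]; rewrite /cart_disk /= polarE.
have mp : measurable_fun rct (fun p : T => (p.1 * cos p.2, p.1 * sin p.2) : T).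
  exact: measurable_funTS measurable_polar.
split.
  have := measurable_comp measurable_cart_disk sub h1 mp.
  by apply: eq_measurable_fun => p _ /=; rewrite polarE.
have := measurable_comp measurable_cart_disk sub h2 mp.
by apply: eq_measurable_fun => p _ /=; rewrite polarE.
Qed.

Lemma disk_measurable_id : disk_measurable (fun z : R[i] => z).
Proof. by split; [exact: measurable_fst_T|exact: measurable_snd_T]. Qed.

Lemma disk_measurable_cpsum a M : disk_measurable (fun z : R[i] => cpsum a z M).
Proof.
suff : cmeas cart_disk (fun p => cpsum a (p.1 +i* p.2) M) by [].
apply: (@cmeas_sum _ _ R cart_disk _ _ (fun (m : 'I_M) p => a m * (p.1 +i* p.2) ^+ m)) => m.
apply: cmeasM; [exact: cmeas_cst|apply: cmeasX; exact: disk_measurable_id].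
Qed.

Lemma disk_measurable_csum a (C : R) : (forall n, Normc.normc (a n) <= C * n.+1%:R) ->
  disk_measurable (csum a).
Proof.
move=> aC.
have h p : cart_disk p -> ccvg (cpsum a (p.1 +i* p.2)) (csum a (p.1 +i* p.2)).
  by move=> /unit_diskE pd; apply: (cpsum_cvg aC).
split.
  apply: (measurable_fun_cvg (h := fun M p => complex.Re (cpsum a (p.1 +i* p.2) M))).
    by move=> M; have [] := disk_measurable_cpsum a M.
  by move=> p /h /ccvg_ReIm[].
apply: (measurable_fun_cvg (h := fun M p => complex.Im (cpsum a (p.1 +i* p.2) M))).
  by move=> M; have [] := disk_measurable_cpsum a M.
by move=> p /h /ccvg_ReIm[].
Qed.

(** Every slice, and not almost every one, is asked to be integrable, so that the real-valued inner
    integral agrees with the extended one for each r in [0, 1[. *)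
Lemma Fubini_rect (f : T -> R) : (@leb2 R).-integrable rct (EFin \o f) ->
  (forall r, 0 <= r < 1 -> leb.-integrable `[0, 2 * pi[ (EFin \o (fun t => f (r, t)))) ->
  leb.-integrable `[0, 1[ (EFin \o (fun r => \int[leb]_(t in `[0, 2 * pi[) f (r, t))) /\
  \int[@leb2 R]_(p in rct) f p =
    \int[leb]_(r in `[0, 1[) \int[leb]_(t in `[0, 2 * pi[) f (r, t).
Proof.
move=> fi fr; pose g := (EFin \o f) \_ rct.
have ig : (leb \x leb)%E.-integrable setT g.
  exact: ((integrable_mkcond (mu := @leb2 R) (EFin \o f) measurable_polar_rect).1 fi).
pose h r := \int[leb]_(t in `[0, 2 * pi[) f (r, t).
have E r : (\int[leb]_t g (r, t))%E = ((EFin \o h) \_ `[0, 1[) r.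
  rewrite patchE; case: ifPn => [/set_mem|/negP] r01.
    have r01' : 0 <= r < 1 by move: r01; rewrite /= in_itv.
    rewrite /h /= /Rintegral fineK; last exact: integrable_fin_num (fr _ r01').
    rewrite [RHS]integral_mkcond; apply: eq_integral => t _; rewrite /g !patchE.
    congr (if _ then _ else _); apply/idP/idP => /set_mem.
      by move=> [_ ?]; exact/mem_set.
    by move=> ?; apply/mem_set.
  rewrite integral0_eq// => t _; rewrite /g patchE; case: ifPn => // /set_mem[r1 _].
  by exfalso; apply: r01; exact/mem_set.
have i1 : leb.-integrable setT (fun r => \int[leb]_t g (r, t))%E.
  exact: (integrable_fubini_F ig).
have e1 := integral12_prod_meas1 ig.
split.
  apply/integrable_mkcond; first exact: measurable_itv.
  by apply: eq_integrable i1 => // r _; rewrite E.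
rewrite /Rintegral [in LHS]integral_mkcond -/g; congr fine; rewrite [LHS](_ : _ = (\int[leb]_x \int[leb]_y g (x, y))%E); last by rewrite -e1.
by rewrite [RHS]integral_mkcond; apply: eq_integral => r _; rewrite E.
Qed.

Lemma cFubini_rect G : cintegrable (@leb2 R) rct G ->
  (forall r, 0 <= r < 1 -> cintegrable leb `[0, 2 * pi[ (fun t => G (r, t))) ->
  cintegrable leb `[0, 1[ (fun r => cint leb `[0, 2 * pi[ (fun t => G (r, t))) /\
  cint (@leb2 R) rct G =
    cint leb `[0, 1[ (fun r => cint leb `[0, 2 * pi[ (fun t => G (r, t))).
Proof.
move=> [g1 g2] gr.
have [i1 e1] := Fubini_rect g1 (fun r h => (gr r h).1).
have [i2 e2] := Fubini_rect g2 (fun r h => (gr r h).2).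
by split; [split|apply: eq_ReIm].
Qed.

Lemma integral_exprn n : \int[leb]_(r in `[0, 1[) r ^+ n = n.+1%:R^-1.
Proof.
have c : leb.-integrable `[0, 1] (EFin \o (fun r : R => r ^+ n)).
  apply: continuous_compact_integrable; first exact: segment_compact.
  by apply: continuous_subspaceT => x; exact: exprn_continuous.
rewrite Rintegral_itv_bndo_bndc; last first.
  by apply: integrableS c => //; apply: subset_itvl; rewrite bnd_simp.
rewrite /Rintegral (@continuous_FTC2 _ _ (fun r => r ^+ n.+1 / n.+1%:R) 0 1)//=.
- by rewrite expr1n expr0n mul0r subr0 mul1r.
- by apply: continuous_subspaceT => x; exact: exprn_continuous.
- split.
  + move=> x _; exact: (derivableM (@exprn_derivable R n.+1 x 1) (@derivable_cst R R R _ x 1)).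
  + apply: cvg_at_right_filter; apply: cvgM; last exact: cvg_cst.
    exact: exprn_continuous.
  + apply: cvg_at_left_filter; apply: cvgM; last exact: cvg_cst.
    exact: exprn_continuous.
- move=> x _; rewrite derive1E (deriveM (@exprn_derivable R n.+1 x 1) (@derivable_cst R R R _ x 1)).
  rewrite derive_cst scaler0 add0r exp_derive.
  change (n.+1%:R^-1 * (n.+1%:R * x ^+ n * 1) = x ^+ n).
  by rewrite mulr1 mulrA mulVf ?mul1r.
Qed.

End PolarMeasure.

(** * Square-integrable functions and inner products in polar coordinates *)

Section PolarL2.
Context {R : realType}.
Notation leb := (@lebesgue_measure R).
Notation T := (measurableTypeR R * measurableTypeR R)%type.
Notation rct := (@polar_rect R : set T).
Notation mu := (@leb2 R).
Implicit Types (F : R[i] -> R[i]) (G H K : T -> R[i]).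

Let mrct : measurable rct := measurable_polar_rect.

Lemma polar_weight_ge0 (p : T) : rct p -> 0 <= p.1 / pi.
Proof. by move=> /polar_rectP[/andP[p0 _] _]; rewrite divr_ge0// pi_ge0. Qed.

Lemma polar_weight_le1 (p : T) : rct p -> p.1 / pi <= 1.
Proof.
move=> /polar_rectP[/andP[p0 p1] _]; rewrite ler_pdivrMr ?pi_gt0// mul1r.
by rewrite (le_trans (ltW p1))// (le_trans _ (pi_ge2 R))// ler1n.
Qed.

Lemma measurable_polar_weight : measurable_fun rct (fun p : T => p.1 / pi : R).
Proof. by apply: measurable_funM; [exact: measurable_fst_T|exact: measurable_cst]. Qed.

Definition pint G : R[i] := cint mu rct (fun p => G p * (p.1 / pi)%:C).

Definition pintegrable G := cintegrable mu rct (fun p => G p * (p.1 / pi)%:C).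

Definition pL2 G := cmeas rct G /\ (polar_sqnorm G < +oo)%E.

Definition psq G : R := \int[mu]_(p in rct) (Normc.normc (G p) ^+ 2 * p.1 / pi).

Definition inner G H : R[i] := pint (fun p => G p * conjc (H p)).

Lemma area_integral_pint F : area_integral F = pint (fun p => F (polar p)).
Proof.
apply: eq_ReIm => /=; apply: eq_Rintegral => p _.
  by rewrite ReM /= mulr0 subr0 mulrA.
by rewrite ImM /= mulr0 add0r mulrA.
Qed.

Lemma eq_inner G G' H H' : (forall p, rct p -> G p = G' p) ->
  (forall p, rct p -> H p = H' p) -> inner G H = inner G' H'.
Proof. by move=> GG HH; apply: eq_cint => p rp; rewrite GG// HH. Qed.

Lemma eq_psq G G' : (forall p, rct p -> G p = G' p) -> psq G = psq G'.
Proof. by move=> GG; apply: eq_Rintegral => p /set_mem rp; rewrite GG. Qed.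

Lemma eq_pL2 G G' : (forall p, rct p -> G p = G' p) -> pL2 G -> pL2 G'.
Proof.
move=> GG [mG G2]; split; first exact: eq_cmeas mG.
rewrite (_ : polar_sqnorm G' = polar_sqnorm G)//.
by apply: eq_integral => p /set_mem rp; rewrite GG.
Qed.

Lemma pcmeasW G : cmeas rct G -> cmeas rct (fun p => G p * (p.1 / pi)%:C).
Proof. by move=> mG; apply: cmeasM => //; apply: cmeas_real; exact: measurable_polar_weight. Qed.

Lemma measurable_sq G : cmeas rct G ->
  measurable_fun rct (fun p => Normc.normc (G p) ^+ 2 * p.1 / pi).
Proof.
move=> mG; apply: measurable_funM; last exact: measurable_cst.
apply: measurable_funM; last exact: measurable_fst_T.
by apply: measurable_funX; exact: measurable_normc.
Qed.

Lemma sq_ge0 G (p : T) : rct p -> 0 <= Normc.normc (G p) ^+ 2 * p.1 / pi.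
Proof.
by move=> rp; rewrite -mulrA mulr_ge0 ?exprn_ge0 ?normc_ge0// polar_weight_ge0.
Qed.

Lemma pL2_integrable G : pL2 G ->
  mu.-integrable rct (EFin \o (fun p => Normc.normc (G p) ^+ 2 * p.1 / pi)).
Proof.
move=> [mG G2]; apply/integrableP; split; first by apply/measurable_EFinP; exact: measurable_sq.
rewrite (_ : (\int[_]_(_ in _) _)%E = polar_sqnorm G)//.
by apply: eq_integral => p /set_mem rp; rewrite /= ger0_norm// sq_ge0.
Qed.

Lemma integrable_pL2 G (g : T -> R) : cmeas rct G -> mu.-integrable rct (EFin \o g) ->
  (forall p, rct p -> Normc.normc (G p) ^+ 2 * p.1 / pi <= g p) -> pL2 G.
Proof.
move=> mG ig Gg; split => //.
apply: le_lt_trans (integrable_lty mrct ig).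
apply: ge0_le_integral => //.
- by move=> p rp; rewrite lee_fin sq_ge0.
- by apply/measurable_EFinP; exact: measurable_sq.
- by move/measurable_int : ig.
Qed.

Lemma polar_sqnormE G : pL2 G -> polar_sqnorm G = (psq G)%:E.
Proof. by move=> /pL2_integrable iG; rewrite /psq /Rintegral fineK// integrable_fin_num. Qed.

Lemma psq_ge0 G : 0 <= psq G.
Proof. by apply: Rintegral_ge0 => p rp; exact: sq_ge0. Qed.

Lemma pL2_meas G : pL2 G -> cmeas rct G.
Proof. by case. Qed.

Lemma integrable_lin (t s : R) G H : pL2 G -> pL2 H -> mu.-integrable rct (EFin \o (fun p =>
  t * (Normc.normc (G p) ^+ 2 * p.1 / pi) + s * (Normc.normc (H p) ^+ 2 * p.1 / pi))).
Proof.
move=> /pL2_integrable iG /pL2_integrable iH.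
have := integrableD mrct (integrableZl mrct t iG) (integrableZl mrct s iH).
by apply: eq_integrable => // p _ /=; rewrite EFinD !EFinM.
Qed.

Lemma pL2D G H : pL2 G -> pL2 H -> pL2 (fun p => G p + H p).
Proof.
move=> LG LH; apply: (integrable_pL2 (g := fun p =>
  2 * (Normc.normc (G p) ^+ 2 * p.1 / pi) + 2 * (Normc.normc (H p) ^+ 2 * p.1 / pi))).
- by apply: cmeasD; exact: pL2_meas.
- exact: integrable_lin.
- move=> p rp; rewrite -!(mulrA _ p.1) !(mulrA 2) -mulrDl ler_wpM2r ?polar_weight_ge0//.
  have h : Normc.normc (G p + H p) ^+ 2 <= (Normc.normc (G p) + Normc.normc (H p)) ^+ 2.
    by rewrite ler_pXn2r ?nnegrE ?addr_ge0 ?normc_ge0// normc_triangle.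
  apply: le_trans h _; have := sqr_ge0 (Normc.normc (G p) - Normc.normc (H p)).
  by move: (Normc.normc (G p)) (Normc.normc (H p)) => x y; rewrite !expr2; lra.
Qed.

Lemma pL2_bmul (B : T -> R[i]) M G : cmeas rct B ->
  (forall p, rct p -> Normc.normc (B p) <= M) -> pL2 G -> pL2 (fun p => B p * G p).
Proof.
move=> mB BM LG; apply: (integrable_pL2 (g := fun p =>
  M ^+ 2 * (Normc.normc (G p) ^+ 2 * p.1 / pi) + 0 * (Normc.normc (G p) ^+ 2 * p.1 / pi))).
- by apply: cmeasM => //; exact: pL2_meas.
- exact: integrable_lin.
- move=> p rp; rewrite mul0r addr0 Normc.normcM exprMn -!(mulrA _ p.1) -mulrA ler_wpM2r//.
    by rewrite mulr_ge0 ?exprn_ge0 ?normc_ge0// polar_weight_ge0.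
  by rewrite ler_pXn2r ?nnegrE ?normc_ge0// ?BM// (le_trans (normc_ge0 _) (BM _ rp)).
Qed.

Lemma pL2Z c G : pL2 G -> pL2 (fun p => c * G p).
Proof. by apply: (@pL2_bmul (fun=> c) (Normc.normc c)) => //; exact: cmeas_cst. Qed.

Lemma pL2B G H : pL2 G -> pL2 H -> pL2 (fun p => G p - H p).
Proof.
move=> LG LH; apply: (@eq_pL2 (fun p => G p + -1 * H p)).
  by move=> p _; rewrite mulN1r.
by apply: pL2D => //; exact: pL2Z.
Qed.

Lemma pL2_bounded M G : cmeas rct G -> (forall p, rct p -> Normc.normc (G p) <= M) -> pL2 G.
Proof.
move=> mG GM.
have i1 : mu.-integrable rct (EFin \o fun=> (M ^+ 2 : R)).
  apply: measurable_bounded_integrable => //; first exact: leb2_polar_rect_lty.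
  by exists (`|M ^+ 2|); split; [exact: num_real|move=> y My x _; exact: ltW].
apply: (integrable_pL2 mG i1) => p rp.
rewrite -mulrA -[leRHS]mulr1 ler_pM ?polar_weight_ge0 ?polar_weight_le1//.
  by rewrite exprn_ge0// normc_ge0.
by rewrite ler_pXn2r ?nnegrE ?normc_ge0// ?GM// (le_trans (normc_ge0 _) (GM _ rp)).
Qed.

Lemma pL2_cst c : pL2 (fun=> c).
Proof. by apply: (@pL2_bounded (Normc.normc c)) => //; exact: cmeas_cst. Qed.

Lemma pL2_sum (I : Type) (s : seq I) (f : I -> T -> R[i]) :
  (forall i, pL2 (f i)) -> pL2 (fun p => \sum_(i <- s) f i p).
Proof.
move=> Lf; elim: s => [|i s IH].
  by apply: (@eq_pL2 (fun=> 0)); [move=> p _; rewrite big_nil|exact: pL2_cst].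
apply: (@eq_pL2 (fun p => f i p + \sum_(j <- s) f j p)); last exact: pL2D.
by move=> p _; rewrite big_cons.
Qed.

(** The free parameter t lets this inequality do the work of Cauchy-Schwarz: [inner_bound] inherits
    it, and limits of inner products are obtained by taking t large first. *)
Lemma amgm (t x y : R) : 0 < t -> x * y <= t * x ^+ 2 + t^-1 * y ^+ 2.
Proof.
move=> t0; have h : 0 <= t * (x - t^-1 * y) ^+ 2 + t * x ^+ 2 + t^-1 * y ^+ 2.
  by rewrite !addr_ge0// mulr_ge0 ?sqr_ge0 ?invr_ge0// ltW.
have e : t * (x - t^-1 * y) ^+ 2 = t * x ^+ 2 - 2 * (x * y) + t^-1 * y ^+ 2.
  by field; rewrite gt_eqF.
by rewrite e in h; lra.
Qed.

Lemma pL2_inner_le (t : R) G H (p : T) : 0 < t -> rct p ->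
  Normc.normc (G p * conjc (H p) * (p.1 / pi)%:C) <=
  t * (Normc.normc (G p) ^+ 2 * p.1 / pi) + t^-1 * (Normc.normc (H p) ^+ 2 * p.1 / pi).
Proof.
move=> t0 rp; rewrite !Normc.normcM normc_conj normcR ger0_norm ?polar_weight_ge0//.
rewrite -!(mulrA _ p.1) (mulrA t) (mulrA t^-1) -mulrDl ler_wpM2r ?polar_weight_ge0//.
exact: amgm.
Qed.

Lemma pL2_inner_integrable G H : pL2 G -> pL2 H -> pintegrable (fun p => G p * conjc (H p)).
Proof.
move=> LG LH; apply: (cintegrable_le mrct (g := fun p => 1 * (Normc.normc (G p) ^+ 2 * p.1 / pi) +
    1^-1 * (Normc.normc (H p) ^+ 2 * p.1 / pi))).
- by apply/pcmeasW/cmeasM; [exact: pL2_meas|apply/cmeas_conj/pL2_meas].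
- exact: integrable_lin.
- by move=> p rp; exact: pL2_inner_le.
Qed.

Lemma inner_bound (t : R) G H : 0 < t -> pL2 G -> pL2 H ->
  Normc.normc (inner G H) <= t * psq G + t^-1 * psq H.
Proof.
move=> t0 LG LH; have iGH := pL2_inner_integrable LG LH.
have [iG iH] := (pL2_integrable LG, pL2_integrable LH).
rewrite (le_trans (normc_cint mrct iGH))// /psq -!RintegralZl//.
rewrite -RintegralD//; last 2 first.
  by have := integrableZl mrct t iG; apply: eq_integrable => // p _ /=; rewrite !EFinM.
  by have := integrableZl mrct t^-1 iH; apply: eq_integrable => // p _ /=; rewrite !EFinM.
apply: le_Rintegral => //.
- exact: integrable_normc.
- exact: integrable_lin.
- by move=> p rp; exact: pL2_inner_le.
Qed.

Lemma inner_self G : pL2 G -> inner G G = (psq G)%:C.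
Proof.
move=> LG; apply: eq_ReIm => /=.
  by apply: eq_Rintegral => p _; rewrite mul_conj_normc -complexRM /= mulrA.
rewrite -[RHS](mul0r (fine (mu rct))) -Rintegral_cst//; apply: eq_Rintegral => p _.
by rewrite mul_conj_normc -complexRM.
Qed.

Lemma innerC G H : pL2 G -> pL2 H -> inner H G = conjc (inner G H).
Proof.
move=> LG LH; rewrite /inner /pint -cint_conj//; last exact: pL2_inner_integrable.
by apply: eq_cint => p _; rewrite !conjcM conjcK conjc_real [conjc _ * _]mulrC.
Qed.

Lemma innerBl G H K : pL2 G -> pL2 H -> pL2 K ->
  inner (fun p => G p - H p) K = inner G K - inner H K.
Proof.
move=> LG LH LK; rewrite /inner /pint -cintB//; [|exact: pL2_inner_integrable..].
by apply: eq_cint => p _; rewrite !mulrBl.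
Qed.

Lemma innerDl G H K : pL2 G -> pL2 H -> pL2 K ->
  inner (fun p => G p + H p) K = inner G K + inner H K.
Proof.
move=> LG LH LK; rewrite /inner /pint -cintD//; [|exact: pL2_inner_integrable..].
by apply: eq_cint => p _; rewrite !mulrDl.
Qed.

Lemma innerZl c G K : pL2 G -> pL2 K -> inner (fun p => c * G p) K = c * inner G K.
Proof.
move=> LG LK; rewrite /inner /pint -cintZ//; last exact: pL2_inner_integrable.
by apply: eq_cint => p _; rewrite !mulrA.
Qed.

Lemma inner_suml (I : Type) (s : seq I) (f : I -> T -> R[i]) K :
  (forall i, pL2 (f i)) -> pL2 K ->
  inner (fun p => \sum_(i <- s) f i p) K = \sum_(i <- s) inner (f i) K.
Proof.
move=> Lf LK; rewrite /inner /pint.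
rewrite -(@cint_sum _ _ _ mu rct mrct _ s (fun i p => f i p * conjc (K p) * (p.1 / pi)%:C)).
  by apply: eq_cint => p _; rewrite !mulr_suml.
by move=> i; exact: pL2_inner_integrable.
Qed.

Lemma innerBr G H K : pL2 G -> pL2 H -> pL2 K ->
  inner K (fun p => G p - H p) = inner K G - inner K H.
Proof.
move=> LG LH LK; rewrite innerC//; last exact: pL2B.
by rewrite innerBl// conjcB -!innerC.
Qed.

Lemma innerZr c G K : pL2 G -> pL2 K -> inner K (fun p => c * G p) = conjc c * inner K G.
Proof. by move=> LG LK; rewrite innerC//; [rewrite innerZl// conjcM -innerC|exact: pL2Z]. Qed.

Lemma inner_sumr (I : Type) (s : seq I) (f : I -> T -> R[i]) K :
  (forall i, pL2 (f i)) -> pL2 K ->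
  inner K (fun p => \sum_(i <- s) f i p) = \sum_(i <- s) inner K (f i).
Proof.
move=> Lf LK; rewrite innerC ?inner_suml//; last exact: pL2_sum.
by rewrite conjc_sum; apply: eq_bigr => i _; rewrite -innerC.
Qed.

Lemma inner_ccvg (Gn : nat -> T -> R[i]) G H : (forall n, pL2 (Gn n)) -> pL2 G -> pL2 H ->
  (fun n => psq (fun p => Gn n p - G p)) @ \oo --> (0 : R) ->
  ccvg (fun n => inner (Gn n) H) (inner G H).
Proof.
move=> LGn LG LH h; apply/cvgr0Pnorm_lt => e e0.
have P0 := psq_ge0 H.
(* Chosen so that t^-1 psq H is less than e / 2, with + 1 covering psq H = 0; the other half of e is
   left to the distance from Gn to G. *)
pose t : R := (2 * (psq H + 1)) / e.
have t0 : 0 < t by rewrite divr_gt0// mulr_gt0// ltr_wpDl.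
have et : 0 < e / 2 / t by apply: divr_gt0 => //; exact: divr_gt0.
have [N _ hN] := (cvgr0Pnorm_lt (fun n => psq (fun p => Gn n p - G p))).1 h _ et.
exists N => // n Nn; have := hN n Nn; rewrite !ger0_norm ?normc_ge0 ?psq_ge0// => /= hn.
rewrite -innerBl// (le_lt_trans (inner_bound t0 (pL2B (LGn n) LG) LH))//.
rewrite (splitr e) ltrD//.
  by rewrite mulrC -ltr_pdivlMr.
rewrite /t invf_div mulrC mulrA ltr_pdivrMr ?mulr_gt0 ?ltr_wpDl//.
rewrite (_ : e / 2 * _ = (psq H + 1) * e); last by field.
by rewrite ltr_pM2r// ltrDl.
Qed.

End PolarL2.

(** * The Bergman projection *)

Section Bergman.
Context {R : realType}.
Notation leb := (@lebesgue_measure R).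
Notation T := (measurableTypeR R * measurableTypeR R)%type.
Notation rct := (@polar_rect R : set T).
Notation mu := (@leb2 R).
Implicit Types (F : R[i] -> R[i]) (G H K : T -> R[i]).

Definition mono n (p : T) : R[i] := polar p ^+ n.

Lemma normc_polar_le1 (p : T) : rct p -> Normc.normc (polar p) <= 1.
Proof.
by move=> rp; have [/andP[p0 p1] _] := polar_rectP rp; rewrite normc_polar_pt// ltW.
Qed.

Lemma normc_mono_le1 n p : rct p -> Normc.normc (mono n p) <= 1.
Proof. by move=> rp; rewrite normcX exprn_ile1 ?normc_ge0// normc_polar_le1. Qed.

Lemma cmeas_mono n : cmeas rct (mono n).
Proof. by apply: cmeasX; exact: (cmeas_polar disk_measurable_id). Qed.

Lemma pL2_mono n : pL2 (mono n).
Proof. by apply: (@pL2_bounded _ 1); [exact: cmeas_mono|exact: normc_mono_le1]. Qed.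

Lemma L2_disk_pL2 F : L2_disk F -> pL2 (fun p => F (polar p)).
Proof. by move=> [mF F2]; split => //; exact: cmeas_polar. Qed.

Lemma circle_int_co F r : 0 < r ->
  (forall w, Normc.normc w = r -> cderivable F w) ->
  cintegrable leb `[0, 2 * pi[ (fun t => F (r%:C * cis t)) /\
  cint leb `[0, 2 * pi[ (fun t => F (r%:C * cis t)) = circle_int F r.
Proof.
move=> r0 dF; have [i1 i2] := circle_integrable r0 dF.
have sub : (`[0, 2 * pi[%classic : set R) `<=` `[0, 2 * pi]%classic.
  by apply: subset_itvl; rewrite bnd_simp.
have j1 : leb.-integrable `[0, 2 * pi[ (EFin \o (fun t => complex.Re (F (r%:C * cis t)))).
  exact: integrableS i1.
have j2 : leb.-integrable `[0, 2 * pi[ (EFin \o (fun t => complex.Im (F (r%:C * cis t)))).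
  exact: integrableS i2.
split; first by split.
by apply: eq_ReIm => /=; apply: Rintegral_itv_bndo_bndc.
Qed.

(* On the circle of radius r, conj(w) ^ m = r ^ (2 m) w ^ (- m). *)
Lemma inner_mono_taylor v m : cderivable_disk v -> pL2 (fun p => v (polar p)) ->
  inner (fun p => v (polar p)) (mono m) = taylor_coef v m / m.+1%:R.
Proof.
move=> dv Lv; have ivm := pL2_inner_integrable Lv (pL2_mono m).
have E r t : 0 < r -> v (polar (r, t)) * conjc (mono m (r, t)) * (r / pi)%:C =
    (r ^+ m.*2.+1 / pi)%:C * (v (r%:C * cis t) * (r%:C * cis t)^-1 ^+ m).
  move=> r0; rewrite /mono /polar /=; set w := r%:C * cis t.
  have w0 : w != 0 by apply: normc_neq0; rewrite normc_polar ?ltW.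
  have -> : conjc (w ^+ m) = (r ^+ m.*2)%:C * w^-1 ^+ m.
    rewrite conjcX (_ : conjc w = (r ^+ 2)%:C * w^-1); last first.
      apply: (mulfI w0); rewrite mul_conj_normc normc_polar ?ltW//.
      by rewrite mulrCA divff// mulr1.
    by rewrite exprMn -rmorphXn /= -exprM mul2n.
  by rewrite exprSr !complexRM; ring.
have dX r : 0 < r < 1 -> forall w, Normc.normc w = r -> cderivable (fun w => v w * w^-1 ^+ m) w.
  move=> /andP[r0 r1] w wr; apply: cderivable_divX; first by apply: dv; rewrite wr.
  by apply: normc_neq0; rewrite wr.
have ir r : 0 <= r < 1 -> cintegrable leb `[0, 2 * pi[
    (fun t => v (polar (r, t)) * conjc (mono m (r, t)) * (r / pi)%:C).
  move=> /andP[r0 r1]; have [->|rn0] := eqVneq r 0.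
    apply: eq_cintegrable (cintegrable0 _ _); first exact: measurable_itv.
    by move=> t _; rewrite mul0r mulr0.
  have {}r0 : 0 < r by rewrite lt_neqAle eq_sym rn0.
  have r01 : 0 < r < 1 by rewrite r0.
  have : cintegrable leb `[0, 2 * pi[
      (fun t => (r ^+ m.*2.+1 / pi)%:C * (v (r%:C * cis t) * (r%:C * cis t)^-1 ^+ m)).
    by apply: cintegrableZ => //; exact: (circle_int_co r0 (dX _ r01)).1.
  by apply: eq_cintegrable; [exact: measurable_itv|move=> t _; rewrite E].
have [_ e] := cFubini_rect ivm ir.
rewrite /inner /pint e.
rewrite (_ : cint leb `[0, 1[ _ = cint leb `[0, 1[ (fun r => (2%:C * taylor_coef v m) * (r ^+ m.*2.+1)%:C)); last first.
  apply: eq_cint => r; rewrite /= in_itv /= => /andP[r0 r1].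
  have [->|rn0] := eqVneq r 0.
    rewrite expr0n /= mulr0 -[RHS](cint0 leb `[0, 2 * pi[); apply: eq_cint => t _.
    by rewrite mul0r mulr0.
  have {}r0 : 0 < r by rewrite lt_neqAle eq_sym rn0.
  have r01 : 0 < r < 1 by rewrite r0.
  have [j1 j2] := circle_int_co r0 (dX _ r01).
  rewrite (eq_cint leb (fun t _ => E r t r0)) cintZ// j2 taylor_circle//.
  rewrite mulrA -complexRM (_ : _ / pi * (2 * pi) = 2 * r ^+ m.*2.+1); last first.
    by rewrite [2 * pi]mulrC mulrA divfK 1?mulrC// gt_eqF// pi_gt0.
  by rewrite complexRM mulrAC.
have ic : cintegrable leb `[0, 1[ (fun r => (r ^+ m.*2.+1)%:C).
  apply: (@cintegrable_bounded _ _ R leb _ _ (fun r => (r ^+ m.*2.+1)%:C) 1); first exact: measurable_itv.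
  - have h : (leb `[0%R, 1%R[%classic < +oo)%E.
      by rewrite lebesgue_measure_itv /= lte_fin ltr01 -EFinB ltry.
    exact: h.
  - by apply: cmeas_real; apply: measurable_funX; exact: measurable_id.
  - move=> r; rewrite /= in_itv /= => /andP[r0 r1].
    by rewrite normcR ger0_norm ?exprn_ge0// exprn_ile1// ltW.
rewrite cintZ//.
have -> : cint leb `[0, 1[ (fun r => (r ^+ m.*2.+1)%:C) = (m.*2.+2%:R^-1)%:C.
  apply: eq_ReIm => /=; first by rewrite integral_exprn.
  by rewrite /Rintegral integral0.
rewrite mulrAC mulrC; congr (_ * _).
rewrite -complexRM -doubleS -muln2 natrM invfM mulrCA mulfV ?pnatr_eq0// mulr1.
by rewrite fmorphV rmorph_nat.
Qed.

Lemma normcn (n : nat) : Normc.normc (n%:R : R[i]) = n%:R.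
Proof. by rewrite -[n%:R](rmorph_nat (real_complex R)) normcR ger0_norm. Qed.

Lemma cderivable_diskX n : cderivable_disk (fun z : R[i] => z ^+ n).
Proof. by move=> z _; apply: cderivableX; exact: cderivable_id. Qed.

(** Through [inner_mono_taylor] this yields both the orthogonality and the norms of the
    monomials. *)
Lemma taylor_coefX n m : taylor_coef (fun z : R[i] => z ^+ n) m = (n == m)%:R.
Proof.
rewrite /taylor_coef; apply: (mulIf (@pi2C_neq0 R)); rewrite divfK ?pi2C_neq0//.
have p0 : 0 < 1 / 2 :> R by rewrite divr_gt0.
have pC0 : (1 / 2)%:C != 0 :> R[i] by rewrite eq_complex /= eqxx andbT gt_eqF.
have cn0 t : cis t != 0 :> R[i] by apply: normc_neq0; rewrite normc_cis.
have w0 t : (1 / 2)%:C * cis t != 0 :> R[i] by rewrite mulf_neq0.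
have icis (k : nat) : cintegrable leb `[0, 2 * pi] (fun t => cis t ^+ k).
  have := circle_integrable (@ltr01 R) (fun w _ => cderivableX k (cderivable_id w)).
  by apply: eq_cintegrable; [exact: measurable_itv|move=> t _; rewrite mul1r].
have icisV (k : nat) : cintegrable leb `[0, 2 * pi] (fun t => (cis t)^-1 ^+ k).
  have h (w : R[i]) : Normc.normc w = 1 -> cderivable (fun w => w^-1 ^+ k) w.
    move=> w1; apply: cderivableX; apply: cderivableV; last exact: cderivable_id.
    by apply: normc_neq0; rewrite w1.
  have := circle_integrable (@ltr01 R) h.
  by apply: eq_cintegrable; [exact: measurable_itv|move=> t _; rewrite mul1r].
have xV (x : R[i]) k : x != 0 -> x ^+ k * x^-1 ^+ k = 1.
  by move=> x0; rewrite -exprMn mulfV// expr1n.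
have [nm|nm|<-] := ltngtP n m.
- rewrite mul0r /circle_int.
  rewrite (_ : cint _ _ _ = cint leb `[0, 2 * pi] (fun t => (1 / 2)%:C^-1 ^+ (m - n) * (cis t)^-1 ^+ (m - n))); last first.
    apply: eq_cint => t _; rewrite -exprMn -invfM -{1}(subnKC (ltnW nm)) exprD mulrA.
    by rewrite xV// mul1r.
  by rewrite cintZ// cint_cisVX_eq0 ?mulr0// subn_gt0.
- rewrite mul0r /circle_int.
  rewrite (_ : cint _ _ _ = cint leb `[0, 2 * pi] (fun t => (1 / 2)%:C ^+ (n - m) * cis t ^+ (n - m))); last first.
    apply: eq_cint => t _; rewrite -exprMn -{1}(subnK (ltnW nm)) exprD -mulrA.
    by rewrite xV// mulr1.
  by rewrite cintZ// cint_cisX_eq0 ?mulr0// subn_gt0.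
- have -> : true%:R * (2 * pi)%:C = (2 * pi)%:C * 1 :> R[i] by rewrite mul1r mulr1.
  rewrite -cint_cst_circle; apply: eq_cint => t _.
  exact: xV.
Qed.

Lemma inner_mono n m : inner (mono n) (mono m) = (n == m)%:R / n.+1%:R :> R[i].
Proof.
rewrite (inner_mono_taylor m (@cderivable_diskX n) (pL2_mono n)) taylor_coefX.
by case: eqP => [->//|_]; rewrite !mul0r.
Qed.

Lemma psq_mono n : psq (mono n) = n.+1%:R^-1 :> R.
Proof.
have := inner_self (pL2_mono n); rewrite inner_mono eqxx mul1r.
by rewrite -[n.+1%:R](rmorph_nat (real_complex R)) -fmorphV => /complexI.
Qed.

(** The factor n + 1 is the inverse of the squared norm of z^n, by [psq_mono]. *)
Definition proj_coef G n : R[i] := n.+1%:R * inner G (mono n).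

Definition proj_sum G M (p : T) : R[i] := cpsum (proj_coef G) (polar p) M.

Lemma pL2_cpsum a M : pL2 (fun p : T => cpsum a (polar p) M).
Proof.
by apply: (@pL2_sum R _ _ (fun (m : 'I_M) p => a m * mono m p)) => m; apply: pL2Z; exact: pL2_mono.
Qed.

Lemma inner_cpsum_mono a M n :
  inner (fun p : T => cpsum a (polar p) M) (mono n) = (n < M)%:R * (a n / n.+1%:R).
Proof.
rewrite (@inner_suml R _ _ (fun (m : 'I_M) p => a m * mono m p)); last 2 first.
- by move=> m; apply: pL2Z; exact: pL2_mono.
- exact: pL2_mono.
have e (m : 'I_M) : inner (fun p => a m * mono m p) (mono n) = (m == n :> nat)%:R * (a n / n.+1%:R).
  rewrite innerZl ?inner_mono; [|exact: pL2_mono..].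
  by case: eqP => [->|_]; rewrite ?mul1r// !mul0r mulr0.
rewrite (eq_bigr _ (fun m _ => e m)) -mulr_suml; congr (_ * _).
have [nM|Mn] := ltnP n M.
  rewrite (bigD1 (Ordinal nM))//= eqxx big1 ?addr0// => m /eqP mn.
  by case: eqP => // mn'; exfalso; apply: mn; exact: val_inj.
by rewrite big1// => m _; case: eqP => // mn; move: (ltn_ord m); rewrite mn ltnNge Mn.
Qed.

Definition bessel_sum G M : R := \sum_(n < M) n.+1%:R * Normc.normc (inner G (mono n)) ^+ 2.

Lemma conjcn (n : nat) : conjc n%:R = n%:R :> R[i].
Proof. exact: conjc_nat. Qed.

Lemma inner_proj_sum G H M : pL2 G -> pL2 H ->
  (forall n, (n < M)%N -> inner H (mono n) = inner G (mono n)) ->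
  inner H (proj_sum G M) = (bessel_sum G M)%:C.
Proof.
move=> LG LH HG; rewrite (@inner_sumr R _ _ (fun (m : 'I_M) p => proj_coef G m * mono m p)) //.
  rewrite /bessel_sum rmorph_sum /=; apply: eq_bigr => m _.
  rewrite innerZr//; last exact: pL2_mono.
  rewrite HG// /proj_coef conjcM conjcn -mulrA [conjc _ * _]mulrC mul_conj_normc.
  by rewrite -[m.+1%:R](rmorph_nat (real_complex R)) -complexRM.
by move=> m; apply: pL2Z; exact: pL2_mono.
Qed.

Lemma inner_proj_sum_mono G M n : (n < M)%N ->
  inner (proj_sum G M) (mono n) = inner G (mono n).
Proof.
by move=> nM; rewrite inner_cpsum_mono nM mul1r /proj_coef mulrAC mulfV ?mul1r// pnatr_eq0.
Qed.

Lemma psqB G H : pL2 G -> pL2 H ->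
  (psq (fun p => G p - H p))%:C = inner G G - inner G H - inner H G + inner H H.
Proof.
move=> LG LH; rewrite -inner_self; last exact: pL2B.
by rewrite innerBl//; [rewrite !innerBr//; ring|exact: pL2B].
Qed.

Lemma psq_proj_sumB G M M' : pL2 G -> (M <= M')%N ->
  psq (fun p => proj_sum G M' p - proj_sum G M p) = bessel_sum G M' - bessel_sum G M.
Proof.
move=> LG MM; have LS n : pL2 (proj_sum G n) by exact: pL2_cpsum.
have e1 n n' : (n <= n')%N -> inner (proj_sum G n') (proj_sum G n) = (bessel_sum G n)%:C.
  move=> nn; apply: inner_proj_sum => // k kn.
  by rewrite inner_proj_sum_mono// (leq_trans kn).
apply: complexI; rewrite psqB// (innerC (LS M') (LS M)) !e1// conjc_real.
by rewrite -!rmorphB -rmorphD /=; congr (_%:C); ring.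
Qed.

Lemma bessel G M : pL2 G -> bessel_sum G M <= psq G.
Proof.
move=> LG; have LS : pL2 (proj_sum G M) by exact: pL2_cpsum.
have h := psq_ge0 (fun p => G p - proj_sum G M p).
have e : psq (fun p => G p - proj_sum G M p) = psq G - bessel_sum G M.
  apply: complexI; rewrite psqB// (innerC LG LS) !inner_proj_sum//; last first.
    by move=> n; exact: inner_proj_sum_mono.
  by rewrite inner_self// conjc_real subrK rmorphB.
by rewrite e subr_ge0 in h.
Qed.

Lemma bessel_sum_cvg G : pL2 G -> cvgn (bessel_sum G).
Proof.
move=> LG; apply: nondecreasing_is_cvgn.
  apply/nondecreasing_seqP => n; rewrite /bessel_sum big_ord_recr /= lerDl.
  by rewrite mulr_ge0// exprn_ge0// normc_ge0.
by exists (psq G) => _ [M _ <-]; exact: bessel.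
Qed.

Lemma proj_coef_bound G n : pL2 G -> Normc.normc (proj_coef G n) <= (psq G + 1) * n.+1%:R.
Proof.
move=> LG; rewrite Normc.normcM normcn mulrC ler_wpM2r//.
rewrite (le_trans (inner_bound ltr01 LG (pL2_mono n)))// invr1 !mul1r psq_mono lerD2l.
by rewrite invf_le1// ler1n.
Qed.

Definition bproj G : R[i] -> R[i] := csum (proj_coef G).

Lemma bproj_cderivable G : pL2 G -> cderivable_disk (bproj G).
Proof. by move=> LG; apply: csum_cderivable => n; exact: proj_coef_bound. Qed.

Lemma proj_sum_cvg G p : pL2 G -> rct p -> ccvg (fun M => proj_sum G M p) (bproj G (polar p)).
Proof.
move=> LG rp; apply: (cpsum_cvg (C := psq G + 1)); first by move=> n; exact: proj_coef_bound.
by apply/unit_diskE; exact: unit_disk_polar.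
Qed.

Lemma cmeas_bproj G : pL2 G -> cmeas rct (fun p => bproj G (polar p)).
Proof.
by move=> LG; apply/cmeas_polar/(disk_measurable_csum (C := psq G + 1)) => n; exact: proj_coef_bound.
Qed.

(** Fatou's lemma along the partial sums, which converge at every point of the disk, bounds the
    distance to the M-th one by a tail of the Bessel series. The case M = 0 gives square
    integrability of [bproj G], and letting M grow gives convergence in norm. *)
Lemma polar_sqnorm_bproj G M : pL2 G ->
  (polar_sqnorm (fun p => bproj G (polar p) - proj_sum G M p)%R <=
    (limn (bessel_sum G) - bessel_sum G M)%R%:E)%E.
Proof.
move=> LG; have LS n : pL2 (proj_sum G n) by exact: pL2_cpsum.
pose f n (p : T) := (Normc.normc (proj_sum G (n + M) p - proj_sum G M p) ^+ 2 * p.1 / pi)%:E.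
have mf n : measurable_fun rct (f n).
  by apply/measurable_EFinP; apply: measurable_sq; apply: cmeasB; exact: pL2_meas.
have f0 n p : rct p -> (0 <= f n p)%E.
  move=> rp; rewrite lee_fin.
  exact: (sq_ge0 (fun p => proj_sum G (n + M) p - proj_sum G M p) rp).
have := fatou mu measurable_polar_rect mf f0.
have -> : (\int[mu]_(p in rct) limn_einf (f^~ p))%E =
    polar_sqnorm (fun p => bproj G (polar p) - proj_sum G M p).
  apply: eq_integral => p /set_mem rp.
  have c : f^~ p @ \oo --> (Normc.normc (bproj G (polar p) - proj_sum G M p) ^+ 2 * p.1 / pi)%:E.
    apply: cvg_EFin; first exact: nearW.
    rewrite /f /=; apply: cvgM; last exact: cvg_cst.
    apply: cvgM; last exact: cvg_cst.
    have h := ccvg_normc (ccvgB (ccvg_shift M (proj_sum_cvg LG rp)) (ccvg_cst (proj_sum G M p))).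
    by rewrite expr2; under [fun n => _]eq_fun do rewrite expr2; exact: cvgM.
  rewrite is_cvg_limn_einfE; first exact: cvg_lim.
  by apply/cvg_ex; eexists; exact: c.
move/le_trans; apply.
have e n : (\int[mu]_(p in rct) f n p)%E = (bessel_sum G (n + M) - bessel_sum G M)%:E.
  rewrite -psq_proj_sumB ?leq_addl// -polar_sqnormE//; exact: pL2B.
rewrite (_ : (fun n => _) = (fun n => (bessel_sum G (n + M) - bessel_sum G M)%:E)); last first.
  by apply/funext => n; exact: e.
have c : (fun n => (bessel_sum G (n + M) - bessel_sum G M)%:E) @ \oo -->
    (limn (bessel_sum G) - bessel_sum G M)%:E.
  apply: cvg_EFin; first exact: nearW.
  apply: cvgB; last exact: cvg_cst.
  by rewrite (cvg_shiftn M); exact: bessel_sum_cvg.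
rewrite is_cvg_limn_einfE; last by apply/cvg_ex; eexists; exact: c.
by rewrite (cvg_lim _ c).
Qed.

Lemma pL2_bproj G : pL2 G -> pL2 (fun p => bproj G (polar p)).
Proof.
move=> LG; split; first exact: cmeas_bproj.
have h := polar_sqnorm_bproj 0 LG.
rewrite (_ : polar_sqnorm _ = polar_sqnorm (fun p => bproj G (polar p) - proj_sum G 0 p)).
  by apply: le_lt_trans h _; rewrite ltry.
by apply: eq_integral => p _; rewrite /proj_sum /cpsum big_ord0 subr0.
Qed.

Lemma psq_bproj_cvg G : pL2 G ->
  (fun M => psq (fun p => proj_sum G M p - bproj G (polar p))) @ \oo --> (0 : R).
Proof.
move=> LG; apply: (squeeze0 (v := fun M => limn (bessel_sum G) - bessel_sum G M)).
  move=> M; rewrite psq_ge0 /=.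
  have L := pL2B (pL2_bproj LG) (pL2_cpsum (proj_coef G) M).
  have := polar_sqnorm_bproj M LG; rewrite polar_sqnormE// lee_fin; apply: le_trans.
  by rewrite le_eqVlt; apply/orP; left; apply/eqP/eq_Rintegral => p _; rewrite normc_dist.
rewrite -(subrr (limn (bessel_sum G))); apply: cvgB; first exact: cvg_cst.
exact: bessel_sum_cvg.
Qed.

Lemma inner_bproj G H : pL2 G -> pL2 H ->
  ccvg (fun M => inner (proj_sum G M) H) (inner (fun p => bproj G (polar p)) H).
Proof.
move=> LG LH; apply: inner_ccvg => //; last exact: psq_bproj_cvg.
  by move=> n; exact: pL2_cpsum.
exact: pL2_bproj.
Qed.

Lemma inner_bproj_mono G n : pL2 G ->
  inner (fun p => bproj G (polar p)) (mono n) = inner G (mono n).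
Proof.
move=> LG; have h := inner_bproj LG (pL2_mono n).
apply: ccvg_unique (ccvg_shift n.+1 h) _.
by under eq_fun do rewrite inner_proj_sum_mono ?leq_addl//; exact: ccvg_cst.
Qed.

(* Off the ray theta = 0 a Bergman function is the sum of its Taylor series, whose
   coefficients are the inner products with the monomials. *)
Lemma bproj_bergman v (p : T) : cderivable_disk v -> pL2 (fun p => v (polar p)) ->
  0 < p.1 < 1 -> 0 < p.2 < 2 * pi -> bproj (fun p => v (polar p)) (polar p) = v (polar p).
Proof.
move=> dv Lv p1 p2; have rp : rct p.
  by move: p1 p2 => /andP[p1 p1'] /andP[p2 p2']; split; rewrite /= in_itv /= ltW.
apply: (ccvg_unique (proj_sum_cvg Lv rp)).
have e : (fun M => \sum_(m < M) taylor_coef v m * ((p.1)%:C * cis p.2) ^+ m) =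
    (fun M => proj_sum (fun p => v (polar p)) M p).
  apply/funext => M; rewrite /proj_sum /cpsum; apply: eq_bigr => m _; congr (_ * _).
  by rewrite /proj_coef inner_mono_taylor// mulrCA mulfV ?mulr1// pnatr_eq0.
by have := taylor_expansion dv p1 p2; rewrite e.
Qed.

End Bergman.

(** * Identification of the Bergman projection *)

Section Projection.
Context {R : realType}.
Notation leb := (@lebesgue_measure R).
Notation T := (measurableTypeR R * measurableTypeR R)%type.
Notation rct := (@polar_rect R : set T).
Notation mu := (@leb2 R).
Implicit Types (F u v : R[i] -> R[i]) (G K : T -> R[i]).

Lemma analytic_cderivable u : analytic_disk u <-> cderivable_disk u.
Proof.
split=> h z z1; first by apply/derivable_cderivable/h/unit_diskE.
by apply/derivable_cderivable/h/unit_diskE.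
Qed.

Lemma bergman_cderivable u : bergman u -> cderivable_disk u.
Proof. by move=> [_ /analytic_cderivable]. Qed.

Lemma bergman_pL2 u : bergman u -> pL2 (fun p => u (polar p)).
Proof. by move=> [/L2_disk_pL2]. Qed.

Lemma leb2_ray : mu (`[0, 1[%classic `*` [set 0]) = 0%E.
Proof.
rewrite (_ : mu _ = (leb \x leb)%E (`[0, 1[%classic `*` [set 0]))//.
rewrite product_measure1E//.
transitivity (leb `[0%R, 1%R[%classic * leb [set 0%R])%E => //.
by rewrite lebesgue_measure_set1 mule0.
Qed.

(** Expansions are known only for positive radius and angle: the ray has measure 0, and at r = 0 the
    weight vanishes. *)
Lemma psq_eq0_off_ray G : cmeas rct G ->
  (forall p, rct p -> 0 < p.1 -> 0 < p.2 -> G p = 0) -> psq G = 0.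
Proof.
move=> mG G0.
have z0 (p : T) : rct p -> p.2 <> 0 -> Normc.normc (G p) ^+ 2 * p.1 / pi = 0.
  move=> rp p2; have [/andP[p1 _] /andP[p2' _]] := polar_rectP rp.
  have [->|p1n] := eqVneq p.1 0; first by rewrite mulr0 mul0r.
  rewrite G0//; first by rewrite normc0E expr0n !mul0r.
    by rewrite lt_neqAle eq_sym p1n.
  by rewrite lt_neqAle p2' andbT eq_sym; apply/eqP.
rewrite /psq /Rintegral (_ : (\int[_]_(_ in _) _)%E = 0%E)//.
rewrite -(integral0 mu rct); apply: ae_eq_integral => //.
- exact: measurable_polar_rect.
- by apply/measurable_EFinP; exact: measurable_sq.
- exists (`[0, 1[%classic `*` [set 0]); split => //.
  + by apply: measurableX.
  + exact: leb2_ray.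
  + move=> p /= /not_implyP[rp np]; split; first by have [] := rp.
    by apply: contrapT => p2; apply: np; rewrite z0.
Qed.

Lemma inner_psq0 G G' K : pL2 G -> pL2 G' -> pL2 K ->
  psq (fun p => G p - G' p) = 0 -> inner G K = inner G' K.
Proof.
move=> LG LG' LK e; have := @inner_ccvg R (fun=> G) G' K (fun=> LG) LG' LK.
rewrite e => /(_ (cvg_cst _)); apply: ccvg_unique; exact: ccvg_cst.
Qed.

(** Density of polynomials in the Bergman space: v is the norm limit of its partial sums, each
    orthogonal to G. *)
Lemma inner_bergman_eq0 G v : pL2 G -> cderivable_disk v -> pL2 (fun p => v (polar p)) ->
  (forall n, inner G (mono n) = 0) -> inner (fun p => v (polar p)) G = 0.
Proof.
move=> LG dv Lv G0; have Lb := pL2_bproj Lv.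
rewrite (@inner_psq0 _ (fun p => bproj (fun p => v (polar p)) (polar p)))//; last first.
  apply: psq_eq0_off_ray; first by apply: cmeasB; exact: pL2_meas.
  move=> p rp p1 p2; have [/andP[_ p1'] /andP[_ p2']] := polar_rectP rp.
  by rewrite bproj_bergman ?subrr// ?p1 ?p2.
apply: ccvg_unique (inner_bproj Lv LG) _.
rewrite (_ : (fun M => _) = fun=> 0); first exact: ccvg_cst.
apply/funext => M.
rewrite (@inner_suml R _ _ (fun (m : 'I_M) p => proj_coef (fun p => v (polar p)) m * mono m p))//.
  rewrite big1// => m _; rewrite innerZl//; last exact: pL2_mono.
  by rewrite innerC ?G0 ?conjc0 ?mulr0//; exact: pL2_mono.
by move=> m; apply: pL2Z; exact: pL2_mono.
Qed.

Lemma polar_representation (z : R[i]) : exists2 t : R, 0 <= t <= 2 * pi &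
  z = (Normc.normc z)%:C * cis t.
Proof.
have [->|z0] := eqVneq z 0.
  by exists 0; [rewrite lexx pi2_ge0|rewrite normc0E mul0r].
have r0 := normc_gt0 z0; set r := Normc.normc z in r0 *.
pose a : R := complex.Re z / r.
have a1 : -1 <= a <= 1.
  by rewrite -ler_norml normrM normfV (gtr0_norm r0) ler_pdivrMr// mul1r Re_le_normc.
have sE : sin (acos a) = `|complex.Im z| / r.
  rewrite sin_acos//; apply/eqP; rewrite -(@eqrXn2 _ 2) ?sqrtr_ge0 ?divr_ge0 ?(ltW r0)//.
  rewrite sqr_sqrtr; last by rewrite subr_ge0 -real_normK ?num_real// exprn_ile1// ler_norml.
  rewrite (expr_div_n `|complex.Im z|) real_normK ?num_real// /a expr_div_n.
  have := normc_sqr z; rewrite -/r => e; apply/eqP.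
  have -> : complex.Im z ^+ 2 = r ^+ 2 - complex.Re z ^+ 2 by rewrite e addrC addKr.
  by rewrite mulrBl mulfV// sqrf_eq0 gt_eqF.
have [p0 p1] : 0 <= acos a /\ acos a <= pi by rewrite acos_ge0// acos_lepi.
have p2 : 0 <= pi :> R by exact: pi_ge0.
have rE : r * cos (acos a) = complex.Re z by rewrite acosK// /a mulrC divfK// gt_eqF.
have [i0|i0] := leP 0 (complex.Im z).
  exists (acos a); first by rewrite p0 /=; lra.
  apply: eq_ReIm; rewrite ?ReM ?ImM /= ?mul0r ?subr0 ?addr0 ?rE//.
  by rewrite sE ger0_norm// mulrC divfK// gt_eqF.
exists (2 * pi - acos a); first by apply/andP; split; lra.
have cE : cis (2 * pi - acos a) = conjc (cis (acos a)).
  by rewrite cisD cis_2pi mul1r cisN.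
rewrite cE; apply: eq_ReIm; rewrite ?ReM ?ImM /= ?mul0r ?subr0 ?addr0 ?rE//.
by rewrite mulrN sE ltr0_norm// mulNr mulrN opprK mulrC divfK// gt_eqF.
Qed.

(** Continuity fills in the origin and the slit, so that Bergman functions with equal coefficients
    agree at every point of the disk. *)
Lemma cderivable_disk_eq0 v : cderivable_disk v ->
  (forall r t, 0 < r < 1 -> 0 < t < 2 * pi -> v (r%:C * cis t) = 0) ->
  forall z, unit_disk z -> v z = 0.
Proof.
move=> dv v0 z /unit_diskE z1; apply: Normc.eq0_normc; apply/eqP.
rewrite eq_le normc_ge0 andbT; apply/ler_addgt0Pr => e e0; rewrite add0r.
have pi0 : 0 < pi :> R by exact: pi_gt0.
have [z0|z0] := eqVneq z 0.
  have [d d0 Hd] := cderivable_ccontinuous (dv z z1) e0.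
  pose r : R := Num.min (d / 2) (1 / 2).
  have r0 : 0 < r by rewrite lt_min !divr_gt0.
  have r1 : r < 1 by rewrite gt_min; apply/orP; right; rewrite ltr_pdivrMr// mul1r ltr1n.
  have rd : r < d by rewrite gt_min ltr_pdivrMr// ltr_pMr// ltr1n.
  have := Hd (r%:C * cis pi); rewrite normc_polar ?(ltW r0)// => /(_ rd).
  rewrite z0 add0r v0 ?sub0r ?normc_opp//; first by rewrite r0.
  by rewrite pi0 ltr_pMl// ltr1n.
have r0 := normc_gt0 z0.
have [t /andP[t0 t2] zE] := polar_representation z.
have cz : ccontinuous v ((expR (ln (Normc.normc z)))%:C * cis t).
  by rewrite lnK// -zE; exact/cderivable_ccontinuous/dv.
have [d d0 Hd] := ccontinuous_polar cz e0.
pose k : R := Num.min (d / 2) (pi / 2).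
have k0 : 0 < k by rewrite lt_min !divr_gt0.
have kd : k < d by rewrite gt_min ltr_pdivrMr// ltr_pMr// ltr1n.
have kp : k <= pi / 2 by rewrite ge_min lexx orbT.
(* A rotation by less than d that leaves the slit: forwards when t is at most pi, backwards
   otherwise. *)
have [s [sd s0 s2]] : exists s : R, [/\ `|s| < d, 0 < t + s & t + s < 2 * pi].
  have [tp|tp] := leP t pi.
    by exists k; rewrite gtr0_norm//; split => //; lra.
  by exists (- k); rewrite normrN gtr0_norm//; split => //; lra.
have := Hd 0 s; rewrite normr0 => /(_ d0 sd).
rewrite addr0 lnK// v0 ?r0 ?s0// -zE sub0r normc_opp//.
Qed.

Lemma bergman_ext u v : cderivable_disk u -> cderivable_disk v ->
  pL2 (fun p => u (polar p)) -> pL2 (fun p => v (polar p)) ->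
  (forall n, inner (fun p => u (polar p)) (mono n) = inner (fun p => v (polar p)) (mono n)) ->
  forall z, unit_disk z -> u z = v z.
Proof.
move=> du dv Lu Lv uv z z1; apply/eqP; rewrite -subr_eq0; apply/eqP.
apply: (@cderivable_disk_eq0 (fun z => u z - v z)) => //.
  by move=> w w1; apply: cderivableB; [exact: du|exact: dv].
move=> r t r01 t02.
have L := pL2B Lu Lv.
have d : cderivable_disk (fun z => u z - v z).
  by move=> w w1; apply: cderivableB; [exact: du|exact: dv].
rewrite -[LHS](@bproj_bergman _ (fun z => u z - v z) (r, t) d L r01 t02).
rewrite /bproj /csum (_ : cpsum _ _ = fun=> 0); first by rewrite (climP (ccvg_cst 0)).
apply/funext => M; rewrite /cpsum big1// => m _.
rewrite /proj_coef innerBl//; last exact: pL2_mono.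
by rewrite uv subrr mulr0 mul0r.
Qed.

Lemma bproj_bergman_fun G : pL2 G -> bergman (bproj G).
Proof.
move=> LG; split; last exact/analytic_cderivable/bproj_cderivable.
split; last by have [] := pL2_bproj LG.
by apply: (disk_measurable_csum (C := psq G + 1)) => n; exact: proj_coef_bound.
Qed.

Lemma bproj_is_proj F : pL2 (fun p => F (polar p)) ->
  is_bergman_proj F (bproj (fun p => F (polar p))).
Proof.
move=> LF; split; first exact: bproj_bergman_fun.
move=> v bv; have [dv Lv] := (bergman_cderivable bv, bergman_pL2 bv).
have Lb := pL2_bproj LF.
rewrite /L2_inner area_integral_pint.
rewrite -[LHS]/(inner (fun p => F (polar p) - bproj (fun p => F (polar p)) (polar p)) (fun p => v (polar p))).
rewrite innerC//; last exact: pL2B.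
rewrite inner_bergman_eq0 ?conjc0//; first exact: pL2B.
by move=> n; rewrite innerBl ?inner_bproj_mono ?subrr//; exact: pL2_mono.
Qed.

Lemma bergmanX n : bergman (fun z : R[i] => z ^+ n).
Proof.
split; last exact/analytic_cderivable/cderivable_diskX.
split; last by have [] := pL2_mono (R := R) n.
exact: (@cmeasX _ _ R cart_disk _ n disk_measurable_id).
Qed.

Lemma is_bergman_proj_unique F h : pL2 (fun p => F (polar p)) -> is_bergman_proj F h ->
  forall z, unit_disk z -> h z = bproj (fun p => F (polar p)) z.
Proof.
move=> LF [bh hF]; have [dh Lh] := (bergman_cderivable bh, bergman_pL2 bh).
apply: bergman_ext => //; [exact: bproj_cderivable|exact: pL2_bproj|].
move=> n; rewrite inner_bproj_mono//; apply/eqP; rewrite eq_sym -subr_eq0; apply/eqP.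
rewrite -innerBl//; last exact: pL2_mono.
by have := hF _ (bergmanX n); rewrite /L2_inner area_integral_pint.
Qed.

(** Existence rules out the default value of [xget]; uniqueness on the disk then identifies the
    chosen projection with the power series. *)
Lemma bergman_projE F : pL2 (fun p => F (polar p)) ->
  forall z, unit_disk z -> bergman_proj F z = bproj (fun p => F (polar p)) z.
Proof.
move=> LF; apply: is_bergman_proj_unique => //.
exact: (xgetPex (fun=> 0) (ex_intro _ _ (bproj_is_proj LF))).
Qed.

Lemma bergman_proj_bergman F : pL2 (fun p => F (polar p)) -> bergman (bergman_proj F).
Proof.
by move=> LF; have [] := (xgetPex (fun=> 0) (ex_intro _ _ (bproj_is_proj LF))).
Qed.

Lemma inner_bergman_proj F n : pL2 (fun p => F (polar p)) ->
  inner (fun p => bergman_proj F (polar p)) (mono n) = inner (fun p => F (polar p)) (mono n).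
Proof.
move=> LF; rewrite -[RHS](inner_bproj_mono n LF); apply: eq_inner => // p rp.
by rewrite bergman_projE//; exact: unit_disk_polar.
Qed.

End Projection.

(** * The matrix of a Toeplitz operator *)

Section Toeplitz.
Context {R : realType}.
Notation leb := (@lebesgue_measure R).
Notation T := (measurableTypeR R * measurableTypeR R)%type.
Notation rct := (@polar_rect R : set T).
Notation mu := (@leb2 R).
Implicit Types (F f u v : R[i] -> R[i]) (G K g : T -> R[i]).

Lemma bounded_diskP f : bounded_disk f ->
  exists M : R, forall p : T, rct p -> Normc.normc (f (polar p)) <= M.
Proof. by move=> [M fM]; exists M => p /unit_disk_polar/fM. Qed.

Lemma pL2_bounded_mul f G : disk_measurable f -> bounded_disk f -> pL2 G ->
  pL2 (fun p => f (polar p) * G p).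
Proof.
move=> mf /bounded_diskP[M fM] LG; apply: pL2_bmul fM LG; exact: cmeas_polar.
Qed.

Lemma disk_measurable_quad : disk_measurable (@quad_symbol R).
Proof.
suff : cmeas cart_disk (fun p : T => (p.1 +i* p.2) ^+ 2 + conjc (p.1 +i* p.2) ^+ 2) by [].
by apply: cmeasD; apply: cmeasX; [|apply: cmeas_conj]; exact: disk_measurable_id.
Qed.

Lemma bounded_disk_quad : bounded_disk (@quad_symbol R).
Proof.
exists 2 => z /unit_diskE z1; rewrite (le_trans (normc_triangle _ _))//.
rewrite !normcX normc_conj [leRHS](_ : _ = 1 + 1); last by ring.
by rewrite lerD// exprn_ile1 ?normc_ge0// ltW.
Qed.

(** The coefficient of z^(n - 2) in the projection of conj z ^2 z^n, that is the quotient of the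
    squared norms 1 / (n + 1) and 1 / (n - 1). It is 0 for n = 0 and n = 1, where the truncated
    exponent n - 2 would be meaningless. *)
Definition quad_weight (n : nat) : R[i] := n.-1%:R / n.+1%:R.

Definition quad_mono n (z : R[i]) : R[i] := z ^+ n.+2 + quad_weight n * z ^+ (n - 2).

Lemma quad_mono_cderivable n : cderivable_disk (quad_mono n).
Proof.
move=> z _; apply: cderivableD; first by apply: cderivableX; exact: cderivable_id.
apply: cderivableM; first exact: cderivable_cst.
by apply: cderivableX; exact: cderivable_id.
Qed.

Lemma pL2_quad_mono n : pL2 (fun p : T => quad_mono n (polar p)).
Proof.
exact: (pL2D (pL2_mono n.+2) (pL2Z (quad_weight n) (pL2_mono (n - 2)))).
Qed.

Lemma inner_conj2 G n : inner (fun p => conjc (polar p) ^+ 2 * G p) (mono n) = inner G (mono n.+2).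
Proof.
have aux (x y : R[i]) : x ^+ 2 * y * x ^+ n = y * x ^+ n.+2.
  by rewrite -(addn2 n) exprD; ring.
by apply: eq_cint => p _; congr (_ * _); rewrite /mono !conjcX; exact: aux.
Qed.

Lemma inner_quad_mono n m :
  inner (fun p => quad_symbol (polar p) * mono n p) (mono m) =
  inner (fun p => quad_mono n (polar p)) (mono m).
Proof.
have Lc : pL2 (fun p : T => conjc (polar p) ^+ 2 * mono n p).
  apply: (@pL2_bmul R _ 1); last exact: pL2_mono.
    by apply: cmeasX; apply: cmeas_conj; exact: (cmeas_polar disk_measurable_id).
  move=> p rp; rewrite normcX normc_conj exprn_ile1 ?normc_ge0//.
  exact: normc_polar_le1.
have -> : inner (fun p : T => quad_symbol (polar p) * mono n p) (mono m) =
    inner (fun p : T => mono n.+2 p + conjc (polar p) ^+ 2 * mono n p) (mono m).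
  apply: eq_inner => // p _; rewrite /quad_symbol mulrDl /mono; congr (_ + _).
  by rewrite -exprD add2n.
rewrite innerDl//; [|exact: pL2_mono..].
rewrite inner_conj2 /quad_mono innerDl//; last 3 first.
- exact: pL2_mono.
- by apply: pL2Z; exact: pL2_mono.
- exact: pL2_mono.
congr (_ + _); rewrite innerZl; [|exact: pL2_mono..].
rewrite !inner_mono /quad_weight.
case: n {Lc} => [|[|n]] /=; rewrite ?mul0r// subSS subSS subn0 !eqSS.
case: eqP => _; rewrite ?mul0r ?mulr0// !mul1r mulrAC mulfV ?mul1r// pnatr_eq0//.
Qed.

Lemma quad_symbol_real (z : R[i]) : conjc (quad_symbol z) = quad_symbol z.
Proof. by rewrite /quad_symbol conjcD !conjcX conjcK addrC. Qed.

Lemma toeplitz_quadX n z : unit_disk z ->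
  toeplitz (@quad_symbol R) (fun z => z ^+ n) z = quad_mono n z.
Proof.
move=> z1; have L : pL2 (fun p : T => quad_symbol (polar p) * mono n p).
  exact: pL2_bounded_mul disk_measurable_quad bounded_disk_quad (pL2_mono n).
rewrite /toeplitz bergman_projE//; apply: bergman_ext z1.
- exact: bproj_cderivable.
- exact: quad_mono_cderivable.
- exact: pL2_bproj.
- exact: pL2_quad_mono.
- by move=> m; rewrite inner_bproj_mono// inner_quad_mono.
Qed.

Lemma inner_toeplitz f u n : disk_measurable f -> bounded_disk f -> bergman u ->
  inner (fun p : T => toeplitz f u (polar p)) (mono n) =
  inner (fun p : T => f (polar p) * u (polar p)) (mono n).
Proof.
by move=> mf bf bu; apply: inner_bergman_proj; exact: pL2_bounded_mul mf bf (bergman_pL2 bu).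
Qed.

Definition matrix_entry f n m : R[i] := inner (fun p => f (polar p) * mono n p) (mono m).

(** Pair the two compositions applied to z^n with z^m. On the right the outer operator is moved to
    z^m, the symbol being real, so that on both sides the operator of [quad_symbol] acts on a
    monomial. *)
Lemma matrix_entry_commute f : disk_measurable f -> bounded_disk f ->
  (forall u : R[i] -> R[i], bergman u -> forall z, unit_disk z ->
     toeplitz f (toeplitz (@quad_symbol R) u) z = toeplitz (@quad_symbol R) (toeplitz f u) z) ->
  forall n m,
    matrix_entry f n.+2 m + quad_weight n * matrix_entry f (n - 2) m =
    matrix_entry f n m.+2 + quad_weight m * matrix_entry f n (m - 2).
Proof.
move=> mf bf comm n m.
have Lf k : pL2 (fun p : T => f (polar p) * mono k p).
  exact: pL2_bounded_mul mf bf (pL2_mono k).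
have bq : bergman (toeplitz (@quad_symbol R) (fun z => z ^+ n)).
  apply: bergman_proj_bergman.
  exact: pL2_bounded_mul disk_measurable_quad bounded_disk_quad (pL2_mono n).
have bT : bergman (toeplitz f (fun z => z ^+ n)) by apply: bergman_proj_bergman; exact: Lf.
have h : inner (fun p => toeplitz f (toeplitz (@quad_symbol R) (fun z => z ^+ n)) (polar p)) (mono m) =
    inner (fun p => toeplitz (@quad_symbol R) (toeplitz f (fun z => z ^+ n)) (polar p)) (mono m).
  apply: eq_inner => [p rp|//].
  exact: (comm _ (bergmanX n) _ (unit_disk_polar rp)).
have e1 := inner_toeplitz m mf bf bq.
have e2 := inner_toeplitz m disk_measurable_quad bounded_disk_quad bT.
have {h e1 e2} := etrans (esym e1) (etrans h e2).
have -> : inner (fun p : T => f (polar p) * toeplitz (@quad_symbol R) (fun z => z ^+ n) (polar p)) (mono m) =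
    matrix_entry f n.+2 m + quad_weight n * matrix_entry f (n - 2) m.
  rewrite (@eq_inner _ _ (fun p => f (polar p) * mono n.+2 p + quad_weight n * (f (polar p) * mono (n - 2) p)) _ (mono m))//.
    rewrite innerDl ?innerZl//; try exact: pL2_mono; exact: pL2Z.
  move=> p rp; rewrite toeplitz_quadX; last exact: unit_disk_polar.
  by rewrite /quad_mono /mono; ring.
move=> ->.
set g := toeplitz f (fun z => z ^+ n).
have Lg := bergman_pL2 bT; rewrite -/g in Lg.
have gm k : inner (fun p => g (polar p)) (mono k) = matrix_entry f n k.
  exact: (inner_toeplitz k mf bf (bergmanX n)).
have Lqm : pL2 (fun p : T => quad_symbol (polar p) * mono m p).
  exact: pL2_bounded_mul disk_measurable_quad bounded_disk_quad (pL2_mono m).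
have -> : inner (fun p : T => quad_symbol (polar p) * g (polar p)) (mono m) =
    inner (fun p : T => g (polar p)) (fun p => quad_symbol (polar p) * mono m p).
  by apply: eq_cint => p _; rewrite conjcM quad_symbol_real mulrCA mulrA.
(* The part of the product lost in projecting it is orthogonal to the Bergman function g, so the
   product may be replaced by [quad_mono m]. *)
have : inner (fun p => g (polar p))
    (fun p => quad_symbol (polar p) * mono m p - quad_mono m (polar p)) = 0.
  apply: inner_bergman_eq0 => //.
  - by apply: pL2B => //; exact: pL2_quad_mono.
  - exact: bergman_cderivable.
  - by move=> k; rewrite innerBl ?inner_quad_mono ?subrr//; [exact: pL2_quad_mono|exact: pL2_mono].
rewrite innerBr//; last exact: pL2_quad_mono.
move/eqP; rewrite subr_eq0 => /eqP ->.
rewrite innerC//; last exact: pL2_quad_mono.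
rewrite /quad_mono innerDl//; last 2 first.
- exact: pL2_mono.
- by apply: pL2Z; exact: pL2_mono.
rewrite innerZl//; last exact: pL2_mono.
rewrite conjcD conjcM -!innerC//; try exact: pL2_mono.
rewrite !gm (_ : conjc (quad_weight m) = quad_weight m)//.
by rewrite /quad_weight conjcM conjc_inv !conjcn.
Qed.

End Toeplitz.

(** * Angular pieces and Fourier slices *)

Section Radial.
Context {R : realType}.
Notation leb := (@lebesgue_measure R).
Notation T := (measurableTypeR R * measurableTypeR R)%type.
Notation rct := (@polar_rect R : set T).
Notation mu := (@leb2 R).
Implicit Types (G K g : T -> R[i]) (a : R -> R[i]).

Definition angular (k : int) a (p : T) : R[i] := cis (k%:~R * p.2) * a p.1.

(** 2 pi times the k-th Fourier coefficient of g on the circle of radius r. *)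
Definition fourier_slice g (k : int) (r : R) : R[i] :=
  cint leb `[0, 2 * pi[ (fun t => g (r, t) * conjc (cis (k%:~R * t))).

Lemma cmeas_cis (k : int) (D : set T) : cmeas D (fun p : T => cis (k%:~R * p.2)).
Proof.
have m : measurable_fun D (fun p : T => k%:~R * p.2 : R).
  by apply: measurable_funM; [exact: measurable_cst|exact: measurable_snd_T].
split.
  apply: (measurableT_comp _ m); apply: continuous_measurable_fun; exact: continuous_cos.
apply: (measurableT_comp _ m); apply: continuous_measurable_fun; exact: continuous_sin.
Qed.

Lemma cmeas_angular k a : L2_radial a -> cmeas rct (angular k a).
Proof.
move=> [m1 m2 _]; apply: cmeasM; first exact: cmeas_cis.
have sub : [set p.1 | p in rct] `<=` `[0, 1]%classic.
  by move=> _ [p /polar_rectP[/andP[p0 p1] _] <-]; rewrite /= in_itv /= p0 ltW.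
have m01 : measurable (`[0, 1]%classic : set R) by exact: measurable_itv.
split.
  exact: (measurable_comp m01 sub m1 (@measurable_fst_T R rct)).
exact: (measurable_comp m01 sub m2 (@measurable_fst_T R rct)).
Qed.

Lemma leb_circle : leb `[0%R, (2 * pi)%R[%classic = (2 * pi)%:E.
Proof. by rewrite lebesgue_measure_itv /= lte_fin mulr_gt0 ?pi_gt0// sube0. Qed.

Lemma leb_circle_lty : (leb `[0%R, (2 * pi)%R[%classic < +oo)%E.
Proof. by rewrite leb_circle ltry. Qed.

(** The modulus does not depend on the angle, so by Tonelli the squared norm is twice the integral
    of |a|^2 r. *)
Lemma pL2_angular k a : L2_radial a -> pL2 (angular k a).
Proof.
move=> ra; have ma := cmeas_angular k ra; split => //.
have [_ _ a2] := ra.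
pose h (p : T) : \bar R := ((fun p => (Normc.normc (angular k a p) ^+ 2 * p.1 / pi)%:E) \_ rct) p.
have mh : measurable_fun setT h.
  apply/(measurable_restrictT _ _).1; first exact: measurable_polar_rect.
  by apply/measurable_EFinP; exact: measurable_sq.
have h0 p : (0 <= h p)%E.
  rewrite /h patchE; case: ifPn => // /set_mem rp; rewrite lee_fin.
  exact: sq_ge0.
have := fubini_tonelli1 (m1 := leb) (m2 := leb) h mh h0.
move=> e; have -> : polar_sqnorm (angular k a) = (\int[leb \x leb]_z h z)%E.
  by rewrite /polar_sqnorm integral_mkcond.
rewrite e.
have E r : (\int[leb]_y h (r, y))%E = ((fun r => 2%:E * (Normc.normc (a r) ^+ 2 * r)%:E)%E \_ `[0, 1[) r.
  rewrite patchE; case: ifPn => [/set_mem r01|/negP r01].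
    have r0 : 0 <= r by move: r01; rewrite /= in_itv => /andP[].
    transitivity (\int[leb]_(y in `[0%R, (2 * pi)%R[) (Normc.normc (a r) ^+ 2 * r / pi)%:E)%E.
      rewrite [RHS]integral_mkcond; apply: eq_integral => t _; rewrite /h !patchE.
      have -> : ((r, t) \in rct) = (t \in (`[0, 2 * pi[%classic : set R)).
        by apply/idP/idP => /set_mem; [move=> [_ ?]; exact/mem_set|move=> ?; apply/mem_set].
      by case: ifP => // _; rewrite /angular Normc.normcM normc_cis mul1r.
    transitivity ((Normc.normc (a r) ^+ 2 * r / pi)%:E * leb `[0%R, (2 * pi)%R[%classic)%E.
      by rewrite integral_cst.
    rewrite leb_circle -!EFinM; congr (_%:E).
    by rewrite [2 * pi]mulrC mulrA divfK 1?mulrC// gt_eqF// pi_gt0.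
  rewrite integral0_eq// => t _; rewrite /h patchE; case: ifPn => // /set_mem[r1 _].
  by exfalso; apply: r01; exact/mem_set.
have -> : (\int[leb]_x fubini_F leb h x =
    \int[leb]_(r in `[0%R, 1%R[) (2%:E * (Normc.normc (a r) ^+ 2 * r)%:E))%E.
  by rewrite [RHS]integral_mkcond; apply: eq_integral => r _; exact: E.
have ca : @cmeas _ (measurableTypeR R) R `[0, 1]%classic a.
  by have [m1 m2 _] := ra; split; [exact: m1|exact: m2].
have ma2 : measurable_fun (`[0, 1]%classic : set (measurableTypeR R))
    (fun r => (Normc.normc (a r) ^+ 2 * r)%:E).
  apply/measurable_EFinP; apply: measurable_funM; last exact: measurable_id.
  by apply: measurable_funX; exact: (measurable_normc ca).
have p01 r : (`[0, 1]%classic : set R) r -> (0 <= (Normc.normc (a r) ^+ 2 * r)%:E)%E.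
  by rewrite /= in_itv /= => /andP[r0 _]; rewrite lee_fin mulr_ge0// exprn_ge0// normc_ge0.
apply: (@le_lt_trans _ _ (\int[leb]_(r in `[0%R, 1%R]) (2%:E * (Normc.normc (a r) ^+ 2 * r)%:E))%E).
  apply: ge0_subset_integral => //.
  - by apply: measurable_funeM.
  - by move=> r /p01 r0; rewrite mule_ge0.
  - by apply: subset_itvl; rewrite bnd_simp.
rewrite ge0_integralZl//; first by rewrite lte_mul_pinfty.
Qed.

Lemma pL2_partial_sum fk n : (forall k, L2_radial (fk k)) -> pL2 (@polar_partial_sum R fk n).
Proof.
move=> fkr; apply: (@pL2_sum R _ _ (fun (j : 'I_n.*2.+1) p =>
  angular (Posz j - Posz n)%R (fk (Posz j - Posz n)%R) p)) => j.
exact: pL2_angular.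
Qed.

Lemma measurable_slice (g : T -> R) r : 0 <= r < 1 -> measurable_fun rct g ->
  measurable_fun (`[0, 2 * pi[%classic : set R) (fun t => g (r, t)).
Proof.
move=> r01 mg.
have sub : [set (r, t) | t in (`[0, 2 * pi[%classic : set R)] `<=` rct.
  by move=> _ [t t0 <-]; split => //=; rewrite in_itv.
apply: (measurable_comp measurable_polar_rect sub mg).
by apply: measurable_funTS; apply: measurable_fun_pair; [exact: measurable_cst|exact: measurable_id].
Qed.

Lemma slice_integrable g M r (k : int) : 0 <= r < 1 -> cmeas rct g ->
  (forall p, rct p -> Normc.normc (g p) <= M) ->
  cintegrable leb `[0, 2 * pi[ (fun t => g (r, t) * conjc (cis (k%:~R * t))).
Proof.
move=> r01 [g1 g2] gM.
have mc : cmeas (`[0, 2 * pi[%classic : set R) (fun t => cis (k%:~R * t)).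
  have m : measurable_fun (`[0, 2 * pi[%classic : set R) (fun t => k%:~R * t).
    by apply: measurable_funM; [exact: measurable_cst|exact: measurable_id].
  split.
    by apply: (measurableT_comp _ m); apply: continuous_measurable_fun; exact: continuous_cos.
  by apply: (measurableT_comp _ m); apply: continuous_measurable_fun; exact: continuous_sin.
apply: (@cintegrable_bounded _ _ R leb _ _ _ M); first exact: measurable_itv.
- exact: leb_circle_lty.
- apply: cmeasM; last exact: cmeas_conj.
  by split; [exact: (measurable_slice r01 g1)|exact: (measurable_slice r01 g2)].
- move=> t t0; rewrite Normc.normcM normc_conj normc_cis mulr1; apply: gM.
  by split => //=; rewrite in_itv.
Qed.

Lemma inner_angular g M k a : cmeas rct g -> (forall p, rct p -> Normc.normc (g p) <= M) ->
  L2_radial a ->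
  cintegrable leb `[0, 1[ (fun r => (r / pi)%:C * conjc (a r) * fourier_slice g k r) /\
  inner g (angular k a) = cint leb `[0, 1[ (fun r => (r / pi)%:C * conjc (a r) * fourier_slice g k r).
Proof.
move=> mg gM ra; have Lg := pL2_bounded mg gM; have La := pL2_angular k ra.
have i0 := pL2_inner_integrable Lg La.
have E r t : g (r, t) * conjc (angular k a (r, t)) * (r / pi)%:C =
    (r / pi)%:C * conjc (a r) * (g (r, t) * conjc (cis (k%:~R * t))).
  by rewrite /angular conjcM /=; ring.
have ir r : 0 <= r < 1 -> cintegrable leb `[0, 2 * pi[
    (fun t => g (r, t) * conjc (angular k a (r, t)) * (r / pi)%:C).
  move=> r01.
  have : cintegrable leb `[0, 2 * pi[
      (fun t => (r / pi)%:C * conjc (a r) * (g (r, t) * conjc (cis (k%:~R * t)))).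
    by apply: cintegrableZ => //; exact: slice_integrable gM.
  by apply: eq_cintegrable; [exact: measurable_itv|move=> t _; rewrite E].
have [i1 e1] := cFubini_rect i0 ir.
have H r : (`[0, 1[%classic : set R) r ->
    cint leb `[0, 2 * pi[ (fun t => g (r, t) * conjc (angular k a (r, t)) * (r / pi)%:C) =
    (r / pi)%:C * conjc (a r) * fourier_slice g k r.
  rewrite /= in_itv /= => r01; rewrite (eq_cint leb (fun t _ => E r t)) cintZ//.
  exact: slice_integrable gM.
split; first by apply: eq_cintegrable i1 => //; exact: H.
by rewrite /inner /pint e1; apply: eq_cint.
Qed.

(** The condition bears on the product so that it can be met by either factor: by the radial part
    above the truncation, by the slice elsewhere. *)
Lemma inner_angular_eq0 g M k a : cmeas rct g -> (forall p, rct p -> Normc.normc (g p) <= M) ->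
  L2_radial a ->
  {ae leb, forall r : R, (`[0, 1[%classic : set R) r -> fourier_slice g k r * conjc (a r) = 0} ->
  inner g (angular k a) = 0.
Proof.
move=> mg gM ra ae0; have [[i1 i2] ->] := inner_angular k mg gM ra.
have z r : fourier_slice g k r * conjc (a r) = 0 ->
    (r / pi)%:C * conjc (a r) * fourier_slice g k r = 0.
  by move=> h; rewrite -mulrA [conjc _ * _]mulrC h mulr0.
apply: eq_ReIm; rewrite /= /Rintegral (_ : (\int[_]_(_ in _) _)%E = 0%E)//.
  rewrite -(integral0 leb (`[0, 1[%classic : set R)); apply: ae_eq_integral => //.
  - exact: measurable_int i1.
  - case: ae0 => X [mX X0 sub]; exists X; split => // r /= /not_implyP[r01 nr].
  by apply: sub => /= h; apply: nr; rewrite z ?h.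
rewrite -(integral0 leb (`[0, 1[%classic : set R)); apply: ae_eq_integral => //.
- exact: measurable_int i2.
- case: ae0 => X [mX X0 sub]; exists X; split => // r /= /not_implyP[r01 nr].
  by apply: sub => /= h; apply: nr; rewrite z ?h.
Qed.

End Radial.

(** * The recurrence on the diagonals *)

Section MatrixArgument.
Context {R : realType}.
Implicit Types (s : nat -> R[i]).

(* For the moments s l = \int g(t) t ^ l of an integrable function on [0, 1] the
   binomial sum is \int g(t) (1 - t) ^ M, which tends to 0: such a sequence cannot
   be supported at l = 0. *)
Definition vanishing s :=
  ccvg (fun M => \sum_(l < M.+1) ((-1) ^+ l *+ 'C(M, l)) * s l) 0.

Lemma vanishingD s1 s2 : vanishing s1 -> vanishing s2 -> vanishing (fun l => s1 l + s2 l).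
Proof.
move=> h1 h2; have := ccvgD h1 h2; rewrite addr0 /vanishing.
rewrite [X in ccvg X _ -> _](_ : _ =
  fun M => \sum_(l < M.+1) ((-1) ^+ l *+ 'C(M, l)) * (s1 l + s2 l))//.
by apply/funext => M; rewrite -big_split; apply: eq_bigr => l _; rewrite mulrDr.
Qed.

Lemma vanishingZ c s : vanishing s -> vanishing (fun l => c * s l).
Proof.
move=> h; have := ccvgZ c h; rewrite mulr0 /vanishing.
rewrite [X in ccvg X _ -> _](_ : _ =
  fun M => \sum_(l < M.+1) ((-1) ^+ l *+ 'C(M, l)) * (c * s l))//.
by apply/funext => M; rewrite mulr_sumr; apply: eq_bigr => l _; rewrite mulrCA.
Qed.

Lemma vanishing_eq s1 s2 : s1 =1 s2 -> vanishing s1 -> vanishing s2.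
Proof. by move=> /funext ->. Qed.

Lemma vanishing_supp0 s : vanishing s -> (forall l, s l.+1 = 0) -> s 0 = 0.
Proof.
move=> h s0; apply: ccvg_unique h.
rewrite (_ : (fun M => _) = fun=> s 0); first exact: ccvg_cst.
apply/funext => M; rewrite big_ord_recl /= bin0 expr0 mul1r big1 ?addr0// => i _.
by rewrite s0 mulr0.
Qed.

Variable A : nat -> nat -> R[i].

(** The relation of [matrix_entry_commute] multiplied by m + 1. The factor m - 1 of [quad_weight m]
    is then the normalisation of the column m - 2, and the conditional records that it is 0 for m <
    2. *)
Definition matrix_eqn := forall n m,
  A n.+2 m + quad_weight n * A (n - 2) m =
  m.+1%:R / m.+3%:R * A n m.+2 + (if (m < 2)%N then 0 else A n (m - 2)).

Definition diag_regular := exists C : R, forall n m,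
  Normc.normc (A n.+1 m.+1 - A n m) * (n + m).+1%:R <= C.

(** Both sequences run along the diagonal K - 4, the second one step ahead of the first. For K = 3
    and l = 0 the column of the first would be -1, and truncated subtraction would read A 0 0 in its
    place. *)
Definition diag_vanishing := forall K, (2 < K)%N ->
  vanishing (fun l => if (l == 0) && (K == 3) then 0 else A l.*2 (l.*2 + K - 4)) /\
  vanishing (fun l => A l.*2.+2 (l.*2 + K - 2)).

Hypotheses (eqnA : matrix_eqn) (regA : diag_regular).

Lemma diag_diff_cvg (D : nat -> R[i]) (n0 m0 : nat) :
  (forall p, D p = A (p.*2 + n0).+1 (p.*2 + m0).+1 - A (p.*2 + n0) (p.*2 + m0)) -> ccvg D 0.
Proof.
move=> DE; have [C hC] := regA.
have C0 : 0 <= C by rewrite (le_trans _ (hC 0 0))// mulr_ge0// normc_ge0.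
apply: (@ccvg_le _ _ _ (fun p => C * harmonic p)).
  move=> p; rewrite subr0 DE /harmonic /= -[leRHS]/(C / p.+1%:R) ler_pdivlMr//.
  rewrite (le_trans _ (hC (p.*2 + n0) (p.*2 + m0)))// ler_wpM2l ?normc_ge0// ler_nat.
  lia.
rewrite -[X in _ --> X](mulr0 C); apply: cvgM; [exact: cvg_cst|exact: cvg_harmonic].
Qed.

Lemma diag_bounded_below (D : nat -> R[i]) c : ccvg D 0 ->
  (forall p, Normc.normc c <= Normc.normc (D p)) -> c = 0.
Proof.
move=> D0 cD; apply: Normc.eq0_normc; apply/eqP; rewrite eq_le normc_ge0 andbT.
have := ccvg_normc D0; rewrite normc0E => h.
rewrite -(cvg_lim _ h)//; apply: limr_ge; first by apply/cvg_ex; eexists; exact: h.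
by near=> n; exact: cD.
Unshelve. all: by end_near. Qed.

(** At (n, n + K + 2) the relation has two terms on the diagonal K + 4, which vanish, and two on the
    diagonal K, both with coefficient 1. *)
Lemma diag_step K n : (forall n m, (n + K < m)%N -> A n m = 0) ->
  A n.+2 (n + K).+2 = A n (n + K).
Proof.
move=> zA; have := eqnA n (n + K).+2.
rewrite (zA (n - 2)%N); last by lia.
rewrite (zA n (n + K).+4); last by lia.
by rewrite !mulr0 addr0 add0r /= !subSS subn0.
Qed.

(** Each parity class is constant by [diag_step]; the difference of the two constants occurs between
    neighbours arbitrarily far down the diagonal, where regularity makes it tend to 0. *)
Lemma diag_const K n : (forall n m, (n + K < m)%N -> A n m = 0) -> A n (n + K) = A 0 K.
Proof.
move=> zA; have st i : A i.+2 (i + K).+2 = A i (i + K) by exact: diag_step.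
have ev p : A p.*2 (p.*2 + K) = A 0 K.
  by elim: p => // p IH; rewrite doubleS !addSn st.
have od p : A p.*2.+1 (p.*2.+1 + K) = A 1 K.+1.
  by elim: p => // p IH; rewrite doubleS addSn addSn st.
have e : A 1 K.+1 - A 0 K = 0.
  apply: (@diag_bounded_below (fun=> A 1 K.+1 - A 0 K)) => //.
  apply: (@diag_diff_cvg _ 0 K) => p; rewrite addn0.
  by rewrite -(ev p) -(od p) addSn.
have e' : A 1 K.+1 = A 0 K by apply/eqP; rewrite -subr_eq0 e.
by rewrite -(odd_double_half n); case: (odd n); rewrite ?add1n ?add0n ?ev ?od.
Qed.

Lemma natSC_neq0 k : k.+1%:R != 0 :> R[i].
Proof. by rewrite pnatr_eq0. Qed.

(** Solved at (2 l, 2 l + K - 2), the relation gives the increment of the diagonal K - 4 as c ((2 l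
    + K - 1) / (2 l + K + 1) - (2 l - 1) / (2 l + 1)) for l >= 1, which is 2 c / (2 l + 1) - 2 c /
    (2 l + K + 1). *)
Lemma diag_high_eq0 K n : diag_vanishing ->
  (forall a, vanishing (fun l => (l.*2 + a).+1%:R^-1)) -> (2 < K)%N ->
  (forall n m, (n + K < m)%N -> A n m = 0) -> A n (n + K) = 0.
Proof.
move=> vA vV K3 zA; rewrite diag_const//; set c := A 0 K.
have cst j : A j (j + K) = c by exact: diag_const.
have [v1 v2] := vA _ K3.
(* The actual increment minus its value for l >= 1; every ingredient is a vanishing sequence. *)
pose s l := A l.*2.+2 (l.*2 + K - 2) + (-1) * (if (l == 0) && (K == 3) then 0 else A l.*2 (l.*2 + K - 4)) +
  ((- 2 * c) * (l.*2 + 0).+1%:R^-1 + (2 * c) * (l.*2 + K).+1%:R^-1).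
have vs : vanishing s.
  apply: vanishingD; first by apply: vanishingD => //; exact: vanishingZ.
  by apply: vanishingD; apply: vanishingZ.
have sS l : s l.+1 = 0.
  rewrite /s /= addn0.
  have := eqnA l.+1.*2 (l.+1.*2 + K - 2)%N.
  have -> : (l.+1.*2 + K - 2 < 2)%N = false by lia.
  have -> : (l.+1.*2 + K - 2).+2 = (l.+1.*2 + K)%N by lia.
  have -> : (l.+1.*2 + K - 2 - 2 = l.+1.*2 + K - 4)%N by lia.
  have -> : A (l.+1.*2 - 2) (l.+1.*2 + K - 2) = c.
    by rewrite -(cst l.*2); congr (A _ _); lia.
  rewrite cst => e.
  have -> : A l.+1.*2.+2 (l.+1.*2 + K - 2) =
     (l.+1.*2 + K - 2).+1%:R / (l.+1.*2 + K).+1%:R * c + A l.+1.*2 (l.+1.*2 + K - 4) - quad_weight l.+1.*2 * c.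
    by rewrite -e addrK.
  have -> : ((l.+1.*2 + K - 2).+1 = (l.*2 + K).+1)%N by lia.
  have -> : ((l.+1.*2 + K).+1 = (l.*2 + K).+3)%N by lia.
  rewrite /quad_weight doubleS /=.
  have e1 : (l.*2 + K).+1%:R = (l.*2 + K).+3%:R - 2 :> R[i] by rewrite -[(_ + _).+3]addn2 natrD addrK.
  have e2 : l.*2.+1%:R = l.*2.+3%:R - 2 :> R[i] by rewrite -[l.*2.+3]addn2 natrD addrK.
  rewrite e1 e2; have := natSC_neq0 (l.*2 + K).+2; have := natSC_neq0 l.*2.+2.
  move: (l.*2.+3%:R) ((l.*2 + K).+3%:R) => x y x0 y0.
  by field; rewrite x0 y0.
(* At l = 0 the lowering weight is 0 where the formula (2 l - 1) / (2 l + 1) would give -1, so that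
   s 0 = - c. *)
have := vanishing_supp0 vs sS; rewrite /s /= !add0n.
have := eqnA 0 (K - 2)%N.
have -> : ((K - 2).+2 = K)%N by lia.
rewrite -[X in A 0 X]add0n cst /quad_weight /= mul0r mul0r addr0 => ->.
have -> : (if (K - 2 < 2)%N then 0 else A 0 (K - 2 - 2)) = if K == 3 then 0 else A 0 (K - 4).
  have -> : (K - 2 < 2)%N = (K == 3) by lia.
  by have -> : (K - 2 - 2 = K - 4)%N by lia.
have -> : ((K - 2).+1 = K.-1)%N by lia.
have -> : K.-1%:R = K.+1%:R - 2 :> R[i].
  by have -> : K.+1 = (K.-1 + 2)%N by [lia]; rewrite natrD addrK.
have := natSC_neq0 K; move: (K.+1%:R) (if _ then _ else _) => y u y0 h.
have : - c = 0 by rewrite -h; field.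
by move/eqP; rewrite oppr_eq0 => /eqP.
Qed.

(** The constant c determines the diagonal -3: its even and odd entries start at c / 3 and c / 6,
    and their difference is t c with t >= 1 / 6 throughout, whereas regularity makes it tend to
    0. *)
Lemma diag1_eq0 n : (forall n m, (n + 1 < m)%N -> A n m = 0) -> A n n.+1 = 0.
Proof.
move=> zA; have cst j : A j j.+1 = A 0 1 by rewrite -addn1; exact: diag_const.
rewrite cst; set c := A 0 1 in cst *.
pose G j := A (j + 3) j.
have G0 : G 0 = c / 3.
  have e := eqnA 1 0; rewrite /quad_weight /= !mul0r !addr0 cst in e.
  by rewrite /G add0n e mulrC mul1r.
have G1 : G 1 = c / 6.
  have e := eqnA 2 1; rewrite /quad_weight /= addr0 !cst in e.
  have -> : G 1 = 2 / 4 * c - 1 / 3 * c by rewrite -e addrK.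
  by field.
(* The increment is c ((j + 3) / (j + 5) - (j + 2) / (j + 4)), from the relation at (j + 3, j +
   2). *)
have GS j : G j.+2 = G j + 2 * c / ((j + 4)%:R * (j + 5)%:R).
  have := eqnA (j + 3)%N j.+2; rewrite /= subSS subSS subn0.
  have -> : A (j + 3 - 2) j.+2 = c by rewrite -(cst j.+1); congr (A _ _); lia.
  have -> : A (j + 3) j.+4 = c by rewrite -(cst (j + 3)%N); congr (A _ _); lia.
  have -> : (j + 3).+2 = (j.+2 + 3)%N by lia.
  rewrite -/(G j.+2) -/(G j) => e.
  have -> : G j.+2 = j.+3%:R / j.+4.+1%:R * c + G j - quad_weight (j + 3)%N * c by rewrite -e addrK.
  rewrite /quad_weight.
  have -> : (j + 3).-1 = (j + 2)%N by lia.
  have -> : (j + 3).+1 = (j + 4)%N by lia.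
  have -> : j.+4.+1 = (j + 5)%N by lia.
  have -> : j.+3 = (j + 3)%N by lia.
  have h4 : (j + 4)%:R != 0 :> R[i] by rewrite addnS natSC_neq0.
  have h5 : (j + 5)%:R != 0 :> R[i] by rewrite addnS natSC_neq0.
  have e5 : (j + 5)%:R = (j + 4)%:R + 1 :> R[i] by rewrite natr1 -addnS.
  have e3 : (j + 3)%:R = (j + 4)%:R - 1 :> R[i] by rewrite (_ : (j + 4)%N = (j + 3 + 1)%N) ?natrD ?addrK//; lia.
  have e2 : (j + 2)%:R = (j + 4)%:R - 2 :> R[i] by rewrite (_ : (j + 4)%N = (j + 2 + 2)%N) ?[(j + 2 + 2)%:R]natrD ?addrK//; lia.
  rewrite e2 e3; rewrite e5 in h5 *.
  move: ((j + 4)%:R) h4 h5 => x h4 h5; by field; rewrite h4 h5.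
(* Increments decrease with j, so an even entry gains at least as much as the odd entry that follows
   it. *)
have tel (x : R) : 0 < x -> 0 <= 2 / (x * (x + 1)) - 2 / ((x + 1) * (x + 2)).
  move=> x0; have h1 : x + 1 != 0 by rewrite gt_eqF// ltr_wpDl// ltW.
  have h2 : x + 2 != 0 by rewrite gt_eqF// ltr_wpDl// ltW.
  rewrite [X in _ <= X](_ : _ = 4 / (x * (x + 1) * (x + 2))).
    by rewrite divr_ge0// !mulr_ge0 ?addr_ge0// ltW.
  by field; rewrite h2 h1 gt_eqF.
pose D p := G p.*2 - G p.*2.+1.
have DE p : exists2 t : R, 1 / 6 <= t & D p = t%:C * c.
  elim: p => [|p [t t6 IH]].
    exists (1 / 6) => //; rewrite /D /= G0 G1 (_ : (1 / 6)%:C = 1 / 6); first by field.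
    by rewrite rmorphM /= fmorphV rmorph_nat.
  pose x : R := (p.*2 + 4)%:R; have x0 : 0 < x by rewrite ltr0n; lia.
  exists (t + 2 / (x * (x + 1)) - 2 / ((x + 1) * (x + 2))).
    by have := tel _ x0; lra.
  rewrite /D doubleS !GS.
  have -> : G p.*2 + 2 * c / ((p.*2 + 4)%:R * (p.*2 + 5)%:R) -
     (G p.*2.+1 + 2 * c / ((p.*2.+1 + 4)%:R * (p.*2.+1 + 5)%:R)) = D p +
     (2 / ((p.*2 + 4)%:R * (p.*2 + 5)%:R) - 2 / ((p.*2.+1 + 4)%:R * (p.*2.+1 + 5)%:R)) * c.
    by rewrite /D; ring.
  rewrite IH -mulrDl; congr (_ * _).
  have c4 : (p.*2 + 4)%:R = x%:C :> R[i] by rewrite rmorph_nat.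
  have c5 : (p.*2 + 5)%:R = (x + 1)%:C :> R[i] by rewrite addnS -natr1 c4 rmorphD rmorph1.
  have c5' : (p.*2.+1 + 4)%:R = (x + 1)%:C :> R[i] by rewrite -c5 addSnnS.
  have two : (2 : R[i]) = 2%:C by rewrite rmorph_nat.
  have c6 : (p.*2.+1 + 5)%:R = (x + 2)%:C :> R[i] by have -> : (p.*2.+1 + 5 = p.*2 + 4 + 2)%N by [lia]; rewrite natrD c4 two -rmorphD.
  rewrite c4 c5 c5' c6 -!rmorphM -!fmorphV /=.
  rewrite two.
  by rewrite -!complexRM -rmorphB -rmorphD /= addrA.
have D0 : ccvg D 0.
  rewrite -oppr0; apply: (@ccvg_le _ _ _ (fun p => Normc.normc (- D p - 0))).
    by move=> p; rewrite subr0 normc_opp oppr0 subr0.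
  apply: (@diag_diff_cvg (fun p => - D p) 3 0) => p.
  by rewrite /D opprB /G; congr (A _ _ - A _ _); lia.
have : c / 6 = 0.
  apply: (diag_bounded_below D0) => p; have [t t6 ->] := DE p.
  rewrite !Normc.normcM normcR mulrC ler_wpM2r ?normc_ge0//.
  rewrite Normc.normcV normcn ger0_norm; lra.
by move/eqP; rewrite mulf_eq0 invr_eq0 pnatr_eq0 orbF => /eqP.
Qed.

(** Strong induction on the distance q = n - m, then on m by steps of two: the relation at (m + q -
    2, m) involves only the diagonal at distance q - 4 and the entry of column m - 2 at distance q.
    For q = 1 and m = 0 its first index would be -1, so that diagonal is handled apart, with the
    help of regularity. *)
Lemma lower_eq0 n m : (forall n m, (n <= m)%N -> A n m = 0) -> A n m = 0.
Proof.
move=> zA.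
have H1 j : A j.+1 j = 0.
  pose h j := A j.+1 j.
  have h1 : h 1 = 0.
    have e := eqnA 0 1; rewrite /quad_weight /= !mul0r !addr0 (zA 0 3)// mulr0 in e.
    exact: e.
  have hS i : h i.+2 = h i.
    have := eqnA i.+1 i.+2; rewrite /= !subSS subn0.
    by rewrite (zA (i.+1 - 2)%N); [rewrite (zA i.+1 i.+4); [rewrite !mulr0 addr0 add0r|lia]|lia].
  have od p : h p.*2.+1 = 0 by elim: p => // p IH; rewrite doubleS hS.
  have ev p : h p.*2 = h 0 by elim: p => // p IH; rewrite doubleS hS.
  have h0 : h 0 = 0.
    apply: (@diag_bounded_below (fun=> - h 0)); last by move=> p; rewrite normc_opp.
    apply: (@diag_diff_cvg _ 1 0) => p; rewrite -(ev p) -[LHS]add0r -(od p) /h.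
    by congr (A _ _ - A _ _); lia.
  rewrite -/(h j) -(odd_double_half j); case: (odd j); rewrite ?add1n ?add0n ?od//.
  by rewrite ev.
have [nm|mn] := leqP n m; first exact: zA.
have -> : n = (m + (n - m))%N by lia.
have : (0 < n - m)%N by lia.
move: (n - m)%N => q q0 {mn}; elim/ltn_ind: q m q0 => q IH m q0.
have [q1|q2] := leqP q 1; first by have -> : q = 1%N by [lia]; rewrite addn1 H1.
have low i j : (i + 4 <= j + q \/ i <= j)%N -> (j + q <= i + 4 \/ i <= j)%N -> A i j = 0.
  move=> h1 h2; have [ij|ji] := leqP i j; first exact: zA.
  have -> : i = (j + (q - 4))%N by lia.
  by apply: IH; lia.
elim/ltn_ind: m => m IHm.
have := eqnA (m + q - 2)%N m.
have -> : (m + q - 2).+2 = (m + q)%N by lia.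
have -> : A (m + q - 2) m.+2 = 0 by apply: low; lia.
have -> : quad_weight (m + q - 2)%N * A (m + q - 2 - 2) m = 0.
  have [h|h] := leqP (m + q) 3.
    rewrite /quad_weight; have -> : (m + q - 2).-1 = 0%N by lia.
    by rewrite !mul0r.
  by rewrite (low (m + q - 2 - 2)%N m) ?mulr0//; lia.
rewrite mulr0 addr0 add0r => ->; case: ifPn => // m2.
have -> : (m + q - 2 = (m - 2) + q)%N by lia.
by apply: IHm; lia.
Qed.

End MatrixArgument.

(** * Moments *)

Section Moments.
Context {R : realType}.
Notation leb := (@lebesgue_measure R).

Lemma natmul_exprn_cvg0 (q : R) : 0 <= q < 1 -> (fun n => n.+1%:R * q ^+ n) @ \oo --> (0 : R).
Proof.
move=> q01; have := cvg_series_cvg_0 (cvg_arith_geom ler01 q01).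
by under eq_fun do rewrite mul1r.
Qed.

Lemma bernoulli_ge (a : R) n : 0 <= a -> 1 + n%:R * a <= (1 + a) ^+ n.
Proof.
move=> a0; elim: n => [|n IH]; first by rewrite mul0r addr0 expr0.
rewrite exprS; apply: le_trans (ler_wpM2l _ IH); last by rewrite addr_ge0.
rewrite -natr1; have : 0 <= n%:R * a * a by rewrite !mulr_ge0.
by move=> h; lra.
Qed.

Lemma bernoulli_le (a : R) n : 0 <= a <= 1 -> 1 - n%:R * a <= (1 - a) ^+ n.
Proof.
move=> /andP[a0 a1]; elim: n => [|n IH]; first by rewrite mul0r subr0 expr0.
rewrite exprS; apply: le_trans (ler_wpM2l _ IH); last by rewrite subr_ge0.
rewrite -natr1; have : 0 <= n%:R * a * a by rewrite !mulr_ge0.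
by move=> h; lra.
Qed.

(* In r ^ 2 these tend to the indicator of r < x on [0, 1[; the factor n + 1 in the
   exponent forces the limit 0 at r = x as well. *)
Definition step_poly (x : R) (n : nat) : {poly R} :=
  (1 - (2^-1 *: ((1 - x ^+ 2)%:P + 'X)) ^+ n) ^+ (n.+1 * 2 ^ n).

Lemma step_polyE x n (r : R) :
  (step_poly x n).[r ^+ 2] = (1 - (2^-1 * (1 - x ^+ 2 + r ^+ 2)) ^+ n) ^+ (n.+1 * 2 ^ n).
Proof. by rewrite /step_poly !hornerE. Qed.

Lemma step_poly_bound x n (r : R) : 0 <= x <= 1 -> 0 <= r < 1 ->
  0 <= (step_poly x n).[r ^+ 2] <= 1.
Proof.
move=> /andP[x0 x1] /andP[r0 r1]; rewrite step_polyE.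
have x2 : x ^+ 2 <= 1 by rewrite exprn_ile1.
have r2 : r ^+ 2 <= 1 by rewrite exprn_ile1// ltW.
have x20 : 0 <= x ^+ 2 by rewrite sqr_ge0.
have r20 : 0 <= r ^+ 2 by rewrite sqr_ge0.
set p := 2^-1 * _; have p0 : 0 <= p by rewrite /p; lra.
have p1 : p <= 1 by rewrite /p; lra.
have pn0 : 0 <= p ^+ n by rewrite exprn_ge0.
have pn1 : p ^+ n <= 1 by rewrite exprn_ile1.
by rewrite exprn_ge0 ?exprn_ile1 ?subr_ge0// gerBl.
Qed.

(** With p = (1 - x^2 + r^2) / 2 one has 2 p < 1 exactly when r < x, and the exponent N = (n + 1)
    2^n gives N p^n = (n + 1) (2 p)^n. Bernoulli's inequality settles both cases, as in elementary
    proofs of the Stone-Weierstrass theorem. *)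
Lemma step_poly_cvg x (r : R) : 0 <= x <= 1 -> 0 <= r < 1 ->
  (fun n => (step_poly x n).[r ^+ 2]) @ \oo --> ((r < x)%R%:R : R).
Proof.
move=> x01 r01; have bd n := step_poly_bound n x01 r01.
case/andP: (x01) => x0 x1; case/andP: (r01) => r0 r1.
have x2 : x ^+ 2 <= 1 by rewrite exprn_ile1.
have r20 : 0 <= r ^+ 2 by rewrite sqr_ge0.
have r2 : r ^+ 2 <= 1 by rewrite exprn_ile1// ltW.
have x20 : 0 <= x ^+ 2 by rewrite sqr_ge0.
set p := 2^-1 * (1 - x ^+ 2 + r ^+ 2).
have p0 : 0 <= p by rewrite /p; lra.
have p1 : p <= 1 by rewrite /p; lra.
have pn n : 0 <= p ^+ n <= 1 by rewrite exprn_ge0 ?exprn_ile1.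
have e2 n : (n.+1 * 2 ^ n)%:R * p ^+ n = n.+1%:R * (2 * p) ^+ n :> R.
  by rewrite natrM natrX [(2 * p) ^+ n]exprMn mulrA.
have [rx|xr] := ltP r x.
  have rx2 : r ^+ 2 < x ^+ 2 by rewrite ltr_sqr.
  have q01 : 0 <= 2 * p < 1 by rewrite /p; apply/andP; split; lra.
  rewrite /=; have h : (fun n => 1 - (step_poly x n).[r ^+ 2]) @ \oo --> (0 : R).
    apply: squeeze0 (natmul_exprn_cvg0 q01) => n; have /andP[b0 b1] := bd n.
    rewrite subr_ge0 b1 /= -e2 lerBlDr -lerBlDl step_polyE; exact: bernoulli_le.
  rewrite (_ : (fun n => (step_poly x n).[r ^+ 2]) = fun n => 1 - (1 - (step_poly x n).[r ^+ 2])).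
    by rewrite -[X in _ --> X](subr0 (1 : R)); apply: cvgB => //; exact: cvg_cst.
  by apply/funext => n; rewrite subKr.
have rx2 : x ^+ 2 <= r ^+ 2 by rewrite ler_sqr.
have q1 : 1 <= 2 * p by rewrite /p; lra.
apply: squeeze0 (@cvg_harmonic R) => n; have /andP[b0 _] := bd n; rewrite b0 /=.
rewrite step_polyE -/p; set N := (n.+1 * 2 ^ n)%N; have /andP[a0 a1] := pn n.
(* Since (1 - a) (1 + a) <= 1, the value is at most (1 + p^n)^(- N), hence at most 1 / (n + 1); this
   includes r = x, where 2 p = 1. *)
have h1 : n.+1%:R <= (1 + p ^+ n) ^+ N.
  rewrite (le_trans _ (bernoulli_ge N a0))// e2 ler_wpDl// ler_peMr//.
  by rewrite exprn_ege1.
have h2 : (1 - p ^+ n) ^+ N * (1 + p ^+ n) ^+ N <= 1.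
  rewrite -exprMn exprn_ile1//; first by rewrite mulr_ge0 ?subr_ge0 ?addr_ge0.
  have : 0 <= p ^+ n * p ^+ n by rewrite mulr_ge0.
  by move=> h; lra.
rewrite -[leRHS]mul1r ler_pdivlMr// (le_trans _ h2)// ler_wpM2l//.
by rewrite exprn_ge0// subr_ge0.
Qed.

(** * Functions with vanishing even moments *)

Section Measure.
Variable chi : R -> R[i].
Hypothesis ichi : cintegrable leb `[0, 1[ chi.
Hypothesis moments : forall j, cint leb `[0, 1[ (fun r => ((r ^+ 2) ^+ j)%:C * chi r) = 0.

Let m01 : measurable (`[0, 1[%classic : set R) := measurable_itv _.

Let cmeas_poly (q : {poly R}) : cmeas (`[0, 1[%classic : set R) (fun r => (q.[r ^+ 2])%:C).
Proof.
apply: cmeas_real; apply: measurable_funTS; apply: continuous_measurable_fun => r.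
have -> : (fun r : R => q.[r ^+ 2]) = horner q \o (fun r => r ^+ 2) by [].
by apply: continuous_comp; [exact: exprn_continuous|exact: continuous_horner].
Qed.

Let cint_poly (q : {poly R}) : cint leb `[0, 1[ (fun r => (q.[r ^+ 2])%:C * chi r) = 0.
Proof.
have ii j : cintegrable leb `[0, 1[ (fun r => ((r ^+ 2) ^+ j)%:C * chi r).
  apply: (@cintegrable_le _ _ R leb _ m01 _ (fun r => Normc.normc (chi r))).
  - apply: cmeasM; last exact: cintegrable_meas ichi.
    have := cmeas_poly ('X^j); congr cmeas; apply/funext => r.
    by rewrite hornerXn.
  - exact: integrable_normc.
  - move=> r; rewrite /= in_itv /= => /andP[r0 r1].
    rewrite Normc.normcM normcR ger0_norm ?exprn_ge0// ler_piMl ?normc_ge0//.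
    by rewrite -exprM exprn_ile1// ltW.
transitivity (cint leb `[0, 1[ (fun r => \sum_(j < size q) (q`_j)%:C * (((r ^+ 2) ^+ j)%:C * chi r))).
  apply: eq_cint => r _; rewrite horner_coef raddf_sum /= mulr_suml.
  by apply: eq_bigr => j _; rewrite complexRM mulrA.
rewrite cint_sum//; last by move=> j; exact: cintegrableZ.
by rewrite big1// => j _; rewrite cintZ// moments mulr0.
Qed.

Let cint_below x : 0 <= x <= 1 -> cint leb `[0, 1[ (fun r => ((r < x)%R%:R : R)%:C * chi r) = 0.
Proof.
move=> x01; have mx : cmeas (`[0, 1[%classic : set R) (fun r => ((r < x)%R%:R : R)%:C).
  apply: cmeas_real; apply: measurable_funTS.
  rewrite (_ : (fun r : R => _) = \1_(`]-oo, x[%classic : set R)).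
    exact: measurable_indic.
  apply/funext => r; rewrite indicE; congr ((nat_of_bool _)%:R); apply/idP/idP; rewrite inE /= in_itv //=.
have c : ccvg (fun n => cint leb `[0, 1[ (fun r => ((step_poly x n).[r ^+ 2])%:C * chi r))
    (cint leb `[0, 1[ (fun r => ((r < x)%R%:R : R)%:C * chi r)).
  apply: (@cint_dominated _ _ R leb _ m01 _ _ (fun r => Normc.normc (chi r))).
  - by move=> n; apply: cmeasM; [exact: cmeas_poly|exact: (cintegrable_meas ichi)].
  - by apply: cmeasM => //; exact: (cintegrable_meas ichi).
  - exact: integrable_normc.
  - move=> r; rewrite /= in_itv /= => r01; have h := step_poly_cvg x01 r01.
    apply: ReIm_ccvg; rewrite /=.
      under eq_fun do rewrite ReM /= mul0r subr0; rewrite ReM /= mul0r subr0.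
      by apply: cvgM => //; exact: cvg_cst.
    under eq_fun do rewrite ImM /= mul0r addr0; rewrite ImM /= mul0r addr0.
    by apply: cvgM => //; exact: cvg_cst.
  - move=> n r; rewrite /= in_itv /= => r01; have /andP[b0 b1] := step_poly_bound n x01 r01.
    by rewrite Normc.normcM normcR ger0_norm// ler_piMl ?normc_ge0.
apply: ccvg_unique c _.
under eq_fun do rewrite cint_poly; exact: ccvg_cst.
Qed.

(** Lebesgue differentiation: extended by 0, h has an identically zero primitive, and almost
    everywhere h is the derivative of its primitive. *)
Lemma ae_eq0_of_primitive (h : R -> R) : leb.-integrable `[0, 1[ (EFin \o h) ->
  (forall x, 0 <= x <= 1 -> \int[leb]_(r in `[0, 1[) ((r < x)%R%:R * h r) = 0) ->
  {ae leb, forall r, (`[0, 1[%classic : set R) r -> h r = 0}.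
Proof.
move=> ih h0; pose g := h \_ (`[0, 1[%classic : set R).
have ig : leb.-integrable setT (EFin \o g).
  have := (integrable_mkcond (mu := leb) (EFin \o h) m01).1 ih.
  by rewrite restrict_EFin.
have locg : locally_integrable setT g.
  exact: integrable_locally.
have ig' y : leb.-integrable `]-oo, y] (EFin \o g).
  by apply: integrableS ig.
have F0 (x : R) : \int[leb]_(t in `]-oo, x]) g t = 0.
  rewrite -Rintegral_itv_bndo_bndc; last by apply: integrableS ig.
  rewrite Rintegral_mkcond.
  (* For x outside [0, 1] the half-line below x meets [0, 1[ in the same set as the half-line below
     y = 0 or y = 1. *)
  have E y : 0 <= y <= 1 -> (forall r, 0 <= r < 1 -> (r < y) = (r < x)) ->
      \int[leb]_r ((g \_ `]-oo, x[) r) = 0.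
    move=> y01 yx; rewrite -(h0 _ y01) [RHS]Rintegral_mkcond.
    apply: eq_Rintegral => r _; rewrite /g !patchE.
    have -> : (r \in `]-oo, x[%classic) = (r < x) by apply/idP/idP; rewrite inE /= in_itv.
    have -> : (r \in `[0, 1[%classic) = (0 <= r < 1) by apply/idP/idP; rewrite inE /= in_itv.
    by case: ifPn => rx; case: ifPn => // r01; rewrite yx ?rx ?mul1r ?mul0r// (negbTE rx) mul0r.
  have [x0|x0] := ltP x 0.
    apply: (E 0); first by rewrite lexx ler01.
    by move=> r /andP[r0 _]; rewrite ltNge r0 ltNge ltW// (lt_le_trans x0).
  have [x1|x1] := leP x 1; first by apply: (E x); rewrite ?x0.
  apply: (E 1); first by rewrite lexx ler01.
  by move=> r /andP[_ r1]; rewrite r1 (lt_trans r1).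
have := FTC1Ny ig' locg; case=> X [mX X0 sub]; exists X; split => // r /= /not_implyP[r01 nr].
apply: sub => /= -[_ e]; apply: nr.
have : g r = 0.
  rewrite -e (_ : (fun x => _) = cst 0); last by apply/funext => x; exact: F0.
  exact: derive1_cst.
by rewrite /g patchE mem_set.
Qed.

Lemma moments_eq0 : {ae leb, forall r, (`[0, 1[%classic : set R) r -> chi r = 0}.
Proof.
have [i1 i2] := ichi.
have h1 : {ae leb, forall r, (`[0, 1[%classic : set R) r -> complex.Re (chi r) = 0}.
  apply: ae_eq0_of_primitive => // x x01; have := congr1 (@complex.Re R) (cint_below x01).
  by move=> e; rewrite -[RHS]/(complex.Re (0 : R[i])) -e; apply: eq_Rintegral => r _ /=; rewrite ReM /= mul0r subr0.
have h2 : {ae leb, forall r, (`[0, 1[%classic : set R) r -> complex.Im (chi r) = 0}.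
  apply: ae_eq0_of_primitive => // x x01; have := congr1 (@complex.Im R) (cint_below x01).
  by move=> e; rewrite -[RHS]/(complex.Im (0 : R[i])) -e; apply: eq_Rintegral => r _ /=; rewrite ImM /= mul0r addr0.
apply: negligibleS (negligibleU h1 h2) => r /= nr.
have [n1|n1] := pselect (complex.Re (chi r) = 0); last by left => h; apply: nr => r01; case: (n1 (h r01)).
by right => h; apply: nr => r01; apply: eq_ReIm; [exact: n1|exact: h].
Qed.

End Measure.
End Moments.

(** * Alternating binomial sums of weighted powers *)

Section BinomialWeight.
Context {R : realType}.

(** This is c (1 - t)^M + k t times the derivative of (1 - t)^M. The affine factor k l + c behind it
    is the normalisation m + 1 read along a diagonal. *)
Definition binomial_weight (k c M : nat) (t : R) : R :=
  c%:R * (1 - t) ^+ M - (k * M)%:R * t * (1 - t) ^+ M.-1.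

Lemma alternating_binomial M (t : R) :
  \sum_(l < M.+1) ((-1) ^+ l *+ 'C(M, l)) * t ^+ l = (1 - t) ^+ M.
Proof.
rewrite exprDn; apply: eq_bigr => l _.
by rewrite expr1n mul1r [in RHS]exprNn mulrnAl.
Qed.

Lemma binomial_weightE k c M (t : R) :
  \sum_(l < M.+1) ((-1) ^+ l *+ 'C(M, l)) * ((k * l + c)%:R * t ^+ l) = binomial_weight k c M t.
Proof.
transitivity (k%:R * (\sum_(l < M.+1) ((-1) ^+ l *+ 'C(M, l)) * (l%:R * t ^+ l)) +
   c%:R * \sum_(l < M.+1) ((-1) ^+ l *+ 'C(M, l)) * t ^+ l).
  rewrite !mulr_sumr -big_split; apply: eq_bigr => l _.
  by rewrite /= natrD natrM; ring.
rewrite alternating_binomial /binomial_weight addrC natrM -!mulrA -mulrN; congr (_ + _ * _).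
case: M => [|M]; first by rewrite big_ord_recl big_ord0 !mul0r mulr0 addr0 oppr0.
rewrite big_ord_recl mul0r mulr0 add0r -alternating_binomial /= !mulr_sumr -sumrN.
apply: eq_bigr => l _; rewrite /bump /= add1n.
have : l.+1%:R * 'C(M.+1, l.+1)%:R = M.+1%:R * 'C(M, l)%:R :> R by rewrite -!natrM mul_bin_diag.
move=> e; rewrite -(mulr_natr _ 'C(M.+1, l.+1)) -(mulr_natr _ 'C(M, l)) !exprS.
transitivity (- ((-1) ^+ l * t * t ^+ l) * (l.+1%:R * 'C(M.+1, l.+1)%:R)); first by ring.
by rewrite e; ring.
Qed.

(** In m + 1 trials of probability t, exactly one success is no more likely than at least one; the
    induction is run on this sharper bound. *)
Lemma natmul_onem_le1 m (t : R) : 0 <= t <= 1 -> m.+1%:R * t * (1 - t) ^+ m <= 1.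
Proof.
move=> /andP[t0 t1]; suff : m.+1%:R * t * (1 - t) ^+ m <= 1 - (1 - t) ^+ m.+1.
  by have : 0 <= (1 - t) ^+ m.+1 by [rewrite exprn_ge0// subr_ge0]; lra.
elim: m => [|m IH]; first by rewrite expr0 expr1; lra.
have u0 : 0 <= 1 - t by rewrite subr_ge0.
have := ler_wpM2l u0 IH; rewrite -[m.+2%:R]natr1.
have : 0 <= t * (1 - (1 - t) ^+ m.+1).
  by rewrite mulr_ge0// subr_ge0 exprn_ile1// gerBl.
rewrite [(1 - t) ^+ m.+2]exprS; have := exprS (1 - t) m.
move: ((1 - t) ^+ m.+1) ((1 - t) ^+ m) => x y -> h1 h2.
have -> : (m.+1%:R + 1) * t * ((1 - t) * y) = (1 - t) * (m.+1%:R * t * y) + t * ((1 - t) * y) by ring.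
by lra.
Qed.

Lemma binomial_weight_bound k c M (t : R) : 0 <= t <= 1 ->
  `|binomial_weight k c M t| <= (k + c)%:R.
Proof.
move=> t01; case/andP: (t01) => t0 t1; have u0 : 0 <= 1 - t by rewrite subr_ge0.
rewrite /binomial_weight natrD addrC (le_trans (ler_normD _ _))// lerD//.
  rewrite normrN ger0_norm; last by rewrite !mulr_ge0// exprn_ge0.
  rewrite natrM -!mulrA ler_piMr//; case: M => [|m]; first by rewrite mul0r.
  by rewrite mulrA natmul_onem_le1.
rewrite ger0_norm; last by rewrite mulr_ge0// exprn_ge0.
by rewrite ler_piMr// exprn_ile1// gerBl.
Qed.

Lemma binomial_weight_cvg0 k c (t : R) : 0 < t <= 1 ->
  (fun M => binomial_weight k c M t) @ \oo --> (0 : R).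
Proof.
move=> /andP[t0 t1]; have q01 : 0 <= 1 - t < 1 by rewrite subr_ge0 t1 gtrBl.
rewrite -[X in _ --> X](_ : c%:R * 0 - k%:R * t * 0 = 0); last by rewrite !mulr0 subr0.
apply: cvgB; first by apply: cvgM; [exact: cvg_cst|apply: cvg_expr; rewrite ger0_norm; case/andP: q01].
rewrite (_ : (fun M => _) = fun M => k%:R * t * (M%:R * (1 - t) ^+ M.-1)); last first.
  by apply/funext => M; rewrite natrM; ring.
apply: cvgM; first exact: cvg_cst.
by rewrite -cvg_shiftS; exact: natmul_exprn_cvg0.
Qed.

End BinomialWeight.

(** * Moments and regularity along the diagonals of a bounded symbol *)

Section Diagonals.
Context {R : realType}.
Notation leb := (@lebesgue_measure R).
Notation T := (measurableTypeR R * measurableTypeR R)%type.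
Notation rct := (@polar_rect R : set T).
Notation mu := (@leb2 R).
Implicit Types (f : R[i] -> R[i]) (psi : T -> R[i]).

Let mrct : measurable rct := measurable_polar_rect.

Lemma measurable_radial (g : R -> R) : continuous g -> measurable_fun rct (fun p : T => g p.1).
Proof.
by move=> cg; apply: (measurableT_comp _ (@measurable_fst_T R rct)); exact: continuous_measurable_fun.
Qed.

(** Dominated convergence for the binomial weights, which are bounded by k + c and tend to 0 for t >
    0. At t = 0 the weight is c for every M, and the last hypothesis supplies the convergence
    there. *)
Lemma vanishing_moments psi (C : R) k c : cmeas rct psi ->
  (forall p, rct p -> Normc.normc (psi p) <= C) ->
  (forall p, rct p -> p.1 = 0 -> c%:R * psi p = 0) ->
  vanishing (fun l => (k * l + c)%:R * cint mu rct (fun p => psi p * ((p.1 ^+ 4) ^+ l)%:C)).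
Proof.
move=> mpsi hC h0; rewrite /vanishing.
have t01 p : rct p -> 0 <= p.1 ^+ 4 <= 1.
  by move=> /polar_rectP[/andP[p0 p1] _]; rewrite exprn_ge0//= exprn_ile1// ltW.
have C0 p : rct p -> 0 <= C by move=> /hC; exact: le_trans (normc_ge0 _).
have ii l : cintegrable mu rct (fun p => psi p * ((p.1 ^+ 4) ^+ l)%:C).
  apply: (@cintegrable_bounded _ _ R mu _ mrct _ C); first exact: leb2_polar_rect_lty.
    apply: cmeasM => //; apply: cmeas_real; apply: (@measurable_radial (fun r => (r ^+ 4) ^+ l)) => r.
    by under eq_fun do rewrite -exprM; exact: exprn_continuous.
  move=> p rp; have /andP[a0 a1] := t01 p rp.
  have z0 : 0 <= (p.1 ^+ 4) ^+ l by rewrite exprn_ge0.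
  rewrite Normc.normcM normcR (ger0_norm z0); apply: le_trans (hC p rp).
  by rewrite ler_piMr ?normc_ge0// exprn_ile1.
rewrite (_ : (fun M => _) = fun M => cint mu rct (fun p => psi p * (binomial_weight k c M (p.1 ^+ 4))%:C)); last first.
  apply/funext => M; rewrite -[RHS](@eq_cint _ _ R mu rct
    (fun p => \sum_(l < M.+1) (((-1) ^+ l *+ 'C(M, l)) * (k * l + c)%:R) * (psi p * ((p.1 ^+ 4) ^+ l)%:C))); last first.
    move=> p _; rewrite -binomial_weightE raddf_sum mulr_sumr; apply: eq_bigr => l _.
    have e : ((-1) ^+ l *+ 'C(M, l))%:C = (-1) ^+ l *+ 'C(M, l) :> R[i].
      by rewrite rmorphMn rmorphXn rmorphN1.
    by rewrite /= !complexRM e rmorph_nat; ring.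
  rewrite cint_sum//; last by move=> l; exact: cintegrableZ.
  by apply: eq_bigr => l _; rewrite cintZ// mulrA.
rewrite -(@cint0 _ _ R mu rct).
apply: (@cint_dominated _ _ R mu _ mrct _ _ (fun=> C * (k + c)%:R)).
- move=> M; apply: cmeasM => //; apply: cmeas_real.
  apply: (@measurable_radial (fun r => binomial_weight k c M (r ^+ 4))) => r.
  have cu n : {for r, continuous (fun r : R => (1 - r ^+ 4) ^+ n)}.
    apply: (@continuous_comp _ _ _ (fun r : R => 1 - r ^+ 4) (fun x => x ^+ n)); last exact: exprn_continuous.
    by apply: continuousB; [exact: cst_continuous|exact: exprn_continuous].
  apply: (@continuousB _ _ _ (fun r : R => c%:R * (1 - r ^+ 4) ^+ M)
      (fun r : R => (k * M)%:R * r ^+ 4 * (1 - r ^+ 4) ^+ M.-1)).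
    by apply: continuousM; [exact: cst_continuous|exact: cu].
  apply: continuousM; last exact: cu.
  by apply: continuousM; [exact: cst_continuous|exact: exprn_continuous].
- exact: cmeas_cst.
- apply: measurable_bounded_integrable => //; first exact: leb2_polar_rect_lty.
  by exists `|C * (k + c)%:R|; split; [exact: num_real|move=> y jy x _; exact: ltW].
- move=> p rp; have [p0|p0] := eqVneq p.1 0.
    rewrite (_ : (fun M => _) = fun=> 0); first exact: ccvg_cst.
    apply/funext => M; rewrite /binomial_weight p0 expr0n /= mulr0 mul0r !subr0 expr1n mulr1.
    by rewrite rmorph_nat mulrC h0.
  have /andP[a0 a1] := t01 p rp.
  have := binomial_weight_cvg0 k c (_ : 0 < p.1 ^+ 4 <= 1).
  rewrite a1 andbT lt_def a0 andbT expf_neq0// => /(_ isT) h.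
  rewrite -(mulr0 (psi p)); apply: ccvgZ.
  by apply: ReIm_ccvg => //=; exact: cvg_cst.
- move=> M p rp; rewrite Normc.normcM normcR ler_pM ?normc_ge0 ?hC//.
  exact: binomial_weight_bound (t01 _ rp).
Qed.

Definition weighted_entry f n m : R[i] := m.+1%:R * matrix_entry f n m.

Lemma mono_conj_shift j n m (p : T) : rct p ->
  mono (j + n) p * conjc (mono (j + m) p) = mono n p * conjc (mono m p) * (p.1 ^+ 2 ^+ j)%:C.
Proof.
move=> /polar_rectP[/andP[p0 _] _].
have e : polar p * conjc (polar p) = (p.1 ^+ 2)%:C by rewrite mul_conj_normc normc_polar_pt.
by rewrite /mono !exprD conjcM !conjcX mulrACA -exprMn e -rmorphXn mulrC.
Qed.

Lemma matrix_entry_shift f l n m :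
  matrix_entry f (l.*2 + n) (l.*2 + m) =
  cint mu rct (fun p => f (polar p) * (mono n p * conjc (mono m p)) * (p.1 / pi)%:C * ((p.1 ^+ 4) ^+ l)%:C).
Proof.
apply: eq_cint => p rp; rewrite -(mulrA (f (polar p))) mono_conj_shift// -!exprM.
have -> : (2 * l.*2 = 4 * l)%N by lia.
ring.
Qed.

Section Symbol.
Variable f : R[i] -> R[i].
Hypotheses (mf : disk_measurable f) (bf : bounded_disk f).

Lemma cmeas_matrix_entry n m : cmeas rct (fun p => f (polar p) * (mono n p * conjc (mono m p)) * (p.1 / pi)%:C).
Proof.
apply: pcmeasW; apply: cmeasM; first exact: cmeas_polar.
by apply: cmeasM; [|apply: cmeas_conj]; exact: cmeas_mono.
Qed.

Lemma vanishing_matrix_entry k c n m :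
  vanishing (fun l => (k * l + c)%:R * matrix_entry f (l.*2 + n) (l.*2 + m)).
Proof.
have [M fM] := bounded_diskP bf.
under eq_fun do rewrite matrix_entry_shift.
apply: (@vanishing_moments _ M); first exact: cmeas_matrix_entry.
  move=> p rp; rewrite !Normc.normcM normc_conj normcR.
  rewrite -[leRHS]mulr1 ler_pM ?mulr_ge0 ?normc_ge0//.
    rewrite -[leRHS]mulr1 ler_pM ?mulr_ge0 ?normc_ge0 ?fM//.
    by rewrite mulr_ile1 ?normc_ge0// normc_mono_le1.
  by rewrite ger0_norm ?polar_weight_le1 ?polar_weight_ge0.
by move=> p rp p0; rewrite p0 mul0r !mulr0.
Qed.

(** The borderline case K = 3: z^(2 l) conj z ^(2 l - 1) r equals r^(4 l) e^(i theta), so no power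
    of r is left to make the density vanish at 0. The weight 2 l has c = 0, which takes care of r =
    0. *)
Lemma vanishing_subdiagonal :
  vanishing (fun l => if l == 0 then 0 else l.*2%:R * matrix_entry f l.*2 (l.*2 - 1)).
Proof.
have [M fM] := bounded_diskP bf.
have h : vanishing (fun l => (2 * l + 0)%:R *
    cint mu rct (fun p => f (polar p) * cis p.2 * (pi^-1)%:C * ((p.1 ^+ 4) ^+ l)%:C)).
  apply: (@vanishing_moments _ (M * `|pi^-1|)); last by move=> p _ _; rewrite mul0r.
    apply: cmeasM; last exact: cmeas_cst.
    apply: cmeasM; first exact: cmeas_polar.
    have := @cmeas_cis R 1 rct; congr cmeas; apply/funext => p.
    by rewrite mul1r.
  by move=> p rp; rewrite !Normc.normcM normc_cis mulr1 normcR ler_wpM2r// fM.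
apply: vanishing_eq h => l; rewrite addn0 mul2n; case: eqP => [->|/eqP l0]; first by rewrite mul0r.
congr (_ * _); apply: eq_cint => p rp.
have e : (l.*2 = l.*2 - 1 + 1)%N by lia.
rewrite [in RHS]e addnK -[in RHS](mulrA (f (polar p)) (mono _ p)).
have := mono_conj_shift (l.*2 - 1) 1 0 rp; rewrite addn0 => ->.
rewrite {1}/mono expr1 /mono expr0 /polar -exprM -exprM.
have -> : (4 * l = (2 * (l.*2 - 1)).+2)%N by lia.
by rewrite !exprS !complexRM conjc1; ring.
Qed.

Lemma weighted_entry_diag_vanishing : diag_vanishing (weighted_entry f).
Proof.
move=> K K3; split; last first.
  apply: vanishing_eq (vanishing_matrix_entry 2 K.-1 2 (K - 2)) => l.
  rewrite /weighted_entry addn2 addnBA; last by lia.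
  by congr (_%:R * _); lia.
have [->|K4] := eqVneq K 3.
  apply: vanishing_eq vanishing_subdiagonal => l; rewrite andbT; case: eqP => // /eqP l0.
  rewrite /weighted_entry; have -> : (l.*2 + 3 - 4 = l.*2 - 1)%N by lia.
  by congr (_%:R * _); lia.
apply: vanishing_eq (vanishing_matrix_entry 2 (K - 3) 0 (K - 4)) => l.
rewrite andbF /weighted_entry addn0; have -> : (l.*2 + (K - 4) = l.*2 + K - 4)%N by lia.
by congr (_%:R * _); lia.
Qed.

Lemma integral_radial_exprn j : mu.-integrable rct (EFin \o (fun p : T => p.1 ^+ j)) /\
  \int[mu]_(p in rct) (p.1 ^+ j) = 2 * pi / j.+1%:R.
Proof.
have ij : mu.-integrable rct (EFin \o (fun p : T => p.1 ^+ j)).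
  apply: measurable_bounded_integrable => //; first exact: leb2_polar_rect_lty.
    by apply: (@measurable_radial (fun r => r ^+ j)) => r; exact: exprn_continuous.
  exists 1; split => // y y1 p /polar_rectP[/andP[p0 p1] _] /=.
  by rewrite (le_trans _ (ltW y1))// ger0_norm ?exprn_ge0// exprn_ile1// ltW.
split => //.
have ic r : leb.-integrable (`[0, 2 * pi[%classic : set R) (EFin \o (fun=> r ^+ j : R)).
  apply: measurable_bounded_integrable => //; first exact: leb_circle_lty.
  by exists `|r ^+ j|; split; [exact: num_real|move=> y jy x _; exact: ltW].
have [_ ->] := Fubini_rect ij (fun r _ => ic r).
have E r : \int[leb]_(t in `[0, 2 * pi[) (r ^+ j : R) = 2 * pi * r ^+ j.
  by rewrite Rintegral_cst//= leb_circle mulrC.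
under eq_Rintegral do rewrite E.
rewrite RintegralZl// ?integral_exprn//.
have c : leb.-integrable `[0, 1] (EFin \o (fun r : R => r ^+ j)).
  apply: continuous_compact_integrable; first exact: segment_compact.
  by apply: continuous_subspaceT => x; exact: exprn_continuous.
by apply: integrableS c => //; apply: subset_itvl; rewrite bnd_simp.
Qed.

Lemma cint_le_integral psi (g : T -> R) : cmeas rct psi -> mu.-integrable rct (EFin \o g) ->
  (forall p, rct p -> Normc.normc (psi p) <= g p) ->
  Normc.normc (cint mu rct psi) <= \int[mu]_(p in rct) g p.
Proof.
move=> mpsi ig h; have ipsi : cintegrable mu rct psi by exact: cintegrable_le ig h.
rewrite (le_trans (normc_cint mrct ipsi))//; apply: le_Rintegral => //.
exact: integrable_normc.
Qed.

(** Here a = n + m + 1 and b = m + 1, y is the modulus of an entry and z that of a difference of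
    neighbours; y a contributes 2 M and b z a contributes 4 M. *)
Lemma regular_arith (M a b x y z : R) : 0 <= M -> 1 <= a -> 0 <= b <= a -> x <= y + b * z ->
  y <= 2 * M / (a + 3) -> z <= 2 * M / (a + 1) - 2 * M / (a + 3) -> x * a <= 6 * M.
Proof.
move=> M0 a1 /andP[b0 ba] h3 h1 h2.
have a3 : 0 < a + 3 by lra.
have a2 : 0 < a + 1 by lra.
have a0 : 0 <= a by lra.
have k1 : y * a <= 2 * M.
  apply: le_trans (ler_wpM2r a0 h1) _.
  by rewrite mulrAC ler_pdivrMr// ler_wpM2l ?mulr_ge0//; lra.
have k2 : z * (a * b) <= 4 * M.
  have ab : 0 <= a * b by rewrite mulr_ge0.
  apply: le_trans (ler_wpM2r ab h2) _.
  have -> : 2 * M / (a + 1) - 2 * M / (a + 3) = 4 * M / ((a + 1) * (a + 3)).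
    by field; rewrite !gt_eqF.
  rewrite mulrAC ler_pdivrMr ?mulr_gt0// ler_wpM2l ?mulr_ge0//.
  by rewrite ler_pM//; lra.
have := ler_wpM2r a0 h3; rewrite mulrDl.
have -> : b * z * a = z * (a * b) by ring.
by lra.
Qed.

(** For neighbouring entries E and E' write (m + 2) E' - (m + 1) E = E' - (m + 1) (E - E'). The
    integrand of E - E' carries the factor 1 - r^2, which gains one order in n + m and compensates m
    + 1. *)
Lemma weighted_entry_diag_regular : diag_regular (weighted_entry f).
Proof.
have [M fM] := bounded_diskP bf.
have M0 : 0 <= M.
  have : rct (0, 0) by split; rewrite /= in_itv /= ?lexx ?ltr01 ?mulr_gt0// pi_gt0.
  by move=> /fM; exact: le_trans (normc_ge0 _).
have p0 : pi != 0 :> R by rewrite gt_eqF// pi_gt0.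
have bnd n m p : rct p ->
    Normc.normc (f (polar p) * (mono n p * conjc (mono m p)) * (p.1 / pi)%:C) <= M / pi * p.1 ^+ (n + m).+1.
  move=> rp; have /polar_rectP[/andP[r0 _] _] := rp.
  rewrite !Normc.normcM normc_conj normcR /mono !normcX normc_polar_pt//.
  rewrite ger0_norm ?polar_weight_ge0// [leRHS](_ : _ = M * (p.1 ^+ n * p.1 ^+ m) * (p.1 / pi)).
    rewrite ler_wpM2r ?polar_weight_ge0// ler_wpM2r ?fM//.
    by rewrite mulr_ge0// exprn_ge0.
  by move: (pi^-1 : R) (p.1 : R) => q r; rewrite exprS exprD; ring.
have entryE n m : matrix_entry f n m =
    cint mu rct (fun p => f (polar p) * (mono n p * conjc (mono m p)) * (p.1 / pi)%:C).
  by apply: eq_cint => p _; rewrite mulrA.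
have int1 j : mu.-integrable rct (EFin \o (fun p : T => M / pi * p.1 ^+ j)).
  by have [ij _] := integral_radial_exprn j; exact: (integrableZl mrct (M / pi) ij).
have e1 j : \int[mu]_(p in rct) (M / pi * p.1 ^+ j) = 2 * M / j.+1%:R.
  have [ij e] := integral_radial_exprn j; rewrite RintegralZl// e.
  have aux (q a : R) : q != 0 -> M / q * (2 * q / a) = 2 * M / a.
    by move=> q0; rewrite mulrA -[M / q * _]mulrA [q^-1 * _]mulrCA mulVf// mulr1 [M * 2]mulrC.
  exact: aux p0.
have b1 n m : Normc.normc (matrix_entry f n m) <= 2 * M / (n + m).+2%:R.
  by rewrite entryE -e1; apply: cint_le_integral (bnd n m) => //; exact: cmeas_matrix_entry.
have b2 n m : Normc.normc (matrix_entry f n m - matrix_entry f n.+1 m.+1) <=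
    2 * M / (n + m).+2%:R - 2 * M / (n + m).+4%:R.
  have ii k l : cintegrable mu rct (fun p => f (polar p) * (mono k p * conjc (mono l p)) * (p.1 / pi)%:C).
    by apply: cintegrable_le (int1 (k + l).+1) (bnd k l) => //; exact: cmeas_matrix_entry.
  rewrite !entryE -cintB// -!e1 -RintegralB//.
  apply: cint_le_integral.
  - by apply: cmeasB; exact: cmeas_matrix_entry.
  - exact: (integrableB mrct (int1 _) (int1 _)).
  - move=> p rp; have := mono_conj_shift 1 n m rp; rewrite !add1n => ->.
    have /polar_rectP[/andP[r0 r1] _] := rp.
    rewrite [X in Normc.normc X](_ : _ = f (polar p) * (mono n p * conjc (mono m p)) * (p.1 / pi)%:C *
       (1 - p.1 ^+ 2)%:C); last by rewrite expr1 rmorphB rmorph1 /=; ring.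
    have r2 : 0 <= 1 - p.1 ^+ 2 by rewrite subr_ge0 exprn_ile1// ltW.
    rewrite Normc.normcM normcR (ger0_norm r2).
    rewrite [leRHS](_ : _ = M / pi * p.1 ^+ (n + m).+1 * (1 - p.1 ^+ 2)); last by rewrite !exprS; ring.
    by rewrite ler_wpM2r// bnd.
exists (6 * M) => n m; rewrite /weighted_entry.
rewrite [X in Normc.normc X](_ : _ = matrix_entry f n.+1 m.+1 -
  m.+1%:R * (matrix_entry f n m - matrix_entry f n.+1 m.+1)); last by rewrite -[m.+2%:R]natr1; ring.
have h1 := b1 n.+1 m.+1; have h2 := b2 n m.
rewrite addSn addnS in h1.
have := normc_triangleB (matrix_entry f n.+1 m.+1) (m.+1%:R * (matrix_entry f n m - matrix_entry f n.+1 m.+1)).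
rewrite Normc.normcM normcn.
have ea2 : (n + m).+2%:R = (n + m).+1%:R + 1 :> R by rewrite natr1.
have ea4 : (n + m).+4%:R = (n + m).+1%:R + 3 :> R by rewrite -natrD addn3.
rewrite ea4 in h1; rewrite ea2 ea4 in h2.
move=> h; apply: regular_arith M0 _ _ h h1 h2; first by rewrite ler1n.
by rewrite ler0n ler_nat ltnS leq_addl.
Qed.

End Symbol.
End Diagonals.

(** * Proof of the theorem *)

Section Symbols.
Context {R : realType}.
Notation leb := (@lebesgue_measure R).
Notation T := (measurableTypeR R * measurableTypeR R)%type.
Notation rct := (@polar_rect R : set T).
Notation mu := (@leb2 R).
Implicit Types (f g h u : R[i] -> R[i]) (G : T -> R[i]) (a : R -> R[i]).

Let mrct : measurable rct := measurable_polar_rect.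

Lemma cint_cis_eq0 (d : int) : d != 0 ->
  cint leb `[0, 2 * pi[ (fun t : R => cis (d%:~R * t)) = 0.
Proof.
have pos (n : nat) : (0 < n)%N -> cintegrable leb `[0, 2 * pi[ (fun t : R => cis (n%:R * t)) /\
    cint leb `[0, 2 * pi[ (fun t : R => cis (n%:R * t)) = 0.
  move=> n0; have dX (w : R[i]) : Normc.normc w = 1 -> cderivable (fun w => w ^+ n) w.
    by move=> _; apply: cderivableX; exact: cderivable_id.
  have [i1 e1] := circle_int_co (@ltr01 R) dX.
  have E t : (1%:C * cis t) ^+ n = cis (n%:R * t) :> R[i] by rewrite mul1r cisX.
  split; first by apply: eq_cintegrable i1 => //.
  transitivity (cint leb `[0, 2 * pi[ (fun t : R => (1%:C * cis t) ^+ n)).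
    by apply: eq_cint => t _; rewrite E.
  rewrite e1; transitivity (cint leb `[0, 2 * pi] (fun t : R => cis t ^+ n)).
    by apply: eq_cint => t _; rewrite mul1r.
  exact: cint_cisX_eq0.
case: d => [n|n] d0; first by apply: (pos n _).2; rewrite lt0n.
have [i1 e1] := pos n.+1 isT.
transitivity (conjc (cint leb `[0, 2 * pi[ (fun t : R => cis (n.+1%:R * t)))); last by rewrite e1 conjc0.
rewrite -cint_conj//; apply: eq_cint => t _; rewrite -cisN NegzE mulrNz mulNr.
by congr (cis (- (_ * t))).
Qed.

Lemma fourier_slice_angular_eq0 k l a r : k != l -> fourier_slice (angular l a) k r = 0.
Proof.
move=> kl; have lk : l - k != 0 by rewrite subr_eq0 eq_sym.
transitivity (a r * cint leb `[0, 2 * pi[ (fun t => cis ((l - k)%:~R * t))); last first.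
  by rewrite cint_cis_eq0 ?mulr0.
have ii : cintegrable leb `[0, 2 * pi[ (fun t : R => cis ((l - k)%:~R * t)).
  have h0 : 0 <= (0 : R) < 1 by rewrite lexx ltr01.
  have hM p : rct p -> Normc.normc (1 : R[i]) <= 1 by rewrite (_ : 1 = 1%:R :> R[i])// normcn.
  have := slice_integrable (k - l) h0 (cmeas_cst rct (1 : R[i])) hM.
  apply: eq_cintegrable => // t _.
  by rewrite mul1r -cisN -mulNr -mulrNz opprB.
rewrite -cintZ//; apply: eq_cint => t _.
by rewrite /angular -cisN /= mulrAC -cisD -mulNr -mulrDl -mulrNz -intrD mulrC.
Qed.

Definition rpow (n : nat) : R -> R[i] := fun r => (r ^+ n)%:C.

Lemma L2_radial_rpow n : L2_radial (rpow n).
Proof.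
have m : measurable_fun (`[0, 1]%classic : set R) (fun r : R => r ^+ n).
  by apply: measurable_funTS; apply: continuous_measurable_fun => r; exact: exprn_continuous.
split; [exact: m|exact: measurable_cst|].
have c : leb.-integrable `[0, 1] (EFin \o (fun r : R => Normc.normc (rpow n r) ^+ 2 * r)).
  have : leb.-integrable `[0, 1] (EFin \o (fun r : R => r ^+ (n * 2).+1)).
    apply: continuous_compact_integrable; first exact: segment_compact.
    by apply: continuous_subspaceT => x; exact: exprn_continuous.
  apply: eq_integrable => // r /set_mem; rewrite /= in_itv /= => /andP[r0 _].
  by rewrite /rpow normcR ger0_norm ?exprn_ge0// -exprM exprSr.
by have /integrableP[_] := c; apply: le_lt_trans; rewrite -[leLHS]gee0_abs ?le_abse_integral//;
  [have /integrableP[] := c|apply: integral_ge0 => r; rewrite /= in_itv /= => /andP[r0 _];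
   rewrite lee_fin mulr_ge0// exprn_ge0// normc_ge0].
Qed.

Lemma matrix_entry_angular f n m :
  matrix_entry f n m = inner (fun p => f (polar p)) (angular (m%:Z - n%:Z) (rpow (n + m))).
Proof.
apply: eq_cint => p _; congr (_ * _); rewrite -mulrA; congr (_ * _).
have cR (x : R) : conjc x%:C = x%:C by rewrite /conjc /= oppr0.
have cX (x : R) i : x%:C ^+ i = (x ^+ i)%:C by rewrite rmorphXn.
rewrite /mono /polar !exprMn !cisX !cX /angular /rpow !conjcM -!cisN !cR.
rewrite mulrACA -complexRM -exprD -cisD mulrC; congr (cis _ * _).
by rewrite intrB; ring.
Qed.

(** The partial sums of the decomposition converge to f in norm, so it suffices that G be orthogonal
    to each angular piece. *)
Lemma inner_decomposition_eq0 f fk G M : pL2 (fun p => f (polar p)) -> polar_decomposition f fk ->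
  cmeas rct G -> (forall p, rct p -> Normc.normc (G p) <= M) ->
  (forall k, {ae leb, forall r : R, (`[0, 1[%classic : set R) r ->
     fourier_slice G k r * conjc (fk k r) = 0}) ->
  inner (fun p => f (polar p)) G = 0.
Proof.
move=> Lf [rfk cfk] mG GM h.
have LS n := pL2_partial_sum n rfk.
have LG := pL2_bounded mG GM.
have c : ccvg (fun n => inner (@polar_partial_sum R fk n) G) (inner (fun p => f (polar p)) G).
  apply: inner_ccvg => //.
  have e n : polar_sqnorm (fun p => f (polar p) - polar_partial_sum fk n p) =
      (psq (fun p => polar_partial_sum fk n p - f (polar p)))%:E.
    rewrite polar_sqnormE; last exact: pL2B.
    by congr (_%:E); apply: eq_Rintegral => p _; rewrite normc_dist.
  by move: cfk; under eq_fun do rewrite e; move/fine_cvgP => [].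
apply: ccvg_unique c _; rewrite (_ : (fun n => _) = fun=> 0); first exact: ccvg_cst.
apply/funext => n; have La k := pL2_angular k (rfk k).
rewrite /polar_partial_sum (@inner_suml R _ _ (fun (j : 'I_n.*2.+1) p =>
  angular (Posz j - Posz n)%R (fk (Posz j - Posz n)%R) p))//.
rewrite big1// => j _; rewrite innerC// (inner_angular_eq0 mG GM (rfk _) (h _)).
by rewrite conjc0.
Qed.

Lemma matrix_entry_above f N n m : disk_measurable f -> bounded_disk f -> truncated_above N f ->
  (n + N < m)%N -> matrix_entry f n m = 0.
Proof.
move=> mf bf [fk [dec z]] nm; have Lf : pL2 (fun p => f (polar p)).
  have := pL2_bounded_mul mf bf (pL2_cst 1); apply: eq_pL2 => p _; exact: mulr1.
rewrite matrix_entry_angular.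
apply: (inner_decomposition_eq0 (M := 1) Lf dec).
- exact: cmeas_angular (L2_radial_rpow _).
- move=> p /polar_rectP[/andP[p0 p1] _]; rewrite /angular Normc.normcM normc_cis mul1r normcR.
  by rewrite ger0_norm ?exprn_ge0// exprn_ile1// ltW.
(* Only the slice of index m - n of the angular function is nonzero, and there the radial part of f
   vanishes since m - n > N. *)
- move=> k; have [->|kn] := eqVneq k (m%:Z - n%:Z); last first.
    by apply/aeW => r _; rewrite fourier_slice_angular_eq0// mul0r.
  have Nk : Posz N < m%:Z - n%:Z by lia.
  have [X [mX X0 sub]] := z _ Nk; exists X; split => // r /= /not_implyP[r01 nr].
  apply: sub => /= e; apply: nr; rewrite e ?conjc0 ?mulr0//.
  by move: r01; rewrite in_itv /= => /andP[-> /ltW ->].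
Qed.

Lemma fourier_slice_ae0 f : disk_measurable f -> bounded_disk f ->
  (forall n m, matrix_entry f n m = 0) ->
  forall k, {ae leb, forall r : R, (`[0, 1[%classic : set R) r ->
    0 < r -> fourier_slice (fun p => f (polar p)) k r = 0}.
Proof.
move=> mf /bounded_diskP[M fM] e0 k; have mg := cmeas_polar mf.
(* Any entry on the diagonal k; shifting both indices by j gives the moments in r^(2 j) of one fixed
   function. It carries a positive power of r, whence the restriction to r > 0. *)
have [n0 [m0 kE]] : exists n0 m0 : nat, k = m0%:Z - n0%:Z.
  by case: (k) => i; [exists 0%N, i|exists i.+1, 0%N]; lia.
have w j : cintegrable leb `[0, 1[ (fun r => (r / pi)%:C * conjc (rpow j r) * fourier_slice (fun p => f (polar p)) k r) /\
    inner (fun p => f (polar p)) (angular k (rpow j)) =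
    cint leb `[0, 1[ (fun r => (r / pi)%:C * conjc (rpow j r) * fourier_slice (fun p => f (polar p)) k r).
  exact: inner_angular mg fM (L2_radial_rpow j).
have cR (x : R) : conjc x%:C = x%:C by rewrite /conjc /= oppr0.
have := moments_eq0 (w (n0 + m0)%N).1.
have mom j : cint leb `[0, 1[ (fun r => ((r ^+ 2) ^+ j)%:C *
    ((r / pi)%:C * conjc (rpow (n0 + m0) r) * fourier_slice (fun p => f (polar p)) k r)) = 0.
  rewrite -(e0 (j + n0)%N (j + m0)%N) matrix_entry_angular.
  have -> : (j + m0)%:Z - (j + n0)%:Z = k by rewrite kE; lia.
  rewrite (w _).2; apply: eq_cint => r _; rewrite /rpow !cR.
  have -> : (j + n0 + (j + m0) = 2 * j + (n0 + m0))%N by lia.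
  by rewrite (exprD r (2 * j)) exprM complexRM; ring.
move=> /(_ mom) [X [mX X0 sub]]; exists X; split => // r /= /not_implyP[r01 /not_implyP[r0 nr]].
apply: sub => /= e; apply: nr.
have e' : (r / pi)%:C * (r ^+ (n0 + m0))%:C * fourier_slice (fun p => f (polar p)) k r = 0.
  by rewrite -(cR (r ^+ (n0 + m0))); exact: e r01.
move/eqP: e'.
have cN0 (x : R) : x != 0 -> x%:C != 0 :> R[i] by move=> x0; rewrite eq_complex /= negb_and x0.
rewrite !mulf_eq0 => /orP[/orP[]|/eqP//] /eqP h; exfalso.
  have := cN0 (r / pi); rewrite h eqxx mulf_neq0 ?gt_eqF ?invr_gt0 ?pi_gt0//.
  by move=> /(_ isT).
have := cN0 (r ^+ (n0 + m0)); rewrite h eqxx expf_neq0 ?gt_eqF//.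
by move=> /(_ isT).
Qed.

Lemma psq_ae_eq0 G : cmeas rct G -> (polar_sqnorm G < +oo)%E -> psq G = 0 ->
  {ae mu, forall p, rct p -> G p = 0}.
Proof.
move=> mG LG G0; have LG' : pL2 G by split.
pose sq (p : T) : \bar R := (Normc.normc (G p) ^+ 2 * p.1 / pi)%:E.
have m : measurable_fun rct sq by apply/measurable_EFinP; exact: measurable_sq.
have i0 : (\int[mu]_(p in rct) `|sq p| = 0)%E.
  transitivity (polar_sqnorm G); last by rewrite polar_sqnormE// G0.
  by apply: eq_integral => p /set_mem rp; rewrite gee0_abs// lee_fin sq_ge0.
have h1 := (ae_eq_integral_abs mu mrct m).1 i0.
(* At r = 0 the density vanishes and the norm says nothing about G; this segment is null. *)
have mz : measurable ([set 0] `*` `[0, 2 * pi[%classic : set T) by apply: measurableX.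
have h2 : mu.-negligible ([set 0] `*` `[0, 2 * pi[%classic : set T).
  exists ([set 0] `*` `[0, 2 * pi[%classic); split => //.
  transitivity (leb [set 0%R] * leb `[0%R, (2 * pi)%R[%classic)%E.
    exact: (@product_measure1E _ _ _ _ _ leb leb).
  by rewrite lebesgue_measure_set1 mul0e.
apply: negligibleS (negligibleU h1 h2) => p /= np.
have [rp Gp] : rct p /\ G p <> 0 by move/not_implyP : np.
have [p0|p0] := eqVneq p.1 0; [right|left].
  by case: rp => _ ?; split.
move=> h; have /eqP := h rp; rewrite /= eqe !mulf_eq0 (negbTE p0) invr_eq0 orbb orbF.
by move=> /orP[/eqP/Normc.eq0_normc//|/eqP pi0]; have := pi_gt0 R; rewrite pi0 ltxx.
Qed.

Lemma matrix_entry_subZ f g c n m : disk_measurable f -> bounded_disk f ->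
  disk_measurable g -> bounded_disk g ->
  matrix_entry (fun z => f z - c * g z) n m = matrix_entry f n m - c * matrix_entry g n m.
Proof.
move=> mf bf mg bg; have Lf := pL2_bounded_mul mf bf (pL2_mono n).
have Lg := pL2_bounded_mul mg bg (pL2_mono n).
rewrite /matrix_entry -innerZl//; last exact: pL2_mono.
rewrite -innerBl//; [|exact: pL2Z|exact: pL2_mono].
by apply: eq_inner => // p _; ring.
Qed.

Lemma disk_measurable_subZ f g c : disk_measurable f -> disk_measurable g ->
  disk_measurable (fun z => f z - c * g z).
Proof.
move=> mf mg.
suff : cmeas cart_disk (fun p : T => f (p.1 +i* p.2) - c * g (p.1 +i* p.2)) by [].
apply: cmeasB; first exact: mf.
by apply: cmeasM; [exact: cmeas_cst|exact: mg].
Qed.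

Lemma bounded_disk_subZ f g c : bounded_disk f -> bounded_disk g ->
  bounded_disk (fun z => f z - c * g z).
Proof.
move=> [M fM] [N gN]; exists (M + Normc.normc c * N) => z z1.
rewrite (le_trans (normc_triangleB _ _))// Normc.normcM lerD ?fM//.
by rewrite ler_wpM2l ?normc_ge0// gN.
Qed.

Lemma weighted_entry_eqn f :
  (forall n m, matrix_entry f n.+2 m + quad_weight n * matrix_entry f (n - 2) m =
    matrix_entry f n m.+2 + quad_weight m * matrix_entry f n (m - 2)) ->
  matrix_eqn (weighted_entry f).
Proof.
move=> e n m; rewrite /weighted_entry mulrCA -mulrDr e mulrDr; congr (_ + _).
  by rewrite mulrA divfK ?natSC_neq0.
rewrite /quad_weight; case: m => [|[|m]] /=; rewrite ?mul0r ?mulr0//.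
by rewrite subSS subSS subn0 mulrA mulrCA mulfV ?mulr1 ?natSC_neq0.
Qed.

Lemma matrix_eqn_subZ (A B : nat -> nat -> R[i]) c : matrix_eqn A -> matrix_eqn B ->
  matrix_eqn (fun n m => A n m - c * B n m).
Proof.
move=> hA hB n m; have eA := hA n m; have eB := hB n m.
transitivity ((A n.+2 m + quad_weight n * A (n - 2)%N m) - c * (B n.+2 m + quad_weight n * B (n - 2)%N m)).
  by ring.
by rewrite eA eB; case: ifP => _; ring.
Qed.

Lemma weighted_entry_cst n m : weighted_entry (fun=> 1 : R[i]) n m = (n == m)%:R.
Proof.
rewrite /weighted_entry (_ : matrix_entry _ n m = inner (mono n) (mono m)).
  rewrite inner_mono; case: eqP => [->|_]; last by rewrite mul0r mulr0.
  by rewrite mul1r mulfV ?natSC_neq0.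
by apply: eq_inner => // p _; rewrite mul1r.
Qed.

(** The condition n <= m keeps away from the lowering part of the symbol, which sits on the diagonal
    -2. *)
Lemma weighted_entry_quad n m : (n <= m)%N ->
  weighted_entry (@quad_symbol R) n m = (n.+2 == m)%:R.
Proof.
move=> nm; rewrite /weighted_entry /matrix_entry inner_quad_mono /quad_mono.
rewrite innerDl//; [|exact: pL2_mono|by apply: pL2Z; exact: pL2_mono|exact: pL2_mono].
rewrite innerZl; [|exact: pL2_mono|exact: pL2_mono].
rewrite !inner_mono [X in _ + X](_ : _ = 0).
  rewrite addr0; case: eqP => [->|_]; last by rewrite mul0r mulr0.
  by rewrite mul1r mulfV ?natSC_neq0.
rewrite /quad_weight; case: n nm => [|[|n]] nm /=; rewrite ?mul0r//.
by rewrite subSS subSS subn0 (_ : n == m = false) ?mul0r ?mulr0//; apply/eqP; lia.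
Qed.

Lemma matrix_eqn_cst : matrix_eqn (weighted_entry (fun=> 1 : R[i])).
Proof.
apply: weighted_entry_eqn => n m.
have E i j : matrix_entry (fun=> 1 : R[i]) i j = (i == j)%:R / i.+1%:R.
  by rewrite -inner_mono; apply: eq_inner => // p _; rewrite mul1r.
have t1 : true%:R = 1 :> R[i] by [].
have aux (x y : R[i]) : x != 0 -> 1 / y = x / y * (1 / x).
  by move=> x0; rewrite !mul1r mulrAC mulfV// mul1r.
rewrite !E /quad_weight; have [h1|h1] := eqVneq n.+2 m.
  rewrite -h1 /= !subSS subn0 eqxx (_ : (n - 2 == n.+2)%N = false); last by apply/eqP; lia.
  rewrite (_ : (n == n.+4)%N = false); last by apply/eqP; lia.
  by rewrite !mul0r !mulr0 ?addr0 ?add0r t1; apply: aux; exact: natSC_neq0.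
have [h2|h2] := eqVneq n m.+2.
  rewrite h2 /= !subSS subn0 eqxx (_ : (m.+2 == m - 2)%N = false); last by apply/eqP; lia.
  by rewrite !mul0r !mulr0 ?addr0 ?add0r t1; apply/esym/aux; exact: natSC_neq0.
rewrite !mul0r !add0r.
have [n2|n2] := ltnP n 2.
  rewrite (_ : n.-1 = 0%N); last by lia.
  rewrite !mul0r; have [m2|m2] := ltnP m 2; first by rewrite (_ : m.-1 = 0%N) ?mul0r//; lia.
  by rewrite (_ : (n == m - 2)%N = false) ?mul0r ?mulr0//; apply/eqP; lia.
rewrite (_ : (n - 2 == m)%N = false); last by apply/eqP; lia.
rewrite mul0r mulr0; have [m2|m2] := ltnP m 2; first by rewrite (_ : m.-1 = 0%N) ?mul0r//; lia.
by rewrite (_ : (n == m - 2)%N = false) ?mul0r ?mulr0//; apply/eqP; lia.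
Qed.

Lemma diag_reduce (A : nat -> nat -> R[i]) (N : nat) : matrix_eqn A -> diag_regular A -> diag_vanishing A ->
  (forall b : nat, vanishing (fun l => (l.*2 + b).+1%:R^-1 : R[i])) ->
  (forall n m, (n + N < m)%N -> A n m = 0) -> forall n m, (n + 2 < m)%N -> A n m = 0.
Proof.
move=> eA rA vA v1; elim: N => [|N IH] zA; first by move=> n m h; apply: zA; lia.
have [N2|N2] := leqP N.+1 2; first by move=> n m h; apply: zA; lia.
apply: IH => n m nm; have [|m2] := ltnP (n + N.+1) m; first exact: zA.
have -> : m = (n + N.+1)%N by lia.
exact: (diag_high_eq0 eA rA).
Qed.

Lemma bounded_disk_cst (c : R[i]) : bounded_disk (fun=> c).
Proof. by exists (Normc.normc c) => z _. Qed.

Lemma disk_measurable_cst (c : R[i]) : disk_measurable (fun=> c).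
Proof. by split; exact: measurable_cst. Qed.

(** 1 / (n + 1) is the diagonal entry of the constant symbol 1, so these sequences are moments of a
    bounded symbol too. *)
Lemma vanishing_inv (b : nat) : vanishing (fun l => (l.*2 + b).+1%:R^-1 : R[i]).
Proof.
apply: vanishing_eq (vanishing_matrix_entry (disk_measurable_cst 1) (bounded_disk_cst 1) 0 1 b b) => l.
rewrite mul0n add0n mul1r -[LHS]mul1r -[X in X * _](mulVf (natSC_neq0 (l.*2 + b))).
rewrite -mulrA -/(weighted_entry _ _ _) weighted_entry_cst eqxx mulr1.
by [].
Qed.

Lemma matrix_entry_commuting f N : disk_measurable f -> bounded_disk f -> truncated_above N f ->
  (forall u : R[i] -> R[i], bergman u -> forall z, unit_disk z ->
     toeplitz f (toeplitz (@quad_symbol R) u) z = toeplitz (@quad_symbol R) (toeplitz f u) z) ->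
  exists c2 c0 : R[i], forall n m,
    matrix_entry (fun z => f z - c2 * quad_symbol z - c0 * 1) n m = 0.
Proof.
move=> mf bf tf comm.
have mq := @disk_measurable_quad R; have bq := @bounded_disk_quad R.
have m1 := disk_measurable_cst 1; have b1 := bounded_disk_cst 1.
have subE g h c n m : disk_measurable g -> bounded_disk g -> disk_measurable h -> bounded_disk h ->
    weighted_entry (fun z => g z - c * h z) n m = weighted_entry g n m - c * weighted_entry h n m.
  by move=> mg bg mh bh; rewrite /weighted_entry matrix_entry_subZ//; ring.
have eq_f : matrix_eqn (weighted_entry f).
  by apply: weighted_entry_eqn; exact: matrix_entry_commute.
(* The symbol commutes with itself, so its own matrix satisfies the same relation. *)
have eq_q : matrix_eqn (weighted_entry (@quad_symbol R)).
  by apply: weighted_entry_eqn; exact: (matrix_entry_commute mq bq (fun u _ z _ => erefl)).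
have A2 : forall n m, (n + 2 < m)%N -> weighted_entry f n m = 0.
  apply: (diag_reduce (N := N)) => //.
  - exact: weighted_entry_diag_regular.
  - exact: weighted_entry_diag_vanishing.
  - exact: vanishing_inv.
  - by move=> n m nm; rewrite /weighted_entry (matrix_entry_above mf bf tf nm) mulr0.
pose c2 := weighted_entry f 0 2; pose g z := f z - c2 * quad_symbol z.
have mg : disk_measurable g by exact: disk_measurable_subZ.
have bg : bounded_disk g by exact: bounded_disk_subZ.
have gE n m : weighted_entry g n m = weighted_entry f n m - c2 * weighted_entry (@quad_symbol R) n m.
  exact: subE.
have eq_g : matrix_eqn (weighted_entry g).
  have -> : weighted_entry g = fun n m => weighted_entry f n m - c2 * weighted_entry (@quad_symbol R) n m.
    by apply/funext => n; apply/funext => m; exact: gE.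
  exact: matrix_eqn_subZ.
have reg_g : diag_regular (weighted_entry g) by exact: weighted_entry_diag_regular.
have G1 n m : (n + 1 < m)%N -> weighted_entry g n m = 0.
  move=> nm; rewrite gE weighted_entry_quad; last by lia.
  have [m2|m2] := eqVneq n.+2 m; last by rewrite A2 ?mulr0 ?subrr//; lia.
  rewrite mulr1 -m2 -addn2 (diag_const eq_f (weighted_entry_diag_regular mf bf))//.
  exact: subrr.
have G0 n m : (n + 0 < m)%N -> weighted_entry g n m = 0.
  move=> nm; have [m1'|m1'] := eqVneq m n.+1; last by apply: G1; lia.
  by rewrite m1'; exact: (diag1_eq0 eq_g reg_g).
(* The diagonal 0 of g is constant as well. The constant symbol is written c0 * 1 so as to be
   subtracted by the same lemmas as the quadratic one. *)
pose c0 := weighted_entry g 0 0; pose h z := g z - c0 * 1.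
have mh : disk_measurable h by exact: disk_measurable_subZ.
have bh : bounded_disk h by exact: bounded_disk_subZ.
have hE n m : weighted_entry h n m = weighted_entry g n m - c0 * weighted_entry (fun=> 1) n m.
  exact: subE.
have eq_h : matrix_eqn (weighted_entry h).
  have -> : weighted_entry h = fun n m => weighted_entry g n m - c0 * weighted_entry (fun=> 1) n m.
    by apply/funext => n; apply/funext => m; exact: hE.
  exact: (matrix_eqn_subZ c0 eq_g matrix_eqn_cst).
exists c2, c0 => n m.
have : weighted_entry h n m = 0.
  apply: (lower_eq0 eq_h (weighted_entry_diag_regular mh bh)) => {}n {}m nm.
  rewrite hE weighted_entry_cst; have [<-|nm'] := eqVneq n m.
    have := diag_const eq_g reg_g n G0; rewrite addn0 => ->.
    by rewrite mulr1 subrr.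
  by rewrite G0 ?mulr0 ?subrr//; lia.
move/eqP; rewrite mulf_eq0 (negbTE (natSC_neq0 m)) /= => /eqP; exact.
Qed.

(** g is orthogonal to f through the decomposition of f and its own vanishing slices, and to the
    quadratic symbol and 1 through the entries (0, 2), (2, 0) and (0, 0); being a combination of
    these three functions, it is orthogonal to itself. *)
Lemma entries_eq0_psq f fk c2 c0 : disk_measurable f -> bounded_disk f -> polar_decomposition f fk ->
  let g := fun z => f z - c2 * quad_symbol z - c0 * 1 in
  (forall n m, matrix_entry g n m = 0) ->
  psq (fun p => g (polar p)) = 0.
Proof.
move=> mf bf dec g e0.
have mq := @disk_measurable_quad R; have bq := @bounded_disk_quad R.
have m1 := disk_measurable_cst 1; have b1 := bounded_disk_cst 1.
have mg : disk_measurable g by apply: disk_measurable_subZ => //; exact: disk_measurable_subZ.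
have bg : bounded_disk g by apply: bounded_disk_subZ => //; exact: bounded_disk_subZ.
have L h : disk_measurable h -> bounded_disk h -> pL2 (fun p => h (polar p)).
  by move=> mh /bounded_diskP[M hM]; apply: pL2_bounded hM; exact: cmeas_polar.
have Lf := L _ mf bf; have Lg := L _ mg bg; have Lq := L _ mq bq; have L1 := L _ m1 b1.
have [M gM] := bounded_diskP bg.
have fg : inner (fun p => f (polar p)) (fun p => g (polar p)) = 0.
  apply: (inner_decomposition_eq0 Lf dec (cmeas_polar mg) gM) => k.
  have h1 := fourier_slice_ae0 mg bg e0 k.
  have h2 : {ae leb, forall r : R, r <> 0}.
    exists [set 0]; split => //; first exact: lebesgue_measure_set1.
    by move=> r /= /contrapT.
  apply: negligibleS (negligibleU h1 h2) => r /= nr.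
  have [r0|r0] := pselect (r = 0); first by right.
  left => h; apply: nr => r01; rewrite h ?mul0r//.
  move: r01; rewrite in_itv /= => /andP[r0' _]; rewrite lt_neqAle r0' andbT eq_sym.
  exact/eqP.
have gq : inner (fun p => g (polar p)) (fun p => quad_symbol (polar p)) = 0.
  have Lc : pL2 (fun p : T => conjc (mono 2 p)).
    apply: (@pL2_bounded R 1); first by apply: cmeas_conj; exact: cmeas_mono.
    by move=> p rp; rewrite normc_conj; exact: normc_mono_le1.
  have -> : inner (fun p => g (polar p)) (fun p => quad_symbol (polar p)) =
      inner (fun p => g (polar p)) (fun p => mono 2 p - (- 1) * conjc (mono 2 p)).
    by apply: eq_inner => // p _; rewrite /quad_symbol /mono conjcX; ring.
  rewrite (innerBr (pL2_mono 2) (pL2Z (-1) Lc) Lg) (innerZr (-1) Lc Lg) (_ : inner _ (mono 2) = matrix_entry g 0 2); last first.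
    by apply: eq_inner => // p _; rewrite /mono expr0 mulr1.
  rewrite (_ : inner _ (fun p => conjc (mono 2 p)) = matrix_entry g 2 0); last first.
    by apply: eq_cint => p _; rewrite /mono expr0 conjcK conjc1 mulr1.
  by rewrite !e0 mulr0 subr0.
have g1 : inner (fun p => g (polar p)) (fun=> 1) = 0.
  rewrite -(e0 0%N 0%N); apply: eq_inner => p _; last by rewrite /mono expr0.
  by rewrite /mono expr0 mulr1.
have gg : inner (fun p => g (polar p)) (fun p => g (polar p)) = 0.
  transitivity (inner (fun p => f (polar p) - c2 * quad_symbol (polar p) - c0 * 1) (fun p => g (polar p))) => //.
  rewrite (innerBl (pL2B Lf (pL2Z c2 Lq)) (pL2Z c0 L1) Lg) (innerBl Lf (pL2Z c2 Lq) Lg).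
  rewrite (innerZl c2 Lq Lg) (innerZl c0 L1 Lg) fg [inner (fun p => quad_symbol (polar p)) _]innerC// gq.
  by rewrite [inner (fun=> 1) _]innerC// g1 conjc0 !mulr0 !subr0.
by move: gg; rewrite inner_self// => /(congr1 (@complex.Re R)).
Qed.

(** The two symbols agree in norm while u may be unbounded; moving u to the second argument, where
    conj u z^n is square-integrable, lets the null difference be used. *)
Lemma toeplitz_eq f c2 c0 u : disk_measurable f -> bounded_disk f -> bergman u ->
  psq (fun p => f (polar p) - c2 * quad_symbol (polar p) - c0 * 1) = 0 ->
  forall z, unit_disk z -> toeplitz f u z = c2 * toeplitz (@quad_symbol R) u z + c0 * u z.
Proof.
move=> mf bf bu g0.
have mq := @disk_measurable_quad R; have bq := @bounded_disk_quad R.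
have Lu := bergman_pL2 bu.
have Lfu := pL2_bounded_mul mf bf Lu; have Lqu := pL2_bounded_mul mq bq Lu.
have bT : bergman (toeplitz f u) by exact: bergman_proj_bergman.
have bQ : bergman (toeplitz (@quad_symbol R) u) by exact: bergman_proj_bergman.
have LQ := bergman_pL2 bQ.
apply: bergman_ext.
- exact: bergman_cderivable.
- move=> w w1; apply: cderivableD; apply: cderivableM; try exact: cderivable_cst.
    exact: (bergman_cderivable bQ).
  exact: (bergman_cderivable bu).
- exact: bergman_pL2.
- by apply: pL2D; exact: pL2Z.
move=> n; rewrite inner_toeplitz// innerDl//; [|exact: pL2Z|exact: pL2Z|exact: pL2_mono].
rewrite !innerZl ?inner_toeplitz//; try exact: pL2_mono.
have Lum : pL2 (fun p => conjc (u (polar p)) * mono n p).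
  have Lcu : pL2 (fun p => conjc (u (polar p))).
    split; first by apply: cmeas_conj; exact: pL2_meas.
    rewrite (_ : polar_sqnorm _ = polar_sqnorm (fun p => u (polar p))); first by have [] := Lu.
    by apply: eq_integral => p _; rewrite normc_conj.
  have := pL2_bmul (cmeas_mono n) (@normc_mono_le1 R n) Lcu.
  by apply: eq_pL2 => p _; rewrite mulrC.
have L h : disk_measurable h -> bounded_disk h -> pL2 (fun p => h (polar p)).
  by move=> mh /bounded_diskP[M hM]; apply: pL2_bounded hM; exact: cmeas_polar.
have Lf := L _ mf bf; have Lq := L _ mq bq.
have sw (h : T -> R[i]) : inner (fun p => h p * u (polar p)) (mono n) = inner h (fun p => conjc (u (polar p)) * mono n p).
  by apply: eq_cint => p _; rewrite conjcM conjcK; congr (_ * _); rewrite mulrA.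
rewrite (sw (fun p => f (polar p))) (sw (fun p => quad_symbol (polar p))).
have -> : inner (fun p => u (polar p)) (mono n) = inner (fun=> 1) (fun p => conjc (u (polar p)) * mono n p).
  by rewrite -sw; apply: eq_inner => // p _; rewrite mul1r.
have L1 : pL2 (fun=> 1 : R[i]) by exact: pL2_cst.
rewrite -!innerZl// -innerDl//; [|exact: pL2Z|exact: pL2Z].
apply: inner_psq0 => //; first by apply: pL2D; exact: pL2Z.
rewrite -g0; apply: eq_psq => p _; ring.
Qed.

End Symbols.

Theorem theorem3 (R : realType) (N : nat) (N_gt0 : (0 < N)%N)
    (f : R[i] -> R[i])
    (f_meas : disk_measurable f) (f_bnd : bounded_disk f)
    (f_trunc : truncated_above N f)
    (f_comm : forall u : R[i] -> R[i], bergman u ->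
       forall z, unit_disk z ->
         toeplitz f (toeplitz (@quad_symbol R) u) z =
         toeplitz (@quad_symbol R) (toeplitz f u) z) :
  exists c2 c0 : R[i],
    (forall u : R[i] -> R[i], bergman u ->
       forall z, unit_disk z ->
         toeplitz f u z = c2 * toeplitz (@quad_symbol R) u z + c0 * u z) /\
    ae_disk (fun z => f z = c2 * quad_symbol z + c0).
Proof.
have [c2 [c0 e0]] := matrix_entry_commuting f_meas f_bnd f_trunc f_comm.
have [fk [dec _]] := f_trunc.
have g0 := entries_eq0_psq f_meas f_bnd dec e0.
exists c2, c0; split; first by move=> u bu; exact: (toeplitz_eq f_meas f_bnd bu g0).
have mg : disk_measurable (fun z => f z - c2 * quad_symbol z - c0 * 1).
  apply: disk_measurable_subZ; last exact: disk_measurable_cst.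
  by apply: disk_measurable_subZ => //; exact: disk_measurable_quad.
have bg : bounded_disk (fun z => f z - c2 * quad_symbol z - c0 * 1).
  apply: bounded_disk_subZ; last exact: bounded_disk_cst.
  by apply: bounded_disk_subZ => //; exact: bounded_disk_quad.
have [M gM] := bounded_diskP bg.
have Lg := pL2_bounded (cmeas_polar mg) gM.
apply: negligibleS (psq_ae_eq0 (cmeas_polar mg) Lg.2 g0) => p /= np h; apply: np => rp.
move/eqP: (h rp); rewrite mulr1 subr_eq0 subr_eq => /eqP ->; exact: addrC.
Qed.
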